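(* Fix $(\varepsilon_1,\varepsilon_2)\in(0,1)^2$, $P>0$, $\alpha\in(0,1)$, and let $\dagger\in\{\mathrm{SIC},\mathrm{JNN}\}$. Let $(L_1,L_2)\in\mathbb{R}^2$ satisfy $$L_1\ge \sqrt{\mathrm{V}_1(\alpha P)}\,Q^{-1}(\varepsilon_1),\qquad L_2\ge \sqrt{\mathrm{V}_2(\bar\alpha P,\alpha P)}\,Q^{-1}(\varepsilon_2).$$ Then there exist sequences of codebook sizes $M_{1,n},M_{2,n}$ such that the random spherical-codebook $(n,M_{1,n},M_{2,n})$-$\dagger$ codes satisfy $$\limsup_{n\to\infty}\frac{1}{\sqrt n}\Big(n\,\mathrm{C}\big(\tfrac{\alpha P}{\beta}\big)-\log M_{1,n}\Big)\le L_1,\qquad \limsup_{n\to\infty}\frac{1}{\sqrt n}\Big(n\,\mathrm{C}\big(\tfrac{\bar\alpha P}{\alpha P+1}\big)-\log M_{2,n}\Big)\le L_2,$$ and $\limsup_{n\to\infty}\mathrm{P}^n_{\mathrm{e},i}\le\varepsilon_i$ for each $i\in\{1,2\}$ (i.e., $(L_1,L_2)$ is second-order achievable under the separate error probability criterion, for both SIC and JNN decoding at user 1).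
   Context: Setup (two-user broadcast channel with degraded message sets and additive, not necessarily Gaussian, noise). Fix $n\in\mathbb{N}$, power $P>0$, power split $\alpha\in(0,1)$ with $\bar\alpha=1-\alpha$, and $\beta\in(0,1)$. Outputs: $Y_1^n=X^n+Z_1^n$ (user 1, strong) and $Y_2^n=X^n+Z_2^n$ (user 2, weak), where $Z_{1,1},\dots,Z_{1,n}$ are i.i.d. with an arbitrary distribution satisfying $\mathbb{E}[Z_1^2]=\beta$, $\zeta_1:=\mathbb{E}[Z_1^4]<\infty$, $\mathbb{E}[Z_1^6]<\infty$, and $Z_{2,1},\dots,Z_{2,n}$ are i.i.d. with an arbitrary distribution satisfying $\mathbb{E}[Z_2^2]=1$, $\zeta_2:=\mathbb{E}[Z_2^4]<\infty$, $\mathbb{E}[Z_2^6]<\infty$; the noise is independent of messages and codebooks. Random code: codewords $V^n(1),\dots,V^n(M_1)$ are i.i.d. uniform on the sphere $\{v\in\mathbb{R}^n:\|v\|^2=n\alpha P\}$, codewords $U^n(1),\dots,U^n(M_2)$ are i.i.d. uniform on the sphere $\{u\in\mathbb{R}^n:\|u\|^2=n\bar\alpha P\}$, all independent. Messages $W_1,W_2$ are independent and uniform on $[M_1]$, $[M_2]$; the transmitted signal is $X^n=V^n(W_1)+U^n(W_2)$. User 2 decodes $\hat W_2=\arg\min_{w_2}\|Y_2^n-U^n(w_2)\|^2$. Under SIC, user 1 decodes $\bar W_2=\arg\min_{w_2}\|Y_1^n-U^n(w_2)\|^2$ and then $\hat W_1=\arg\min_{w_1}\|Y_1^n-U^n(\bar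 W_2)-V^n(w_1)\|^2$. Under JNN, user 1 decodes $(\hat W_1,\bar W_2)=\arg\min_{(w_1,w_2)}\|Y_1^n-U^n(w_2)-V^n(w_1)\|^2$. Ensemble error probabilities (averaged over messages, codebooks and noise): $\mathrm{P}^n_{\mathrm{e},1}=\Pr\{\hat W_1\ne W_1\text{ or }\bar W_2\ne W_2\}$, $\mathrm{P}^n_{\mathrm{e},2}=\Pr\{\hat W_2\ne W_2\}$. Notation: $\mathrm{C}(x)=\frac12\log(1+x)$ (natural log); $Q$ is the standard Gaussian complementary cdf and $Q^{-1}$ its inverse. Dispersions: $$\mathrm{V}_1(\alpha P)=\frac{(\alpha P)^2(\zeta_1-\beta^2)+4\alpha P\beta^3}{4\beta^2(\alpha P+\beta)^2},\qquad \mathrm{V}_2(\bar\alpha P,\alpha P)=\frac{(\bar\alpha P)^2(\zeta_2-1+4\alpha P)+4\bar\alpha P(\alpha P+1)^3}{4(\alpha P+1)^2(P+1)^2}.$$ *)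

(* Defs.v *)
From HB Require Import structures.
From mathcomp Require Import all_boot all_order all_algebra.
From mathcomp Require Import all_classical all_reals all_analysis.
Set Implicit Arguments. Unset Strict Implicit. Unset Printing Implicit Defensive.
Import Order.TTheory GRing.Theory Num.Theory.
Import numFieldNormedType.Exports.
Local Open Scope classical_set_scope.
Local Open Scope ring_scope.

Definition capC {R : realType} (x : R) : R := ln (1 + x) / 2.

Definition Qfun {R : realType} (x : R) : R := fine (normal_prob 0 1 `]x, +oo[%classic).
Definition Qinv {R : realType} (e : R) : R := xget 0 [set x | Qfun x = e].

Definition V1 {R : realType} (beta zeta1 aP : R) : R :=
  (aP ^+ 2 * (zeta1 - beta ^+ 2) + 4 * aP * beta ^+ 3) /
  (4 * beta ^+ 2 * (aP + beta) ^+ 2).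
Definition V2 {R : realType} (zeta2 baP aP : R) : R :=
  (baP ^+ 2 * (zeta2 - 1 + 4 * aP) + 4 * baP * (aP + 1) ^+ 3) /
  (4 * (aP + 1) ^+ 2 * (baP + aP + 1) ^+ 2).
(* note: P = baP + aP, so (P+1) = baP + aP + 1 *)

(* vectors in R^n are n.-tuple R (product sigma-algebra) *)
Definition sqnorm {R : realType} {n : nat} (x : 'I_n -> R) : R :=
  \sum_(i < n) x i ^+ 2.
Definition sqdist {R : realType} {n : nat} (x y : 'I_n -> R) : R :=
  \sum_(i < n) (x i - y i) ^+ 2.

Definition mxact {R : realType} {n : nat} (O : 'M[R]_n) (x : n.-tuple R) : n.-tuple R :=
  [tuple \sum_(j < n) O i j * tnth x j | i < n].

Definition orthogonal_mx {R : realType} {n : nat} (O : 'M[R]_n) : Prop :=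
  O *m O^T = 1%:M.

(* X is uniformly distributed on the sphere {x : ||x||^2 = r2}: it lies on the sphere a.s.
   and its law is invariant under every orthogonal transformation (the normalized
   surface measure is the unique such probability). *)
Definition uniform_sphere {R : realType} {d} {T : measurableType d}
  (Pr : probability T R) {n : nat} (X : T -> n.-tuple R) (r2 : R) : Prop :=
  Pr (X @^-1` [set x | sqnorm (tnth x) = r2]) = 1%E /\
  forall O : 'M[R]_n, orthogonal_mx O ->
    forall A : set (n.-tuple R), measurable A ->
      Pr ((fun w => mxact O (X w)) @^-1` A) = Pr (X @^-1` A).

Definition preim_events {d} {T : measurableType d} {d'} {U : measurableType d'}
  (X : T -> U) : set (set T) := [set X @^-1` A | A in measurable].

Definition mutually_independent {R : realType} {d} {T : measurableType d}
  (Pr : probability T R) {I : finType} (F : I -> set (set T)) : Prop :=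
  forall (J : {set I}) (E : I -> set T),
    (forall j, j \in J -> F j (E j)) ->
    Pr (\bigcap_(j in [set j | j \in J]) E j) = (\prod_(j in J) Pr (E j))%E.

Definition bc_model {R : realType} {d} {T : measurableType d} (Pr : probability T R)
  (n M1 M2 : nat) (alpha P : R) (mu : probability R R)
  (Z : 'I_n -> T -> R) (V : 'I_M1 -> T -> n.-tuple R) (U : 'I_M2 -> T -> n.-tuple R) : Prop :=
  (forall k, measurable_fun setT (Z k)) /\
  (forall k A, measurable A -> Pr (Z k @^-1` A) = mu A) /\
  (forall m, measurable_fun setT (V m)) /\
  (forall m, measurable_fun setT (U m)) /\
  (forall m, uniform_sphere Pr (V m) (n%:R * alpha * P)) /\
  (forall m, uniform_sphere Pr (U m) (n%:R * (1 - alpha) * P)) /\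
      mutually_independent Pr
        (fun i : ('I_n + ('I_M1 + 'I_M2))%type =>
           match i with
           | inl k => preim_events (Z k)
           | inr (inl m) => preim_events (V m)
           | inr (inr m) => preim_events (U m)
           end).

Inductive decoder := SIC | JNN.

Section errors.
Context {R : realType} {T : Type} {n M1 M2 : nat}.
Variables (Z : 'I_n -> T -> R) (V : 'I_M1 -> T -> n.-tuple R) (U : 'I_M2 -> T -> n.-tuple R).

Definition received (w1 : 'I_M1) (w2 : 'I_M2) (w : T) : 'I_n -> R :=
  fun i => tnth (V w1 w) i + tnth (U w2 w) i + Z i w.

(* Minimum-distance decoding; a tie with a wrong candidate is counted as an error. *)
(* weak user: decode w2 treating V as noise *)
Definition err_weak (w1 : 'I_M1) (w2 : 'I_M2) : set T :=
  [set w | exists w2' : 'I_M2, w2' != w2 /\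
     sqdist (received w1 w2 w) (tnth (U w2' w)) <= sqdist (received w1 w2 w) (tnth (U w2 w))].

Definition err_strong_SIC (w1 : 'I_M1) (w2 : 'I_M2) : set T :=
  err_weak w1 w2 `|`
  [set w | exists w1' : 'I_M1, w1' != w1 /\
     sqdist (fun i => received w1 w2 w i - tnth (U w2 w) i) (tnth (V w1' w)) <=
     sqdist (fun i => received w1 w2 w i - tnth (U w2 w) i) (tnth (V w1 w))].

Definition err_strong_JNN (w1 : 'I_M1) (w2 : 'I_M2) : set T :=
  [set w | exists (w1' : 'I_M1) (w2' : 'I_M2), (w1' != w1 \/ w2' != w2) /\
     sqdist (received w1 w2 w) (fun i => tnth (U w2' w) i + tnth (V w1' w) i) <=
     sqdist (received w1 w2 w) (fun i => tnth (U w2 w) i + tnth (V w1 w) i)].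

Definition err_strong (dec : decoder) :=
  match dec with SIC => err_strong_SIC | JNN => err_strong_JNN end.
End errors.

Definition avg_err {R : realType} {d} {T : measurableType d} (Pr : probability T R)
  {M1 M2 : nat} (E : 'I_M1 -> 'I_M2 -> set T) : \bar R :=
  (((M1 * M2)%:R)^-1%:E * \sum_(w1 < M1) \sum_(w2 < M2) Pr (E w1 w2))%E.

(* Main.v *)
Require Import Defs.
From HB Require Import structures.
From mathcomp Require Import all_boot all_order all_algebra.
From mathcomp Require Import all_classical all_reals all_analysis.
From mathcomp Require Import measurable_realfun.
From mathcomp Require Import ring lra zify.
Import Order.TTheory GRing.Theory Num.Theory.
Import numFieldNormedType.Exports.
Local Open Scope classical_set_scope.
Local Open Scope ring_scope.
Set Implicit Arguments. Unset Strict Implicit. Unset Printing Implicit Defensive.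

(* An independent codeword X, uniform on a sphere of R^n, has with a fixed vector y a
   squared cosine rho^2 satisfying E (1 - s rho^2)^(-m) <= 1 / (1 - s) for s < 1 and
   m <= n / 2 (moments of the sphere and the negative binomial series). Since
   (1 - rho^2) |y|^2 <= |y - X|^2, Markov's inequality with s = 1 - 1/n shows that the
   probability of confusion with one of M wrong codewords is at most
   Pr (|N|^2 > x |Y|^2) + M n^2 (x + 3/n)^(n/2), Y being the output and N the noise.
   When the rate is below capacity, x can be a constant and Chebyshev's inequality
   suffices. At capacity, x = s2/(S + s2) (1 + 2 l / sqrt n), and |N|^2 > x |Y|^2 is a
   tail event of sqrt n (S (|N|^2/n - s2) - 2 s2 <X, N>/n), whose Gaussian limit comes
   from Lindeberg's replacement argument: the heat evolution u(t, x) = Phi (x / sqrt t)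
   absorbs one small centred term at a time. To apply it to <X, y>, the vector y is
   rotated to have equal coordinates and the signs of the coordinates of X are flipped
   one by one; the conditional variances then add up to |X|^2 |y|^2 / n exactly. *)

(** Since s2/(S + s2) = exp (-2 C) for the capacity C, the power n/2 of x cancels the codebook size
    exp (n C - L sqrt n) up to n^2 exp ((l - L) sqrt n), which vanishes as soon as l < L. The choice
    of s costs (1 - s)^-1 = n per wrong codeword and O (1/n) in x; a JNN error in both messages
    involves two wrong codewords, hence n^2 and 3/n.

    For user 1 only the confusion of V, with the true U removed, occurs at capacity. As beta < 1,
    every event with a wrong U has a rate strictly below what user 1 can support, so eps1 is spent
    on V1 alone, for SIC as for JNN.

    The obstacle to a classical limit theorem is that the coordinates of a codeword are dependent
    and that the variance of <X, N> given N is random. The heat evolution deals with both: times add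
    up, so Gaussian approximations can be composed by conditioning, and it is Lipschitz in time, so
    a random variance may be replaced by its limit. Achievability needs upper bounds only, so nearly
    everything is one-sided and about integrals of nonnegative functions. *)

(** * Integrals of nonnegative functions *)

Section expectation_tools.
Context {R : realType}.

(** With the convention 0^-1 = 0 one has f^-1 = f (f^2)^-1 everywhere; f^2 is nonnegative, so its
    inverse is a real power, hence measurable. *)
Lemma measurable_funV d (T : measurableType d) (f : T -> R) :
  measurable_fun setT f -> measurable_fun setT (fun x => (f x)^-1).
Proof.
move=> mf.
have -> : (fun x => (f x)^-1) = (fun x => f x * powR (f x ^+ 2) (-1)).
  apply/funext => x; rewrite powR_inv1 ?sqr_ge0//.
  have [->|f0] := eqVneq (f x) 0; first by rewrite invr0 mul0r.
  by field.
apply: measurable_funM => //.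
by apply: (measurableT_comp (@measurable_powR R (-1))); exact: measurable_funX.
Qed.

Section one_measure.
Context d (T : measurableType d) (mu : {measure set T -> \bar R}).

Lemma le_EX (f g : T -> R) : (forall x, 0 <= f x) ->
  measurable_fun setT f -> measurable_fun setT g -> (forall x, f x <= g x) ->
  (\int[mu]_x (f x)%:E <= \int[mu]_x (g x)%:E)%E.
Proof.
move=> f0 mf mg fg; apply: ge0_le_integral => //.
- by move=> x _; rewrite lee_fin.
- exact/measurable_EFinP.
- exact/measurable_EFinP.
- by move=> x _; rewrite lee_fin.
Qed.

Lemma le_EX_ae (D : set T) (f g : T -> R) : measurable D -> mu (~` D) = 0%E ->
  (forall x, 0 <= f x) -> (forall x, 0 <= g x) ->
  measurable_fun setT f -> measurable_fun setT g -> (forall x, D x -> f x <= g x) ->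
  (\int[mu]_x (f x)%:E <= \int[mu]_x (g x)%:E)%E.
Proof.
move=> mD D0 f0 g0 mf mg fg; apply: ae_ge0_le_integral => //.
- by move=> x _; rewrite lee_fin.
- exact/measurable_EFinP.
- by move=> x _; rewrite lee_fin.
- exact/measurable_EFinP.
- exists (~` D); split => //; first exact: measurableC.
  move=> x /= h Dx; apply: h => _; rewrite lee_fin; exact: fg.
Qed.

Lemma EX_D (f g : T -> R) : (forall x, 0 <= f x) -> (forall x, 0 <= g x) ->
  measurable_fun setT f -> measurable_fun setT g ->
  (\int[mu]_x (f x + g x)%:E = \int[mu]_x (f x)%:E + \int[mu]_x (g x)%:E)%E.
Proof.
move=> f0 g0 mf mg; under eq_integral do rewrite EFinD.
rewrite ge0_integralD//; try exact/measurable_EFinP.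
- by move=> x _; rewrite lee_fin.
- by move=> x _; rewrite lee_fin.
Qed.

Lemma EX_Zl (c : R) (f : T -> R) : 0 <= c -> (forall x, 0 <= f x) ->
  measurable_fun setT f ->
  (\int[mu]_x (c * f x)%:E = c%:E * \int[mu]_x (f x)%:E)%E.
Proof.
move=> c0 f0 mf; under eq_integral do rewrite EFinM.
rewrite ge0_integralZl//; try exact/measurable_EFinP.
by move=> x _; rewrite lee_fin.
Qed.

Lemma EX_sum (I : Type) (s : seq I) (f : I -> T -> R) :
  (forall i x, 0 <= f i x) -> (forall i, measurable_fun setT (f i)) ->
  (\int[mu]_x (\sum_(i <- s) f i x)%:E = \sum_(i <- s) \int[mu]_x (f i x)%:E)%E.
Proof.
move=> f0 mf; under eq_integral do rewrite -sumEFin.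
rewrite ge0_integral_sum// => i; first exact/measurable_EFinP.
by move=> x _; rewrite lee_fin.
Qed.

Lemma markov_EX (c : R) (f : T -> R) (A : set T) : 0 < c -> (forall x, 0 <= f x) ->
  measurable_fun setT f -> measurable A -> (forall x, A x -> c <= f x) ->
  (mu A <= (c^-1)%:E * \int[mu]_x (f x)%:E)%E.
Proof.
move=> c0 f0 mf mA cf.
have c0' : 0 <= c^-1 by rewrite invr_ge0 ltW.
rewrite -EX_Zl//.
have -> : mu A = (\int[mu]_x (\1_A x : R)%:E)%E.
  by rewrite integral_indic// setIT.
apply: le_EX => //.
- exact: measurable_funM.
- move=> x; rewrite indicE; case: (boolP (x \in A)) => [|_].
    by rewrite inE => /cf h /=; rewrite mulrC ler_pdivlMr// mul1r.
  exact: mulr_ge0.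
Qed.

End one_measure.

Lemma EX_cst d (T : measurableType d) (Pr : probability T R) (c : R) :
  (\int[Pr]_x c%:E = c%:E)%E.
Proof.
apply: etrans; first exact: (integral_cst Pr measurableT c%:E).
by apply: (eq_trans _ (mule1 _)); congr (_ * _)%E; exact: probability_setT.
Qed.

End expectation_tools.

(** * Independence of random maps and of generated sigma-algebras *)

Section independence.
Context {R : realType} d (T : measurableType d) (Pr : probability T R).

Definition indep_maps d1 (D1 : measurableType d1) d2 (D2 : measurableType d2)
    (X : T -> D1) (Y : T -> D2) :=
  forall A B, measurable A -> measurable B ->
  Pr (X @^-1` A `&` Y @^-1` B) = (Pr (X @^-1` A) * Pr (Y @^-1` B))%E.

Section fubini.
Context d1 (D1 : measurableType d1) d2 (D2 : measurableType d2).
Variables (X : T -> D1) (Y : T -> D2).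
Hypotheses (mX : measurable_fun setT X) (mY : measurable_fun setT Y).
Hypothesis iXY : indep_maps X Y.

Let XY w := (X w, Y w).

Let mXY : measurable_fun setT XY.
Proof. exact: measurable_fun_pair. Qed.

HB.instance Definition _ := @isMeasurableFun.Build _ _ T D1 X mX.
HB.instance Definition _ := @isMeasurableFun.Build _ _ T D2 Y mY.
HB.instance Definition _ := @isMeasurableFun.Build _ _ T (D1 * D2)%type XY mXY.

(** The joint law and the product of the marginals agree on rectangles, hence everywhere, and
    Tonelli's theorem applies. The inner integral averages over X with Y frozen. *)
Lemma indep_fubini (F : D1 * D2 -> R) : (forall z, 0 <= F z) ->
  measurable_fun setT F ->
  (\int[Pr]_w (F (X w, Y w))%:E
   = \int[Pr]_w' (\int[Pr]_w (F (X w, Y w'))%:E))%E.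
Proof.
move=> F0 mF.
have mEF : measurable_fun setT (EFin \o F) by exact/measurable_EFinP.
have EF0 z : (0 <= (EFin \o F) z)%E by rewrite lee_fin.
pose PX := distribution Pr (X : {mfun T >-> D1}).
pose PY := distribution Pr (Y : {mfun T >-> D2}).
pose PXY := distribution Pr (XY : {mfun T >-> (D1 * D2)%type}).
have -> : (\int[Pr]_w (F (X w, Y w))%:E = \int[PXY]_z (F z)%:E)%E.
  by rewrite ge0_integral_distribution.
have -> : (\int[PXY]_z (F z)%:E = \int[(PX \x PY)%E]_z (F z)%:E)%E.
  apply: eq_measure_integral => /= A mA _.
  apply/esym; apply: (product_measure_unique (m' := PXY)) => //.
rewrite (fubini_tonelli2 (EFin \o F))//.
rewrite /PY ge0_integral_distribution//=; last 2 first.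
- exact: measurable_fun_fubini_tonelli_G.
- by move=> y; apply: integral_ge0 => x _; exact: EF0.
apply: eq_integral => w _; rewrite /fubini_G /= ge0_integral_distribution//.
- exact/measurable_EFinP/(measurableT_comp mF)/measurable_fun_pair.
- by move=> x; exact: (EF0 (x, Y w)).
Qed.

(** This is how conditioning is done throughout: an estimate for each frozen y may be used with Y in
    place of y. *)
Lemma indep_le (F : D1 * D2 -> R) (g : D2 -> R) : (forall z, 0 <= F z) ->
  measurable_fun setT F -> measurable_fun setT g ->
  (forall y, \int[Pr]_w (F (X w, y))%:E <= (g y)%:E)%E ->
  (\int[Pr]_w (F (X w, Y w))%:E <= \int[Pr]_w (g (Y w))%:E)%E.
Proof.
move=> F0 mF mg Fg; rewrite indep_fubini//.
apply: ge0_le_integral => //.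
- by move=> w _; apply: integral_ge0 => x _; rewrite lee_fin.
- have mEF : measurable_fun setT (EFin \o F) by exact/measurable_EFinP.
  pose PX := distribution Pr (X : {mfun T >-> D1}).
  have -> : (fun w' => \int[Pr]_w (F (X w, Y w'))%:E)%E = (fubini_G PX (EFin \o F)) \o Y.
    apply/funext => w'; rewrite /fubini_G /= ge0_integral_distribution//.
      exact/measurable_EFinP/(measurableT_comp mF)/measurable_fun_pair.
    by move=> x; rewrite lee_fin.
  apply: measurableT_comp => //.
  by apply: measurable_fun_fubini_tonelli_G => // z; rewrite lee_fin.
- exact/measurable_EFinP/measurableT_comp.
Qed.

End fubini.

Section pi_lambda.
Context (I : finType) (F : I -> set (set T)).
Hypothesis Fm : forall i, F i `<=` measurable.
Hypothesis FT : forall i, F i setT.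
Hypothesis FI : forall i, setI_closed (F i).

Definition sigma_of (J : {set I}) : set (set T) :=
  \bigcup_(j in [set j | j \in J]) F j.

(** Dynkin's argument: on intersections of events with indices in J, which form a pi-system, the
    probability of the intersection with B and Pr B times the probability are two finite measures
    that agree by mutual independence; hence they agree on the generated sigma-algebra. *)
Lemma mutually_independent_sigma (J : {set I}) k A B :
  mutually_independent Pr F -> k \notin J ->
  <<s sigma_of J >> A -> F k B -> Pr (A `&` B) = (Pr A * Pr B)%E.
Proof.
move=> mi kJ sA FB.
pose G : set (set T) := [set A | exists E : I -> set T, (forall j, F j (E j)) /\
   A = \bigcap_(j in [set j | j \in J]) E j].
have mB : measurable B by exact: (@Fm k).
have mG : G `<=` measurable.
  move=> _ [E [FE ->]]; apply: fin_bigcap_measurable => //.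
  by move=> j _; exact: (@Fm j).
have GT : G setT by exists (fun _ => setT); split => //; rewrite bigcapT.
have GI : setI_closed G.
  move=> _ _ [E [FE ->]] [E' [FE' ->]]; exists (fun j => E j `&` E' j).
  by split; [move=> j; exact: FI|rewrite bigcapI].
have sub : <<s sigma_of J >> `<=` <<s G >>.
  apply: smallest_sub; first exact: smallest_sigma_algebra.
  move=> C [j /= jJ FC]; apply: sub_sigma_algebra.
  exists (fun i => if i == j then C else setT); split.
    by move=> i; case: eqP => [->|].
  apply/seteqP; split => [x Cx i _ /=|x]; first by case: eqP.
  by move=> /(_ j jJ) /=; rewrite eqxx.
have [B0 B1] : (0 <= fine (Pr B))%R /\ Pr B = (fine (Pr B))%:E.
  by split; [exact: fine_ge0|rewrite fineK// fin_num_measure].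
have := @g_sigma_algebra_measure_unique _ R T G mG (fun _ => setT) (fun _ => GT) _
  (mrestr Pr mB) (mscale (NngNum B0) Pr) GI _ _ A (sub _ sA).
move=> H; transitivity (mrestr Pr mB A) => //; rewrite H.
- by transitivity ((fine (Pr B))%:E * Pr A)%E => //; rewrite -B1 muleC.
- by rewrite bigcup_const//; exists 0%N.
- move=> _ [E [FE ->]].
  (* [B] is inserted at the index k, which lies outside J, so the product formula over J with k
     added gives the agreement on [G]. *)
  pose E' j := if j == k then B else E j.
  have E'k : E' k = B by rewrite /E' eqxx.
  have E'j j : j \in J -> E' j = E j.
    by move=> jJ; rewrite /E'; case: eqP => // jk; rewrite -jk jJ in kJ.
  have FE' j : F j (E' j) by rewrite /E'; case: eqP => [->|].
  have := mi (k |: J) E' (fun j _ => FE' j).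
  rewrite big_setU1//= E'k (eq_bigr (fun j => Pr (E j))); last first.
    by move=> j /E'j ->.
  have -> : \bigcap_(j in [set j | j \in k |: J]) E' j =
            (\bigcap_(j in [set j | j \in J]) E j) `&` B.
    apply/seteqP; split => x.
      move=> h; split => [j /= jJ|].
        by rewrite -E'j//; apply: h; rewrite /= in_setU1 jJ orbT.
      by rewrite -E'k; apply: h; rewrite /= setU11.
    move=> [h Bx] j /=; rewrite in_setU1 => /orP[/eqP ->|jJ]; first by rewrite E'k.
    by rewrite E'j//; exact: h.
  move=> e; transitivity (Pr (\bigcap_(j in [set j | j \in J]) E j `&` B)) => //.
  transitivity ((fine (Pr B))%:E * Pr (\bigcap_(j in [set j | j \in J]) E j))%E => //.
  by rewrite e -B1; congr (_ * _)%E; apply/esym/mi.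
- move=> _; apply: (@le_lt_trans _ _ 1%E); last exact: ltry.
  by apply: probability_le1; exact: measurableI.
Qed.

Lemma indep_maps_sigma d1 (D1 : measurableType d1) d2 (D2 : measurableType d2)
    (X : T -> D1) (Y : T -> D2) (J : {set I}) k :
  mutually_independent Pr F -> k \notin J -> preim_events X `<=` F k ->
  (forall B, measurable B -> <<s sigma_of J >> (Y @^-1` B)) ->
  indep_maps X Y.
Proof.
move=> mi kJ XF YJ A B mA mB; rewrite setIC muleC.
by apply: (mutually_independent_sigma mi kJ); [exact: YJ|apply: XF; exists A].
Qed.

End pi_lambda.
End independence.

(** * Uniform points of the sphere *)

Section rotations.
Context {R : realType} {n : nat}.
Implicit Types (x y : n.-tuple R) (O : 'M[R]_n).

Definition dotp x y : R := \sum_(i < n) tnth x i * tnth y i.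

Definition colv x : 'cV[R]_n := \col_i tnth x i.

Lemma colv_inj : injective colv.
Proof.
move=> x y e; apply: eq_from_tnth => i.
by have := congr1 (fun M : 'cV[R]_n => M i 0) e; rewrite !mxE.
Qed.

Lemma colv_mxact O x : colv (mxact O x) = O *m colv x.
Proof.
apply/colP => i; rewrite !mxE tnth_mktuple.
by apply: eq_bigr => j _; rewrite mxE.
Qed.

Lemma dotpE x y : dotp x y = ((colv x)^T *m colv y) 0 0.
Proof. by rewrite mxE; apply: eq_bigr => i _; rewrite !mxE. Qed.

Lemma dotpC x y : dotp x y = dotp y x.
Proof. by apply: eq_bigr => i _; rewrite mulrC. Qed.

Lemma sqnorm_dotp x : sqnorm (tnth x) = dotp x x.
Proof. by apply: eq_bigr => i _; rewrite expr2. Qed.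

Lemma sqnorm_ge0 (x : 'I_n -> R) : 0 <= sqnorm x.
Proof. by apply: sumr_ge0 => i _; exact: sqr_ge0. Qed.

Lemma dotp_mxact O x y : dotp (mxact O x) y = dotp x (mxact O^T y).
Proof. by rewrite !dotpE !colv_mxact trmx_mul mulmxA. Qed.

(* The Householder reflection along y - y' exchanges y and y'. *)
Lemma exists_orthogonal_mx y y' : sqnorm (tnth y) = sqnorm (tnth y') ->
  exists O, [/\ orthogonal_mx O, O^T = O & mxact O y' = y].
Proof.
rewrite !sqnorm_dotp => yy'.
have [->|neq] := eqVneq y' y.
  exists 1%:M; split; rewrite /orthogonal_mx ?trmx1 ?mulmx1//.
  by apply: colv_inj; rewrite colv_mxact mul1mx.
pose v := colv y' - colv y.
pose a := (v^T *m v) 0 0.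
have vv : v^T *m v = a%:M by apply/matrixP => i j; rewrite !ord1 [RHS]mxE eqxx mulr1n.
have aE : a = dotp y' y' - dotp y y' - dotp y y' + dotp y y.
  rewrite /a mxE /dotp -!sumrB -big_split/=; apply: eq_bigr => i _.
  by rewrite !mxE; ring.
have a0 : a != 0.
  apply: contraNneq neq => a0; apply/eqP/colv_inj.
  have : \sum_i (v i 0) ^+ 2 = 0.
    transitivity a => //; rewrite /a mxE.
    by apply: eq_bigr => i _; rewrite [v^T _ _]mxE expr2.
  move/eqP; rewrite psumr_eq0; last by move=> i _; exact: sqr_ge0.
  move/allP => h; apply/eqP; rewrite -subr_eq0 -/v; apply/eqP/colP => i.
  have := h i (mem_index_enum i); rewrite /= sqrf_eq0 => /eqP ->.
  by rewrite mxE.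
pose O : 'M[R]_n := 1%:M - (2 / a) *: (v *m v^T).
have OT : O^T = O by rewrite /O linearB/= trmx1 linearZ/= trmx_mul trmxK.
exists O; split => //.
  rewrite /orthogonal_mx OT /O mulmxBl mul1mx mulmxBr mulmx1.
  rewrite -scalemxAl -scalemxAr mulmxA -[v *m v^T *m v]mulmxA vv.
  rewrite mul_mx_scalar -scalemxAl !scalerA.
  have -> : 2 / a * (2 / a * a) = 2 / a + 2 / a by field.
  by rewrite scalerDl; apply/matrixP => i j; rewrite !mxE; ring.
apply: colv_inj; rewrite colv_mxact /O mulmxBl mul1mx -scalemxAl -mulmxA.
have -> : v^T *m colv y' = (a / 2)%:M.
  apply/matrixP => i j; rewrite !ord1 [RHS]mxE eqxx mulr1n aE yy'.
  have -> : (v^T *m colv y') 0 0 = dotp y' y' - dotp y y'.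
    by rewrite mxE /dotp -sumrB; apply: eq_bigr => k _; rewrite !mxE; ring.
  by field.
rewrite mul_mx_scalar scalerA; have -> : 2 / a * (a / 2) = 1 by field.
by rewrite scale1r /v; apply/matrixP => i j; rewrite !mxE; ring.
Qed.

Lemma measurable_dotp d (T : measurableType d) (X Y : T -> n.-tuple R) :
  measurable_fun setT X -> measurable_fun setT Y ->
  measurable_fun setT (fun w => dotp (X w) (Y w)).
Proof.
move=> mX mY; apply: measurable_sum => i; apply: measurable_funM.
- exact: (measurableT_comp (measurable_tnth i)).
- exact: (measurableT_comp (measurable_tnth i)).
Qed.

Lemma measurable_sqnorm d (T : measurableType d) (X : T -> n.-tuple R) :
  measurable_fun setT X -> measurable_fun setT (fun w => sqnorm (tnth (X w))).
Proof.
move=> mX.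
have -> : (fun w => sqnorm (tnth (X w))) = (fun w => dotp (X w) (X w)).
  by apply/funext => w; rewrite sqnorm_dotp.
exact: measurable_dotp.
Qed.

Lemma measurable_mxact O : measurable_fun setT (@mxact R n O).
Proof.
apply/measurable_fun_tnthP => i.
have -> : (@tnth n R)^~ i \o mxact O = fun x => \sum_j O i j * tnth x j.
  by apply/funext => x /=; rewrite tnth_mktuple.
apply: measurable_sum => j; apply: measurable_funM => //.
exact: measurable_tnth.
Qed.

End rotations.

Section sphere.
Context {R : realType} {n : nat} (nu : probability (n.-tuple R) R) (r2 : R).

(** [uniform_sphere] as a property of the law alone, so that a codeword can be integrated against
    [nu] while everything independent of it is frozen. *)
Definition sphere_law := nu [set x | sqnorm (tnth x) = r2] = 1%E /\
  forall O : 'M[R]_n, orthogonal_mx O ->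
    forall A : set (n.-tuple R), measurable A -> nu (mxact O @^-1` A) = nu A.

Hypothesis snu : sphere_law.

Lemma measurable_sphere : measurable [set x : n.-tuple R | sqnorm (tnth x) = r2].
Proof.
have := @measurable_sqnorm _ n _ _ _ (@measurable_id _ (n.-tuple R) setT) measurableT.
move=> /(_ [set r2]) -/(_ (measurable_set1 _)); rewrite setTI.
by congr (measurable _).
Qed.

Lemma sphere_compl0 : nu (~` [set x | sqnorm (tnth x) = r2]) = 0%E.
Proof.
rewrite probability_setC; last exact: measurable_sphere.
by case: snu => -> _; rewrite subee.
Qed.

Lemma sphere_rotation O (F : n.-tuple R -> R) : orthogonal_mx O ->
  (forall x, 0 <= F x) -> measurable_fun setT F ->
  (\int[nu]_x (F (mxact O x))%:E = \int[nu]_x (F x)%:E)%E.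
Proof.
move=> oO F0 mF.
have mEF : measurable_fun setT (EFin \o F) by exact/measurable_EFinP.
have := @ge0_integral_pushforward _ _ _ _ R _ (measurable_mxact O) nu setT
  (EFin \o F) measurableT mEF (fun y _ => F0 y).
rewrite preimage_setT => <-.
apply: eq_measure_integral => [|? A mA _]; first exact: measurable_mxact.
exact: (snu.2 O oO A mA).
Qed.

(** By rotation invariance the law of [dotp x y] depends on y only through its norm; the reflection
    is symmetric, so it passes unchanged from x to y. *)
Lemma sphere_dotp (f : R -> R) (y y' : n.-tuple R) :
  (forall x, 0 <= f x) -> measurable_fun setT f ->
  sqnorm (tnth y) = sqnorm (tnth y') ->
  (\int[nu]_x (f (dotp x y))%:E = \int[nu]_x (f (dotp x y'))%:E)%E.
Proof.
move=> f0 mf /exists_orthogonal_mx [Q [oQ QT e]]; rewrite -e.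
rewrite -[RHS](sphere_rotation oQ) //.
  by apply: eq_integral => x _; rewrite dotp_mxact QT.
by apply: (measurableT_comp mf); apply: measurable_dotp.
Qed.

Lemma sphere_EX_eq (f g : n.-tuple R -> R) :
  (forall x, 0 <= f x) -> (forall x, 0 <= g x) ->
  measurable_fun setT f -> measurable_fun setT g ->
  (forall x, sqnorm (tnth x) = r2 -> f x = g x) ->
  (\int[nu]_x (f x)%:E = \int[nu]_x (g x)%:E)%E.
Proof.
move=> f0 g0 mf mg fg; apply/eqP; rewrite eq_le; apply/andP; split;
  apply: (le_EX_ae measurable_sphere sphere_compl0) => // x /fg ->//.
Qed.

End sphere.

(** * Even moments of a coordinate of a uniform point *)

Section moments.
Context {R : realType} {n : nat} (nu : probability (n.-tuple R) R) (r2 : R).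
Hypothesis snu : sphere_law nu r2.
Hypothesis r20 : 0 <= r2.
Implicit Types (i j : 'I_n) (x y : n.-tuple R).

Let mtnth i : measurable_fun setT (fun x : n.-tuple R => tnth x i).
Proof. exact: measurable_tnth. Qed.

(** The moment of order 2k. It is finite because coordinates are bounded on the sphere, so [fine]
    loses nothing. *)
Definition sphere_moment i k : R := fine (\int[nu]_x ((tnth x i ^+ 2) ^+ k)%:E).

Lemma coord_le x i : sqnorm (tnth x) = r2 -> tnth x i ^+ 2 <= r2.
Proof.
move=> <-; rewrite /sqnorm (bigD1 i)//= lerDl.
by apply: sumr_ge0 => j _; exact: sqr_ge0.
Qed.

Lemma EX_bounded_fin (f : n.-tuple R -> R) (c : R) : (forall x, 0 <= f x) ->
  measurable_fun setT f -> 0 <= c -> (forall x, sqnorm (tnth x) = r2 -> f x <= c) ->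
  (\int[nu]_x (f x)%:E)%E = (fine (\int[nu]_x (f x)%:E))%:E.
Proof.
move=> f0 mf c0 fc; rewrite fineK// ge0_fin_numE; last first.
  by apply: integral_ge0 => x _; rewrite lee_fin.
apply: (@le_lt_trans _ _ (\int[nu]_x (c%:E))%E); last by rewrite EX_cst ltry.
exact: (le_EX_ae (measurable_sphere r2) (sphere_compl0 snu)).
Qed.

Lemma sphere_momentE i k :
  (\int[nu]_x ((tnth x i ^+ 2) ^+ k)%:E = (sphere_moment i k)%:E)%E.
Proof.
apply: (@EX_bounded_fin _ (r2 ^+ k)).
- by move=> x; rewrite exprn_ge0// sqr_ge0.
- by do 2 apply: measurable_funX.
- by rewrite exprn_ge0.
- by move=> x /(coord_le i) h; rewrite lerXn2r// nnegrE ?sqr_ge0.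
Qed.

Definition basis_tuple i (a : R) : n.-tuple R := [tuple if k == i then a else 0 | k < n].

Lemma dotp_basis x i a : dotp x (basis_tuple i a) = tnth x i * a.
Proof.
rewrite /dotp (bigD1 i)//= tnth_mktuple eqxx big1 ?addr0// => j ji.
by rewrite tnth_mktuple (negbTE ji) mulr0.
Qed.

(** y may be rotated to a multiple of a basis vector, which leaves a moment of one coordinate. *)
Lemma dotp_moment i y k :
  (\int[nu]_x ((dotp x y ^+ 2) ^+ k)%:E
    = (sphere_moment i k * sqnorm (tnth y) ^+ k)%:E)%E.
Proof.
pose y' := basis_tuple i (Num.sqrt (sqnorm (tnth y))).
have yy' : sqnorm (tnth y) = sqnorm (tnth y').
  rewrite [in RHS]sqnorm_dotp dotp_basis tnth_mktuple eqxx -expr2.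
  by rewrite [RHS]sqr_sqrtr// sqnorm_ge0.
rewrite (@sphere_dotp _ _ _ _ snu (fun z => (z ^+ 2) ^+ k) y y')//; last 2 first.
- by move=> z; rewrite exprn_ge0// sqr_ge0.
- by do 2 apply: measurable_funX.
under eq_integral.
  move=> x _.
  rewrite dotp_basis [(_ * _) ^+ 2]exprMn sqr_sqrtr ?sqnorm_ge0// [(_ * _) ^+ k]exprMn mulrC.
  over.
rewrite EX_Zl.
- by rewrite sphere_momentE -EFinM mulrC.
- by rewrite exprn_ge0// sqnorm_ge0.
- by move=> x; rewrite exprn_ge0// sqr_ge0.
- by do 2 apply: measurable_funX.
Qed.

(** Used to compare the coefficients of an identity known only for numerical values; natural numbers
    are enough of them, and being nonnegative they fit integrals of nonnegative functions. *)
Lemma poly_eq_nat (p q : {poly R}) :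
  (forall k : nat, p.[k%:R] = q.[k%:R]) -> p = q.
Proof.
move=> pq; apply/eqP; rewrite -subr_eq0; apply/negPn/negP => pq0.
pose s := [seq (k%:R : R) | k <- iota 0 (size (p - q))].
have us : uniq s.
  rewrite map_inj_uniq ?iota_uniq// => a b /eqP; rewrite eqr_nat => /eqP//.
have rs : all (root (p - q)) s.
  by apply/allP => _ /mapP[k _ ->]; rewrite rootE hornerD hornerN pq subrr.
by have := max_poly_roots pq0 rs us; rewrite size_map size_iota ltnn.
Qed.

(* The terms of the binomial expansion of ((x + y)^(2k) + (x - y)^(2k)) / 2,
   which are all nonnegative. *)
Definition even_term (a b : R) (N l : nat) : R :=
  if odd l then 0 else a ^+ (N - l) * b ^+ l *+ 'C(N, l).

Lemma even_term_sum (a b : R) N :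
  \sum_(l < N.+1) even_term a b N l = ((a + b) ^+ N + (a - b) ^+ N) / 2.
Proof.
rewrite exprDn exprBn -big_split/= mulr_suml; apply: eq_bigr => l _.
rewrite /even_term -signr_odd; case: (odd l); first by rewrite expr1; ring.
by rewrite expr0; field.
Qed.

Lemma even_term_ge0 (a b : R) k l : (l <= k.*2)%N -> 0 <= even_term a b k.*2 l.
Proof.
move=> lk; rewrite /even_term; case: ifPn => // ol.
rewrite mulrn_wge0// mulr_ge0// exprn_even_ge0//.
by rewrite oddB// odd_double.
Qed.

Lemma measurable_even_term i j N l :
  measurable_fun setT (fun x : n.-tuple R => even_term (tnth x i) (tnth x j) N l).
Proof.
rewrite /even_term; case: (odd l) => //.
under eq_fun do rewrite -mulr_natr.
apply: measurable_funM => //; apply: measurable_funM; exact: measurable_funX.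
Qed.

(** For every b, x_i + b x_j is the scalar product with a vector of squared norm 1 + b^2, so its
    moment of order 2k + 2 is c (1 + b^2)^(k+1) with c = [sphere_moment i k.+1]. Averaging over b
    and -b keeps the even powers of b, and comparing the coefficients of b^2 gives (k + 1)(2k + 1) E
    (x_i^(2k) x_j^2) = (k + 1) c. *)
Lemma cross_moment i j k : i != j ->
  (\int[nu]_x ((tnth x i ^+ 2) ^+ k * tnth x j ^+ 2)%:E
    = (sphere_moment i k.+1 / (2 * k%:R + 1))%:E)%E.
Proof.
move=> ij; pose N := (k.+1).*2.
pose t x l := even_term (tnth x i) (tnth x j) N l.
pose c := sphere_moment i k.+1.
have expN (z : R) : z ^+ N = (z ^+ 2) ^+ k.+1 by rewrite -exprM mul2n.
have Es (b : R) : (\int[nu]_x (((tnth x i + b * tnth x j) ^+ N))%:E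
     = (c * (1 + b ^+ 2) ^+ k.+1)%:E)%E.
  pose y : n.-tuple R := [tuple if l == i then 1 else if l == j then b else 0 | l < n].
  have dy x : dotp x y = tnth x i + b * tnth x j.
    rewrite /dotp (bigD1 i)//= (bigD1 j)//=; last by rewrite eq_sym.
    rewrite !tnth_mktuple !eqxx eq_sym (negbTE ij) big1 ?addr0.
      by rewrite mulr1 mulrC.
    by move=> l /andP[li lj]; rewrite tnth_mktuple (negbTE li) (negbTE lj) mulr0.
  have sy : sqnorm (tnth y) = 1 + b ^+ 2.
    rewrite sqnorm_dotp dy !tnth_mktuple !eqxx eq_sym (negbTE ij).
    by rewrite expr2.
  rewrite -sy -dotp_moment; apply: eq_integral => x _.
  by rewrite dy expN.
have t0 x l : (l < N.+1)%N -> 0 <= t x l by move=> lN; exact: even_term_ge0.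
have mt l : measurable_fun setT (t^~ l) by exact: measurable_even_term.
have Et (l : 'I_N.+1) : (\int[nu]_x (t x l)%:E = (fine (\int[nu]_x (t x l)%:E))%:E)%E.
  rewrite fineK// ge0_fin_numE; last first.
    by apply: integral_ge0 => x _; rewrite lee_fin t0.
  (* Each even term is at most the sum of all of them for b = 1, whose integral is finite by
     [Es]. *)
  apply: (@le_lt_trans _ _ (\int[nu]_x (2^-1 * ((tnth x i + 1 * tnth x j) ^+ N
     + (tnth x i + (- 1) * tnth x j) ^+ N))%:E)%E).
    apply: le_EX => //.
    - by move=> x; exact: t0.
    - apply: measurable_funM => //; apply: measurable_funD; apply: measurable_funX;
      apply: measurable_funD => //; exact: measurable_funM.
    - move=> x; rewrite mul1r mulN1r mulrC -even_term_sum (bigD1 l)//= lerDl.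
      by apply: sumr_ge0 => l' _; exact: t0.
  have e0 (z : R) : 0 <= z ^+ N by rewrite expN exprn_ge0// sqr_ge0.
  have me (b : R) : measurable_fun setT (fun x => (tnth x i + b * tnth x j) ^+ N).
    by apply: measurable_funX; apply: measurable_funD => //; exact: measurable_funM.
  rewrite EX_Zl//; last 2 first.
  - by move=> x; rewrite addr_ge0.
  - exact: measurable_funD.
  by rewrite EX_D// !Es -EFinD -EFinM ltry.
pose al (l : nat) := fine (\int[nu]_x (t x l)%:E).
pose p : {poly R} := \poly_(l < N.+1) al l.
pose q : {poly R} := c%:P * (1 + 'X ^+ 2) ^+ k.+1.
have pq : p = q.
  apply: poly_eq_nat => m; set b : R := m%:R.
  rewrite /q !hornerE /= horner_poly.
  apply: EFin_inj; rewrite -Es.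
  have b0 : 0 <= b by exact: ler0n.
  transitivity (\int[nu]_x (\sum_(l < N.+1) b ^+ l * t x l)%:E)%E.
    rewrite EX_sum//.
    - rewrite -sumEFin; apply: eq_bigr => l _.
      rewrite EX_Zl//; first by rewrite Et -EFinM mulrC.
      + by rewrite exprn_ge0.
      + by move=> x; exact: t0.
    - by move=> l x; rewrite mulr_ge0 ?exprn_ge0// t0.
    - by move=> l; exact: measurable_funM.
  have ev x : \sum_(l < N.+1) b ^+ l * t x l =
     2^-1 * ((tnth x i + b * tnth x j) ^+ N + (tnth x i + (- b) * tnth x j) ^+ N).
    rewrite mulNr mulrC -even_term_sum; apply: eq_bigr => l _.
    rewrite /t /even_term; case: (odd l); first by rewrite mulr0.
    by rewrite exprMn mulrnAr mulrCA.
  under eq_integral do rewrite ev.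
  have e0 (z : R) : 0 <= z ^+ N by rewrite expN exprn_ge0// sqr_ge0.
  have me (z : R) : measurable_fun setT (fun x => (tnth x i + z * tnth x j) ^+ N).
    by apply: measurable_funX; apply: measurable_funD => //; exact: measurable_funM.
  rewrite EX_Zl//; last 2 first.
  - by move=> x; rewrite addr_ge0.
  - exact: measurable_funD.
  by rewrite EX_D// !Es -EFinD -EFinM sqrrN; congr (_%:E); field.
have : p`_2 = q`_2 by rewrite pq.
rewrite coef_poly /q coefCM /al.
have -> : ((1 + 'X ^+ 2 : {poly R}) ^+ k.+1)`_2 = k.+1%:R.
  rewrite exprDn coef_sum (bigD1 (lift ord0 ord0))//= big1 ?addr0.
    by rewrite expr1n mul1r expr1 bin1 coefMn coefXn eqxx.
  move=> l l1; rewrite expr1n mul1r -exprM coefMn coefXn.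
  case: eqP => [e|_]; last by rewrite mul0rn.
  have : (l : nat) = 1%N by lia.
  by move=> e'; case/negP: l1; apply/eqP/val_inj.
rewrite /N doubleS /= => E2.
have t2 x : t x 2%N = (k.+1%:R * (2 * k%:R + 1)) * ((tnth x i ^+ 2) ^+ k * tnth x j ^+ 2).
  rewrite /t /even_term /= /N -mulr_natl -exprM.
  rewrite (_ : ((k.+1).*2 - 2 = 2 * k)%N); last by rewrite doubleS subSS subSS subn0 mul2n.
  congr (_ * _); rewrite bin2 -doubleMl doubleK doubleS /= -mul2n natrM.
  by rewrite -[(2 * k).+1%:R]natr1 natrM.
have e2 : (0 < 2 * k%:R + 1 :> R).
  by rewrite ltr_wpDl// mulr_ge0// ler0n.
have k0 : (0 < k.+1%:R :> R) by rewrite ltr0n.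
have := Et (inord 2).
rewrite inordK; last by rewrite /N doubleS.
rewrite {}E2; under eq_integral do rewrite t2.
rewrite EX_Zl.
- move=> E; have : (\int[nu]_x ((tnth x i ^+ 2) ^+ k * tnth x j ^+ 2)%:E
    = ((k.+1%:R * (2 * k%:R + 1))^-1 * (k.+1%:R * (2 * k%:R + 1)))%:E *
    \int[nu]_x ((tnth x i ^+ 2) ^+ k * tnth x j ^+ 2)%:E)%E.
    rewrite mulVf ?mul1e// mulf_neq0 ?gt_eqF//.
  rewrite EFinM -muleA E -EFinM => ->; congr (_%:E); rewrite /c; field.
  by rewrite !gt_eqF.
- by rewrite mulr_ge0// ltW.
- by move=> x; rewrite mulr_ge0 ?sqr_ge0// exprn_ge0// sqr_ge0.
- by apply: measurable_funM; do ?apply: measurable_funX.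
Qed.

Lemma sphere_moment0 i : sphere_moment i 0 = 1.
Proof. by rewrite /sphere_moment; under eq_integral do rewrite expr0; rewrite EX_cst. Qed.

Lemma sphere_moment_ge0 i k : 0 <= sphere_moment i k.
Proof.
by apply: fine_ge0; apply: integral_ge0 => x _; rewrite lee_fin exprn_ge0// sqr_ge0.
Qed.

(** Summing x_i^(2k) x_j^2 over j gives r2 x_i^(2k) on the sphere. The term j = i has the moment of
    order 2k + 2, and each of the n - 1 others has that moment divided by 2k + 1. *)
Lemma sphere_momentS i k :
  sphere_moment i k.+1 * (2 * k%:R + n%:R) = (2 * k%:R + 1) * r2 * sphere_moment i k.
Proof.
have e2 : (0 < 2 * k%:R + 1 :> R) by rewrite ltr_wpDl// mulr_ge0// ler0n.
have p0 x : 0 <= (tnth x i ^+ 2) ^+ k by rewrite exprn_ge0// sqr_ge0.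
have mp : measurable_fun setT (fun x : n.-tuple R => (tnth x i ^+ 2) ^+ k).
  by do 2 apply: measurable_funX.
have : (\int[nu]_x (\sum_(j < n) (tnth x i ^+ 2) ^+ k * tnth x j ^+ 2)%:E
   = (r2 * sphere_moment i k)%:E)%E.
  rewrite EFinM -sphere_momentE -EX_Zl//.
  apply: (sphere_EX_eq snu) => [x|x|||x xr].
  - by apply: sumr_ge0 => j _; rewrite mulr_ge0// sqr_ge0.
  - by rewrite mulr_ge0.
  - by apply: measurable_sum => j; apply: measurable_funM => //; exact: measurable_funX.
  - exact: measurable_funM.
  - by rewrite -mulr_sumr -/(sqnorm (tnth x)) xr mulrC.
rewrite EX_sum//; last 2 first.
- by move=> j x; rewrite mulr_ge0// sqr_ge0.
- by move=> j; apply: measurable_funM => //; exact: measurable_funX.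
rewrite (bigD1 i)//=; under eq_integral do rewrite -exprSr.
rewrite sphere_momentE (eq_bigr (fun _ => (sphere_moment i k.+1 / (2 * k%:R + 1))%:E)); last first.
  by move=> j ji; rewrite cross_moment// eq_sym.
rewrite sumEFin -EFinD => h; have {h} := EFin_inj h.
rewrite sumr_const cardC1 card_ord -[_ *+ n.-1]mulr_natr.
have n0 : (0 < n)%N by apply: leq_ltn_trans (ltn_ord i).
have -> : (n.-1%:R : R) = n%:R - 1 by rewrite -subn1 natrB.
move=> h; rewrite -mulrA -h; field.
by rewrite gt_eqF.
Qed.

Lemma sphere_moment1 i : sphere_moment i 1 * n%:R = r2.
Proof. by have := sphere_momentS i 0; rewrite !mulr0 !add0r mul1r sphere_moment0 mulr1. Qed.

(** The exact value is 3 r2^2 / (n (n + 2)); the bound is the fourth moment of a Gaussian of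
    variance r2 / n. *)
Lemma sphere_moment2 i : sphere_moment i 2 * n%:R ^+ 2 <= 3 * r2 ^+ 2.
Proof.
have h1 := sphere_moment1 i; have := sphere_momentS i 1.
have m2 := sphere_moment_ge0 i 2.
have n0 : 0 <= n%:R :> R by exact: ler0n.
move=> h2; have : sphere_moment i 2 * (2 + n%:R) * n%:R = 3 * r2 * r2.
  transitivity (3 * r2 * (sphere_moment i 1 * n%:R)); last by rewrite h1.
  by move: h2; rewrite mulr1 => ->; ring.
have : 0 <= sphere_moment i 2 * n%:R by exact: mulr_ge0.
nra.
Qed.

(** From k to k + 1 the moment is multiplied by r2 (2k + 1) / (2k + n) and the binomial coefficient
    by (m + k) / (k + 1). As 2m <= n, (2k + 1)(m + k) <= (2k + n)(k + 1), so the product grows by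
    the factor r2 at most. *)
Lemma sphere_moment_binomial i m k : (0 < m)%N -> (m.*2 <= n)%N ->
  sphere_moment i k * 'C(m + k - 1, k)%:R <= r2 ^+ k.
Proof.
move=> m0 mn; elim: k => [|k IH].
  by rewrite sphere_moment0 bin0 mul1r expr0.
have nk : (0 : R) < 2 * k%:R + n%:R.
  have n0 : (0 < n)%N by apply: leq_trans mn; rewrite double_gt0.
  by rewrite ltr_wpDl ?ltr0n// mulr_ge0.
have k0 : (0 : R) < k.+1%:R by rewrite ltr0n.
have -> : 'C(m + k.+1 - 1, k.+1)%:R = 'C(m + k - 1, k)%:R * (m + k)%:R / k.+1%:R :> R.
  have e : 'C(m + k.+1 - 1, k.+1)%:R * k.+1%:R = 'C(m + k - 1, k)%:R * (m + k)%:R :> R.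
    rewrite -!natrM; congr (_%:R).
    have -> : (m + k.+1 - 1 = m + k)%N by lia.
    by rewrite mulnC -mul_bin_diag mulnC subn1.
  by rewrite -e mulfK// gt_eqF.
have -> : sphere_moment i k.+1 = (2 * k%:R + 1) * r2 * sphere_moment i k / (2 * k%:R + n%:R).
  by rewrite -sphere_momentS mulfK// gt_eqF.
rewrite exprS; have C0 : 0 <= 'C(m + k - 1, k)%:R :> R by exact: ler0n.
set c := sphere_moment i k; have c0 : 0 <= c by exact: sphere_moment_ge0.
rewrite (_ : _ * _ * _ / _ * _ = r2 * (c * 'C(m + k - 1, k)%:R)
   * ((2 * k%:R + 1) * (m + k)%:R / ((2 * k%:R + n%:R) * k.+1%:R))); last first.
  by field; rewrite !gt_eqF.
rewrite -[leRHS]mulr1; apply: ler_pM.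
- by rewrite !mulr_ge0.
- by rewrite divr_ge0 ?mulr_ge0 ?addr_ge0 ?mulr_ge0// ltW.
- by rewrite ler_wpM2l.
- rewrite ler_pdivrMr ?mulr_gt0// mul1r.
  have : (m.*2%:R : R) <= n%:R by rewrite ler_nat.
  rewrite -mul2n natrM natrD -[k.+1%:R]natr1.
  have : 0 <= (k%:R : R) by exact: ler0n.
  have : 1 <= (m%:R : R) by rewrite ler1n.
  by nra.
Qed.

End moments.

(** * The series of (1 - x)^(-m) *)

Section negative_binomial.
Context {R : realType}.
Local Open Scope ereal_scope.

(** Pascal's rule gives S (m + 1) = S m + x S (m + 1) for the sums of the series, hence S (m + 1) =
    S m / (1 - x) unless it is infinite, when the bound is trivial. For m = 0 the term k = 0 is 1,
    which suffices to start. *)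
Lemma negative_binomial_series (m : nat) (x : R) : (0 <= x < 1)%R ->
  ((1 - x)^-1 ^+ m)%:E <= \sum_(0 <= k <oo) ('C(m + k - 1, k)%:R * x ^+ k)%:E.
Proof.
move=> /andP[x0 x1].
pose S m := \sum_(0 <= k <oo) ('C(m + k - 1, k)%:R * x ^+ k)%:E : \bar R.
have u0 m' k : (0 <= 'C(m' + k - 1, k)%:R * x ^+ k :> R)%R.
  by rewrite mulr_ge0// exprn_ge0.
have S0 m' : 0 <= S m' by apply: nneseries_ge0 => k _ _; rewrite lee_fin.
have shift m' : \sum_(1 <= k <oo) ('C(m' + k - 1, k)%:R * x ^+ k)%:E
    = \sum_(0 <= k <oo) ('C(m' + k.+1 - 1, k.+1)%:R * x ^+ k.+1)%:E.
  rewrite -nneseries_addn; last by move=> k; rewrite lee_fin.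
  by apply: eq_eseriesr => k _; rewrite addn1.
have SS m' : S m'.+1 = S m' + x%:E * S m'.+1.
  rewrite {1}/S nneseries_recl//; last by move=> k; rewrite lee_fin.
  rewrite [X in _ = X + _]/S [X in _ = X + _]nneseries_recl//; last by move=> k; rewrite lee_fin.
  rewrite !bin0 -addeA; congr (_ + _).
  rewrite !shift.
  rewrite /S -nneseriesZl//; last by move=> k _; rewrite lee_fin.
  rewrite -nneseriesD//.
  - apply: eq_eseriesr => k _; rewrite -EFinM -EFinD; congr (_%:E).
    have -> : (m'.+1 + k.+1 - 1 = (m' + k).+1)%N by lia.
    have -> : (m' + k.+1 - 1 = m' + k)%N by lia.
    have -> : (m'.+1 + k - 1 = m' + k)%N by lia.
    by rewrite binS natrD exprS; ring.
  - by move=> k _ _; rewrite lee_fin.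
  - by move=> k _ _; rewrite -EFinM lee_fin mulr_ge0.
rewrite -/(S m); elim: m => [|m IH].
  rewrite /S nneseries_recl//; last by move=> k; rewrite lee_fin.
  rewrite expr0 bin0 mulr1 -[leLHS]adde0 leeD2l//.
  by apply: nneseries_ge0 => k _ _; rewrite lee_fin.
have : 0 <= S m.+1 by [].
have := SS m; have := S0 m; case: (S m.+1) => [s| |]//; last by move=> *; rewrite leey.
case: (S m) IH => [t| |]// IH t0 [st] _; rewrite !lee_fin in IH *.
have : (s = (1 - x)^-1 * t)%R.
  by apply: (mulfI (x := 1 - x)); [lra|rewrite mulVKf; lra].
by move=> ->; rewrite exprS ler_wpM2l// invr_ge0; lra.
Qed.

Lemma geometric_series_le (s : R) : (0 <= s < 1)%R ->
  \sum_(0 <= k <oo) (s ^+ k)%:E <= ((1 - s)^-1)%:E.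
Proof.
move=> /andP[s0 s1]; apply: lime_le.
  by apply: is_cvg_nneseries => k _ _; rewrite lee_fin exprn_ge0.
apply: nearW => K; rewrite sumEFin lee_fin.
have h : ((1 - s) * \sum_(0 <= k < K) s ^+ k = 1 - s ^+ K)%R.
  elim: K => [|K IH]; first by rewrite big_geq// mulr0 expr0 subrr.
  by rewrite big_nat_recr//= mulrDr IH exprS; ring.
rewrite -[leRHS]mul1r ler_pdivlMr; last lra.
by rewrite mulrC h gerBl exprn_ge0.
Qed.

End negative_binomial.

(** * The squared cosine between a codeword and a vector *)

Section correlation.
Context {R : realType} {n : nat}.
Implicit Types x y : n.-tuple R.

(* The squared cosine of the angle between x and y (0 if one of them vanishes,
   since then Rocq's division by 0 gives 0). *)
Definition corr2 x y : R := dotp x y ^+ 2 / (sqnorm (tnth x) * sqnorm (tnth y)).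

Lemma sqnorm_eq0 x : sqnorm (tnth x) = 0 -> forall i, tnth x i = 0.
Proof.
move/eqP; rewrite psumr_eq0 => [/allP h i|i _]; last exact: sqr_ge0.
by have := h i (mem_index_enum i); rewrite /= sqrf_eq0 => /eqP.
Qed.

Lemma dotp_sqnorm0 x y : sqnorm (tnth x) = 0 -> dotp x y = 0.
Proof. by move=> /sqnorm_eq0 h; apply: big1 => i _; rewrite h mul0r. Qed.

Lemma cauchy_schwarz x y : dotp x y ^+ 2 <= sqnorm (tnth x) * sqnorm (tnth y).
Proof.
have x0 := sqnorm_ge0 (tnth x).
have [x00|x1] := eqVneq (sqnorm (tnth x)) 0.
  by rewrite dotp_sqnorm0// expr0n /= x00 mul0r.
have xgt0 : 0 < sqnorm (tnth x) by rewrite lt_def x1.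
have : 0 <= \sum_i (dotp x y * tnth x i - sqnorm (tnth x) * tnth y i) ^+ 2.
  by apply: sumr_ge0 => i _; exact: sqr_ge0.
have -> : \sum_i (dotp x y * tnth x i - sqnorm (tnth x) * tnth y i) ^+ 2 =
   dotp x y ^+ 2 * sqnorm (tnth x) - 2 * dotp x y * sqnorm (tnth x) * dotp x y
   + sqnorm (tnth x) ^+ 2 * sqnorm (tnth y).
  set D := dotp x y; set S := sqnorm (tnth x).
  transitivity (D ^+ 2 * (\sum_i tnth x i ^+ 2) - 2 * D * S * (\sum_i tnth x i * tnth y i)
     + S ^+ 2 * (\sum_i tnth y i ^+ 2)) => //.
  clearbody D S; rewrite !mulr_sumr -sumrB -big_split /=.
  by apply: eq_bigr => i _; ring.
move=> h; have : 0 <= sqnorm (tnth x) * (sqnorm (tnth x) * sqnorm (tnth y) - dotp x y ^+ 2).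
  by apply: le_trans h _; rewrite le_eqVlt; apply/orP; left; apply/eqP; ring.
by rewrite pmulr_rge0// subr_ge0.
Qed.

Lemma corr2_ge0 x y : 0 <= corr2 x y.
Proof. by rewrite divr_ge0 ?sqr_ge0// mulr_ge0 ?sqnorm_ge0. Qed.

Lemma corr2_le1 x y : corr2 x y <= 1.
Proof.
rewrite /corr2; have : 0 <= sqnorm (tnth x) * sqnorm (tnth y) by rewrite mulr_ge0 ?sqnorm_ge0.
rewrite le_eqVlt => /predU1P[<-|h]; first by rewrite invr0 mulr0.
by rewrite ler_pdivrMr// mul1r cauchy_schwarz.
Qed.

Lemma sqdistE x y :
  sqdist (tnth y) (tnth x) = sqnorm (tnth y) - 2 * dotp x y + sqnorm (tnth x).
Proof.
rewrite /sqdist /sqnorm /dotp mulr_sumr -sumrB -big_split /=.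
by apply: eq_bigr => i _; ring.
Qed.

(* The distance from y to x is at least the distance from y to the line through x. *)
Lemma corr2_sqdist x y :
  (1 - corr2 x y) * sqnorm (tnth y) <= sqdist (tnth y) (tnth x).
Proof.
rewrite sqdistE /corr2.
have [x0|x0] := eqVneq (sqnorm (tnth x)) 0.
  by rewrite dotp_sqnorm0// x0; lra.
have [y0|y0] := eqVneq (sqnorm (tnth y)) 0.
  by rewrite dotpC dotp_sqnorm0// y0 !mulr0 subr0 add0r sqnorm_ge0.
have xgt0 : 0 < sqnorm (tnth x) by rewrite lt_def x0 sqnorm_ge0.
rewrite -subr_ge0.
have -> : sqnorm (tnth y) - 2 * dotp x y + sqnorm (tnth x) -
   (1 - dotp x y ^+ 2 / (sqnorm (tnth x) * sqnorm (tnth y))) * sqnorm (tnth y)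
   = (dotp x y - sqnorm (tnth x)) ^+ 2 / sqnorm (tnth x).
  by field; rewrite x0 y0.
by rewrite divr_ge0 ?sqr_ge0// ltW.
Qed.

Lemma measurable_corr2 d (T : measurableType d) (X Y : T -> n.-tuple R) :
  measurable_fun setT X -> measurable_fun setT Y ->
  measurable_fun setT (fun w => corr2 (X w) (Y w)).
Proof.
move=> mX mY; apply: measurable_funM.
  by apply: measurable_funX; exact: measurable_dotp.
by apply: measurable_funV; apply: measurable_funM; exact: measurable_sqnorm.
Qed.

Lemma corr_factor_gt0 (s : R) x y : 0 <= s < 1 -> 0 < 1 - s * corr2 x y.
Proof.
move=> /andP[s0 s1]; have := corr2_le1 x y; have := corr2_ge0 x y; nra.
Qed.

(** The k-th term of the negative binomial series integrates to at most s^k: by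
    [sphere_moment_binomial] the mean of the k-th power of the squared cosine is at most the inverse
    of the binomial coefficient. The geometric series does the rest. *)
Lemma sphere_corr_mgf (nu : probability (n.-tuple R) R) (r2 s : R) (m : nat) y :
  sphere_law nu r2 -> 0 < r2 -> 0 <= s < 1 -> (0 < m)%N -> (m.*2 <= n)%N ->
  (\int[nu]_x ((1 - s * corr2 x y)^-1 ^+ m)%:E <= ((1 - s)^-1)%:E)%E.
Proof.
move=> snu r20 s01 m0 mn; have /andP[s0 s1] := s01.
have mid : measurable_fun setT (@id (n.-tuple R)) by [].
have mc := @measurable_corr2 _ _ id (cst y) mid (measurable_cst _).
have n0 : (0 < n)%N by apply: leq_trans mn; rewrite double_gt0.
pose i : 'I_n := Ordinal n0.
pose f k x : R := 'C(m + k - 1, k)%:R * (s * corr2 x y) ^+ k.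
have f0 k x : 0 <= f k x.
  by rewrite mulr_ge0// exprn_ge0// mulr_ge0// corr2_ge0.
have mf k : measurable_fun setT (f k).
  by apply: measurable_funM => //; apply: measurable_funX; exact: measurable_funM.
apply: (@le_trans _ _ (\int[nu]_x (\sum_(0 <= k <oo) (f k x)%:E))%E).
  apply: ge0_le_integral => //.
  - by move=> x _; rewrite lee_fin exprn_ge0// invr_ge0 ltW// corr_factor_gt0.
  - apply/measurable_EFinP; apply: measurable_funX; apply: measurable_funV.
    by apply: measurable_funB => //; exact: measurable_funM.
  - apply: ge0_emeasurable_sum => [k x _ _|k _]; first by rewrite lee_fin.
    exact/measurable_EFinP.
  - move=> x _; apply: negative_binomial_series.
    rewrite mulr_ge0 ?corr2_ge0//=.
    by have := corr2_le1 x y; have := corr2_ge0 x y; nra.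
rewrite integral_nneseries//; last 2 first.
- by move=> k; exact/measurable_EFinP.
- by move=> k x _; rewrite lee_fin.
apply: le_trans _ (geometric_series_le s01).
apply: lee_nneseries => [k _ _|k _]; first by apply: integral_ge0 => x _; rewrite lee_fin.
(* For y = 0 the cosine is 0 by convention, and only the term k = 0 survives. *)
have [y0|y0] := eqVneq (sqnorm (tnth y)) 0.
  rewrite (_ : (fun x => _) = cst ('C(m + k - 1, k)%:R * 0 ^+ k)%:E); last first.
    apply/funext => x; rewrite /f /corr2 y0 mulr0 invr0 !mulr0//.
  rewrite EX_cst lee_fin; case: k => [|k]; first by rewrite bin0 !expr0 mulr1.
  by rewrite expr0n mulr0 exprn_ge0.
have ygt0 : 0 < sqnorm (tnth y) by rewrite lt_def y0 sqnorm_ge0.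
pose g x : R := ('C(m + k - 1, k)%:R * s ^+ k / (r2 * sqnorm (tnth y)) ^+ k) * (dotp x y ^+ 2) ^+ k.
have c0 : 0 <= 'C(m + k - 1, k)%:R * s ^+ k / (r2 * sqnorm (tnth y)) ^+ k.
  by rewrite divr_ge0// ?mulr_ge0 ?exprn_ge0// mulr_ge0// ltW.
have p0 x : 0 <= (dotp x y ^+ 2) ^+ k by rewrite exprn_ge0// sqr_ge0.
have mp : measurable_fun setT (fun x : n.-tuple R => (dotp x y ^+ 2) ^+ k).
  by do 2 apply: measurable_funX; exact: measurable_dotp.
rewrite (@sphere_EX_eq _ _ _ _ snu (f k) g)//; last 3 first.
- by move=> x; exact: mulr_ge0.
- exact: measurable_funM.
- move=> x xr; rewrite /f /g /corr2 xr; set D := dotp x y ^+ 2.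
  rewrite [(s * _) ^+ k]exprMn expr_div_n.
  by rewrite -!mulrA; congr (_ * (_ * _)); rewrite mulrC.
rewrite EX_Zl// (dotp_moment snu (ltW r20) i) -EFinM lee_fin.
have -> : 'C(m + k - 1, k)%:R * s ^+ k / (r2 * sqnorm (tnth y)) ^+ k
   * (sphere_moment nu i k * sqnorm (tnth y) ^+ k)
   = s ^+ k * ((sphere_moment nu i k * 'C(m + k - 1, k)%:R) / r2 ^+ k).
  by rewrite exprMn; field; rewrite !expf_neq0// gt_eqF.
rewrite ler_piMr ?exprn_ge0// ler_pdivrMr ?exprn_gt0// mul1r.
exact: (sphere_moment_binomial snu (ltW r20) i k m0 mn).
Qed.

End correlation.

(** * The heat semigroup and the replacement argument *)

Section gaussian_cdf.
Context {R : realType}.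
Implicit Types x y h s t : R.

Definition phi x : R := normal_pdf 0 1 x.
(** By symmetry this is the standard Gaussian distribution function; writing it through [Qfun] ties
    it to [Qinv]. *)
Definition Phi x : R := Qfun (- x).

Lemma phiE x : phi x = normal_peak 1 * expR (- x ^+ 2 / 2).
Proof.
by rewrite /phi normal_pdfE ?oner_eq0// /normal_fun subr0 expr1n.
Qed.

Lemma phi_ge0 x : 0 <= phi x. Proof. exact: normal_pdf_ge0. Qed.

(** One constant that dominates, up to numerical factors, the density times each polynomial of
    degree at most 4 met below. *)
Definition phi_bound : R := 9 * normal_peak 1.

(** The inequality exp (x^2 / 2) >= 1 + x^4 / 8 absorbs the polynomial. *)
Lemma phi_le x : phi x * (1 + x ^+ 4) <= phi_bound.
Proof.
rewrite phiE /phi_bound mulrC [leRHS]mulrC mulrCA.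
apply: ler_wpM2l; first exact: normal_peak_ge0.
rewrite mulNr expRN ler_pdivrMr ?expR_gt0//.
have x0 : 0 <= x ^+ 2 / 2 by rewrite divr_ge0// sqr_ge0.
have := expR_ge1Dxn 1 x0; rewrite (_ : 2`!%:R = 2)// => h.
nra.
Qed.

Lemma is_derive_phi x : is_derive x 1 phi (- x * phi x).
Proof.
have -> : phi = fun x => normal_peak 1 * expR (- x ^+ 2 / 2).
  by apply/funext => y; rewrite phiE.
apply: is_derive_eq; rewrite /GRing.scale /=.
by field.
Qed.

Lemma QfunE x : Qfun x = 1 - \int[lebesgue_measure]_(t in `]-oo, x]) phi t.
Proof.
rewrite /Qfun -[X in normal_prob 0 1 X]setCK setCitvr.
rewrite [normal_prob _ _ _]probability_setC; last exact: measurable_itv.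
by rewrite fineB// fin_num_measure//; exact: measurable_itv.
Qed.

Lemma is_derive_Qfun x : is_derive x 1 Qfun (- phi x).
Proof.
have -> : Qfun = cst 1 - (fun x => \int[lebesgue_measure]_(t in `]-oo, x]) phi t).
  by apply/funext => y; rewrite QfunE.
have [||||d1 d2] := @continuous_FTC1 R phi -oo%O x (x + 1).
- by rewrite ltrDl.
- apply: integrableS (integrable_normal_pdf 0 1) => //; exact: measurable_itv.
- by rewrite ltNyr.
- by apply: continuous_normal_pdf; exact: oner_neq0.
have d : is_derive x 1 (fun x => \int[lebesgue_measure]_(t in `]-oo, x]) phi t) (phi x).
  by split; [exact: d1|rewrite -d2 derive1E].
by apply: is_derive_eq; rewrite sub0r.
Qed.

Lemma is_derive_Phi x : is_derive x 1 Phi (phi x).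
Proof.
have dn : is_derive x 1 (fun y => - y) (- 1).
  by apply: is_derive_eq.
have := @is_derive1_comp _ Qfun (fun t => - t) x _ _ (is_derive_Qfun _) dn.
move=> h; apply: is_derive_eq; rewrite mulrNN mulr1.
by rewrite !phiE sqrrN.
Qed.

Lemma MVT_le (f df : R -> R) a b (B : R) :
  (forall x, is_derive x 1 f (df x)) ->
  (forall x, `|x - a| <= `|b - a| -> `|df x| <= B) ->
  `|f b - f a| <= B * `|b - a|.
Proof.
move=> fdf dB.
have cf x : {for x, continuous f}.
  by apply/differentiable_continuous/derivable1_diffP; exact: ex_derive.
have [ab|ba] := leP a b.
  have [c /[!in_itv]/= /andP[ac cb] ->] := MVT_segment ab (fun x _ => fdf x)
     (continuous_subspaceT cf).
  rewrite normrM ler_wpM2r// dB// !ger0_norm ?subr_ge0//.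
  by rewrite lerD2r.
have [c /[!in_itv]/= /andP[bc ca] e] := MVT_segment (ltW ba) (fun x _ => fdf x)
   (continuous_subspaceT cf).
rewrite distrC e normrM [in leRHS]distrC ler_wpM2r// dB// distrC [leRHS]distrC.
rewrite !ger0_norm ?subr_ge0//; last exact: ltW.
by rewrite lerD2l lerN2.
Qed.

(** The third derivative (z^2 - 1) phi z is bounded. The mean value inequality is applied to the
    second derivative of the remainder, then to the first, then to the remainder itself, all of
    which vanish at h = 0. *)
Lemma Phi_taylor x h :
  `|Phi (x + h) - Phi x - phi x * h + x * phi x * h ^+ 2 / 2| <= phi_bound * `|h| ^+ 3.
Proof.
pose g2 t := - (x + t) * phi (x + t) + x * phi x.
pose g1 t := phi (x + t) - phi x + x * phi x * t.
pose g t := Phi (x + t) - Phi x - phi x * t + x * phi x * t ^+ 2 / 2.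
have dphi t : is_derive t 1 (fun t => phi (x + t)) (- (x + t) * phi (x + t)).
  have h1 := @is_derive_phi (x + t).
  have h2 : is_derive t 1 (cst x + id) 1.
    by apply: is_derive_eq; rewrite add0r.
  have := @is_derive1_comp _ phi (fun t => x + t) t _ _ h1 h2.
  by rewrite mulr1.
have dPhi t : is_derive t 1 (fun t => Phi (x + t)) (phi (x + t)).
  have h1 := @is_derive_Phi (x + t).
  have h2 : is_derive t 1 (cst x + id) 1.
    by apply: is_derive_eq; rewrite add0r.
  have := @is_derive1_comp _ Phi (fun t => x + t) t _ _ h1 h2.
  by rewrite mulr1.
have dg2 t : is_derive t 1 g2 (((x + t) ^+ 2 - 1) * phi (x + t)).
  by apply: is_derive_eq; rewrite /GRing.scale /=; ring.
have dg1 t : is_derive t 1 g1 (g2 t).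
  by apply: is_derive_eq; rewrite /g2 /GRing.scale /=; ring.
have dg t : is_derive t 1 g (g1 t).
  by apply: is_derive_eq; rewrite /g1 /GRing.scale /=; field.
have g20 : g2 0 = 0 by rewrite /g2 addr0 mulNr addNr.
have g10 : g1 0 = 0 by rewrite /g1 addr0 subrr add0r mulr0.
have g0 : g 0 = 0 by rewrite /g addr0 expr0n /= subrr !mulr0 mul0r subrr addr0.
have b2 t : `|g2 t| <= phi_bound * `|t|.
  have := @MVT_le g2 _ 0 t phi_bound dg2 _; rewrite g20 !subr0; apply => y _.
  rewrite normrM (ger0_norm (phi_ge0 _)) mulrC.
  apply: le_trans (phi_le (x + y)); apply: ler_wpM2l; first exact: phi_ge0.
  have : 0 <= ((x + y) ^+ 2 - 1 / 2) ^+ 2 by exact: sqr_ge0.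
  have : 0 <= (x + y) ^+ 2 by exact: sqr_ge0.
  by rewrite ler_norml; move: (x + y) => z h1 h2; apply/andP; split; nra.
have b1 t : `|g1 t| <= phi_bound * `|t| ^+ 2.
  have := @MVT_le g1 _ 0 t (phi_bound * `|t|) dg1 _.
  rewrite g10 !subr0 expr2 mulrA; apply => y; rewrite subr0 => yt.
  by apply: le_trans (b2 _) _; rewrite ler_wpM2l// mulr_ge0// normal_peak_ge0.
have := @MVT_le g _ 0 h (phi_bound * `|h| ^+ 2) dg _.
rewrite (_ : phi_bound * `|h| ^+ 3 = phi_bound * `|h| ^+ 2 * `|h|); last first.
  by rewrite -mulrA -exprSr.
rewrite g0 !subr0; apply => y; rewrite subr0 => yt.
apply: le_trans (b1 _) _; rewrite ler_wpM2l// ?mulr_ge0 ?normal_peak_ge0//.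
by rewrite lerXn2r ?nnegrE.
Qed.

(** In the logarithmic variable r = ln (1 + s) / 2 the dilation is z = x exp (-r), and the
    derivatives in r of Phi z are polynomials in z times phi z, hence bounded uniformly in x.
    Replacing r by s / 2 costs at most s^2 / 2. *)
Lemma Phi_time x s : 0 <= s ->
  `|Phi (x / Num.sqrt (1 + s)) - Phi x + x * phi x * s / 2| <= phi_bound * s ^+ 2.
Proof.
move=> s0.
have s1 : 0 < 1 + s by lra.
pose r := ln (1 + s) / 2.
have l1 : ln (1 + s) <= s by apply: le_ln1Dx; lra.
have l2 : s / (1 + s) <= ln (1 + s).
  have : ln (1 + (- (s / (1 + s)))) <= - (s / (1 + s)).
    by apply: le_ln1Dx; rewrite ltrN2 ltr_pdivrMr//; lra.
  have -> : 1 - s / (1 + s) = (1 + s)^-1 by field; lra.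
  by rewrite lnV ?posrE//; lra.
have l0 : 0 <= ln (1 + s) by apply: ln_ge0; lra.
have l3 : s - ln (1 + s) <= s ^+ 2.
  have : s - s / (1 + s) = s ^+ 2 / (1 + s) by field; lra.
  have : s ^+ 2 / (1 + s) <= s ^+ 2.
    by rewrite ler_pdivrMr// ler_peMr ?sqr_ge0//; lra.
  by lra.
have -> : x / Num.sqrt (1 + s) = x * expR (- r).
  congr (_ * _); rewrite expRN; congr (_^-1).
  apply/eqP; rewrite -(eqrXn2 (n := 2))// ?sqrtr_ge0 ?expR_ge0//.
  rewrite sqr_sqrtr ?ltW// -expRM_natl /r.
  by rewrite (_ : 2 * (ln (1 + s) / 2) = ln (1 + s)) ?lnK ?posrE//; field.
pose psi y := y * phi y.
pose g t := Phi (x * expR (- t)).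
pose g' t := - psi (x * expR (- t)).
have de t : is_derive t 1 (fun t => x * expR (- t)) (- (x * expR (- t))).
  by apply: is_derive_eq; rewrite /GRing.scale /=; ring.
have dphi t : is_derive t 1 (fun t => phi (x * expR (- t)))
    ((x * expR (- t)) ^+ 2 * phi (x * expR (- t))).
  have := @is_derive1_comp _ phi (fun t => x * expR (- t)) t _ _ (is_derive_phi _) (de t).
  by move=> h; apply: is_derive_eq; ring.
have dg t : is_derive t 1 g (g' t).
  have := @is_derive1_comp _ Phi (fun t => x * expR (- t)) t _ _ (is_derive_Phi _) (de t).
  by move=> h; apply: is_derive_eq; rewrite /g' /psi; ring.
have dg' t : is_derive t 1 g' ((x * expR (- t)) * phi (x * expR (- t))
    - (x * expR (- t)) ^+ 3 * phi (x * expR (- t))).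
  by apply: is_derive_eq; rewrite /GRing.scale /=; ring.
have b1 t : `|g' t - g' 0| <= 2 * phi_bound * `|t|.
  have := @MVT_le g' _ 0 t (2 * phi_bound) dg' _; rewrite !subr0; apply => y _.
  set z := x * _; have := phi_le z; have := phi_ge0 z; move: (phi z) => p p0 pb.
  rewrite (_ : z * p - z ^+ 3 * p = p * (z - z ^+ 3)); last by ring.
  rewrite normrM ger0_norm//.
  have : `|z - z ^+ 3| <= 2 * (1 + z ^+ 4).
    rewrite ler_norml; apply/andP; split.
      have : 0 <= (z ^+ 2 - z / 2) ^+ 2 by exact: sqr_ge0.
      have : 0 <= (z + 1 / 2) ^+ 2 by exact: sqr_ge0.
      nra.
    have : 0 <= (z ^+ 2 + z / 2) ^+ 2 by exact: sqr_ge0.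
    have : 0 <= (z - 1 / 2) ^+ 2 by exact: sqr_ge0.
    nra.
  by move=> /(ler_wpM2l p0); lra.
pose k t := g t - g 0 - g' 0 * t.
have dk t : is_derive t 1 k (g' t - g' 0).
  by apply: is_derive_eq; rewrite /GRing.scale /=; move: (g' t) (g' 0) => u v; ring.
have r0 : 0 <= r by rewrite divr_ge0.
have g'z : g' 0 = - psi x by rewrite /g' oppr0 expR0 mulr1.
have gz : g 0 = Phi x by rewrite /g oppr0 expR0 mulr1.
have k0 : k 0 = 0 by rewrite /k subrr mulr0 subrr.
have H : `|k r| <= 2 * phi_bound * r * r.
  have := @MVT_le k _ 0 r (2 * phi_bound * r) dk _.
  rewrite k0 !subr0 (ger0_norm r0); apply => y; rewrite subr0 => yr.
  by apply: le_trans (b1 y) _; rewrite ler_wpM2l ?mulr_ge0 ?normal_peak_ge0.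
move: H; rewrite /k gz g'z /g mulNr opprK => H.
have p1 : `|psi x| <= phi_bound.
  rewrite /psi normrM mulrC (ger0_norm (phi_ge0 x)).
  apply: le_trans (phi_le x); apply: ler_wpM2l; first exact: phi_ge0.
  have : 0 <= (x ^+ 2 - 1 / 2) ^+ 2 by exact: sqr_ge0.
  have : 0 <= (x - 1 / 2) ^+ 2 by exact: sqr_ge0.
  have : 0 <= (x + 1 / 2) ^+ 2 by exact: sqr_ge0.
  by rewrite ler_norml => h1 h2 h3; apply/andP; split; nra.
rewrite (_ : _ + _ = (Phi (x * expR (- r)) - Phi x + psi x * r) + psi x * (s / 2 - r)); last first.
  by rewrite /psi; ring.
apply: le_trans (ler_normD _ _) _.
have p2 : `|psi x * (s / 2 - r)| <= phi_bound * (s ^+ 2 / 2).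
  rewrite normrM ler_pM// ger0_norm /r; lra.
have p3 : 2 * phi_bound * r * r <= phi_bound * (s ^+ 2 / 2).
  rewrite (_ : 2 * phi_bound * r * r = phi_bound * (2 * r * r)); last by ring.
  rewrite ler_wpM2l ?mulr_ge0 ?normal_peak_ge0// /r; nra.
by apply: le_trans (lerD H p2) _; lra.
Qed.

Lemma Phi_ge0 x : 0 <= Phi x.
Proof. by rewrite /Phi /Qfun; exact: fine_ge0. Qed.

Lemma Phi_le1 x : Phi x <= 1.
Proof.
rewrite /Phi QfunE gerBl; apply: Rintegral_ge0 => y _; exact: phi_ge0.
Qed.

Lemma Phi_nondecreasing : {homo Phi : x y / x <= y}.
Proof.
move=> x y xy; rewrite /Phi /Qfun fine_le ?fin_num_measure//; try exact: measurable_itv.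
apply: le_measure; rewrite ?inE; try exact: measurable_itv.
by apply: subset_itvr; rewrite bnd_simp lerN2.
Qed.

Lemma measurable_Phi : measurable_fun setT Phi.
Proof. by apply: nondecreasing_measurable => //; exact: Phi_nondecreasing. Qed.

Lemma continuous_Phi : continuous Phi.
Proof.
move=> x; apply/differentiable_continuous/derivable1_diffP.
by case: (is_derive_Phi x).
Qed.

Lemma continuous_Qfun : continuous (@Qfun R).
Proof.
move=> x; apply/differentiable_continuous/derivable1_diffP.
by case: (is_derive_Qfun x).
Qed.

Lemma cvg_Qfun0 : @Qfun R x @[x --> +oo] --> (0 : R).
Proof.
have := @cvg_ccdfy0 _ _ R (normal_prob (0:R) 1) idfun.
by move=> /(_ (@measurable_id _ _ setT)) /fine_cvgP[].
Qed.

Lemma cvg_Qfun1 : @Qfun R x @[x --> -oo] --> (1 : R).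
Proof.
have := @cvg_ccdfNy1 _ _ R (normal_prob (0:R) 1) idfun.
by move=> /(_ (@measurable_id _ _ setT)) /fine_cvgP[].
Qed.

Lemma Phi_near1 (e : R) : 0 < e -> exists2 K, 0 < K & 1 - e <= Phi K.
Proof.
move=> e0.
have /cvgrPdist_le/(_ _ e0)[A [Ar hA]] := cvg_Qfun1.
exists (Num.max 1 (1 - A)); first by rewrite lt_max ltr01.
have := hA (- Num.max 1 (1 - A)).
rewrite /Phi => /(_ _)/ler_normlW h; rewrite lerBlDl -lerBlDr; apply: h.
have : 1 - A <= Num.max 1 (1 - A) by rewrite le_max lexx orbT.
by lra.
Qed.

(** [Qfun] is continuous with limits 1 and 0, so a preimage exists by the intermediate value
    theorem, and [xget] returns one instead of its default. *)
Lemma Qinv_correct (e : R) : 0 < e < 1 -> Qfun (Qinv e) = e.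
Proof.
move=> /andP[e0 e1].
suff [x Qx] : exists x, @Qfun R x = e.
  by rewrite /Qinv; case: xgetP => [y _ //|/(_ x)]; rewrite /= Qx.
have /cvgrPdist_lt c1 := cvg_Qfun1; have /cvgrPdist_lt c0 := cvg_Qfun0.
have [|A [Ar hA]] := c1 (1 - e); first lra.
have [|B [Br hB]] := c0 e; first lra.
pose a := Num.min (A - 1) (B - 1).
have [ha1 ha2] : a <= A - 1 /\ a <= B - 1 by rewrite /a; split; rewrite ge_min lexx ?orbT.
have ab : a <= B + 1 by lra.
have cQ : {within `[a, B + 1], continuous (@Qfun R)} by exact: continuous_subspaceT continuous_Qfun.
have := hA a; have := hB (B + 1).
move=> /(_ _) hb1 /(_ _) hb2.
have := @IVT R Qfun a (B + 1) e ab cQ.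
case.
  have : Qfun (B + 1) < e.
    have : B < B + 1 by rewrite ltrDl.
    by move/hb1; rewrite /= sub0r normrN => /ltr_normlW.
  have : e < Qfun a.
    have : a < A by lra.
    by move/hb2 => /= /ltr_normlW; lra.
  move=> h1 h2; rewrite ge_min le_max; apply/andP; split.
    by rewrite (ltW h2) orbT.
  by rewrite (ltW h1).
by move=> c _ Qc; exists c.
Qed.

End gaussian_cdf.

(** * Expansion and regularity of the heat evolution *)

Section heat.
Context {R : realType}.
Implicit Types t s x h : R.

(* The solution of the heat equation 2 u_t = u_xx with initial value 1_{x > 0}. *)
Definition heat t x : R := Phi (x / Num.sqrt t).

(** By the heat equation the same coefficient d2 = u_xx / 2 multiplies h^2 and -s, so for a centred
    increment h of variance s the terms of order at most two vanish on average. A smoothing time of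
    at least t0 makes the constant uniform in t and x; d1 and d2 do not depend on h and s, so the
    expansion can be averaged over h. *)
Lemma heat_step (t0 : R) : 0 < t0 -> exists2 C : R, 0 <= C &
  forall t x, t0 <= t -> exists d1 d2 : R, [/\ `|d1| <= C, `|d2| <= C &
  forall h s, 0 <= s ->
    `|heat t (x + h) - heat (t + s) x - d1 * h - d2 * (h ^+ 2 - s)|
      <= C * (`|h| ^+ 3 + s ^+ 2)].
Proof.
move=> t00.
pose a0 := (Num.sqrt t0)^-1.
have a00 : 0 < a0 by rewrite invr_gt0 sqrtr_gt0.
have b0 : 0 <= @phi_bound R by rewrite mulr_ge0// normal_peak_ge0.
exists (phi_bound * (a0 + a0 ^+ 2 + a0 ^+ 3 + a0 ^+ 4)).
  by rewrite mulr_ge0// !addr_ge0// ?exprn_ge0// ltW.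
move=> t x tt0; have t_gt0 : 0 < t by lra.
pose a := (Num.sqrt t)^-1.
have agt0 : 0 < a by rewrite invr_gt0 sqrtr_gt0.
have aa0 : a <= a0 by rewrite lef_pV2 ?posrE ?sqrtr_gt0// ler_sqrt// ltW.
have aX k : a ^+ k <= a0 ^+ k by rewrite lerXn2r ?nnegrE// ltW.
pose y := x * a.
have a2 : a ^+ 2 = t^-1 by rewrite exprVn sqr_sqrtr// ltW.
exists (phi y * a), (- (y * phi y * a ^+ 2 / 2)).
have fb : phi y <= phi_bound.
  have := phi_le y; have := phi_ge0 y; have : 0 <= (y ^+ 2) ^+ 2 by exact: sqr_ge0.
  by rewrite -exprM; nra.
have pb : `|y * phi y| <= phi_bound.
  rewrite normrM mulrC (ger0_norm (phi_ge0 y)).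
  apply: le_trans (phi_le y); apply: ler_wpM2l; first exact: phi_ge0.
  have : 0 <= (y ^+ 2 - 1 / 2) ^+ 2 by exact: sqr_ge0.
  have : 0 <= (y - 1 / 2) ^+ 2 by exact: sqr_ge0.
  have : 0 <= (y + 1 / 2) ^+ 2 by exact: sqr_ge0.
  by rewrite ler_norml => h1 h2 h3; apply/andP; split; nra.
have A2 : 0 <= a0 ^+ 2 by rewrite exprn_ge0// ltW.
have A3 : 0 <= a0 ^+ 3 by rewrite exprn_ge0// ltW.
have A4 : 0 <= a0 ^+ 4 by rewrite exprn_ge0// ltW.
split.
- rewrite ger0_norm; last by rewrite mulr_ge0 ?phi_ge0// ltW.
  by apply: ler_pM; rewrite ?phi_ge0// ?(ltW agt0)//; lra.
- rewrite normrN normrM (ger0_norm (x := 2^-1))// normrM (ger0_norm (x := a ^+ 2)) ?exprn_ge0// ?(ltW agt0)//.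
  rewrite -mulrA; apply: ler_pM => //; first by rewrite mulr_ge0// exprn_ge0// ltW.
  by have := aX 2%N; lra.
- move=> h s s0.
  have T := Phi_taylor y (h * a).
  have s0' : 0 <= s * a ^+ 2 by rewrite mulr_ge0// exprn_ge0// ltW.
  have S := Phi_time y s0'.
  have e1 : heat t (x + h) = Phi (y + h * a) by rewrite /heat -mulrDl.
  have e2 : heat (t + s) x = Phi (y / Num.sqrt (1 + s * a ^+ 2)).
    rewrite /heat; congr Phi; rewrite /y -mulrA; congr (_ * _).
    rewrite /a -invfM -sqrtrM ?(ltW t_gt0)//; congr (Num.sqrt _)^-1.
    by rewrite a2; field; lra.
  rewrite e1 e2.
  rewrite (_ : _ - _ = (Phi (y + h * a) - Phi y - phi y * (h * a) + y * phi y * (h * a) ^+ 2 / 2)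
     - (Phi (y / Num.sqrt (1 + s * a ^+ 2)) - Phi y + y * phi y * (s * a ^+ 2) / 2)); last first.
    by field.
  apply: le_trans (ler_normB _ _) _.
  apply: le_trans (lerD T S) _.
  rewrite -mulrDr -[leRHS]mulrA ler_wpM2l//.
  rewrite normrM (ger0_norm (ltW agt0)).
  have -> : (`|h| * a) ^+ 3 = `|h| ^+ 3 * a ^+ 3 by ring.
  have -> : (s * a ^+ 2) ^+ 2 = s ^+ 2 * a ^+ 4 by ring.
  have h3 : 0 <= `|h| ^+ 3 by rewrite exprn_ge0.
  have s2 : 0 <= s ^+ 2 by exact: sqr_ge0.
  have k3 := ler_wpM2l h3 (aX 3%N); have k4 := ler_wpM2l s2 (aX 4%N).
  apply: le_trans (lerD k3 k4) _; nra.
Qed.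

Lemma heat_ge0 t x : 0 <= heat t x. Proof. exact: Phi_ge0. Qed.
Lemma heat_le1 t x : heat t x <= 1. Proof. exact: Phi_le1. Qed.

(** With h = 0, [heat_step] gives the Lipschitz bound for time steps of length at most 1; for longer
    steps it is trivial, the values lying between 0 and 1. *)
Lemma heat_time (t0 : R) : 0 < t0 -> exists2 C : R, 0 <= C &
  forall t t' x, t0 <= t -> t0 <= t' -> heat t x <= heat t' x + C * `|t - t'|.
Proof.
move=> t00; have [C C0 hC] := heat_step t00.
exists (2 * C + 1); first lra.
have key t s x : t0 <= t -> 0 <= s -> `|heat t x - heat (t + s) x| <= (2 * C + 1) * s.
  move=> tt0 s0; have [d1 [d2 [D1 D2 /(_ 0 s s0)]]] := hC t x tt0.
  rewrite addr0 normr0 mulr0 subr0 !expr0n /= !add0r mulrN opprK => H.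
  have [s1|s1] := leP s 1.
    have : `|d2 * s| <= C * s by rewrite normrM (ger0_norm s0) ler_wpM2r.
    have : C * s ^+ 2 <= C * s by rewrite ler_wpM2l// expr2 ler_piMr.
    move: (heat t x) (heat (t + s) x) H => u v; rewrite !ler_norml => /andP[h1 h2] h3 /andP[h4 h5].
    by apply/andP; split; lra.
  have := heat_ge0 t x; have := heat_le1 t x; have := heat_ge0 (t + s) x.
  have := heat_le1 (t + s) x; have : 0 <= C * s by rewrite mulr_ge0.
  move: (heat t x) (heat (t + s) x) => u v.
  by rewrite ler_norml => *; apply/andP; split; lra.
move=> t t' x tt0 tt0'; have [tt'|tt'] := leP t t'.
  have := key t (t' - t) x tt0; rewrite subr_ge0 => /(_ tt').
  rewrite (_ : t + (t' - t) = t'); last by ring.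
  move: (heat t x) (heat t' x) => u v.
  rewrite ler_norml => /andP[_]; rewrite (distrC t) ger0_norm ?subr_ge0//; lra.
have := key t' (t - t') x tt0'; rewrite subr_ge0 (ltW tt') => /(_ isT).
rewrite (_ : t' + (t - t') = t); last by ring.
move: (heat t x) (heat t' x) => u v.
rewrite ler_norml => /andP[h _]; rewrite ger0_norm ?subr_ge0 ?(ltW tt')//; lra.
Qed.

Lemma measurable_heat d (T : measurableType d) (f g : T -> R) :
  measurable_fun setT f -> measurable_fun setT g ->
  measurable_fun setT (fun w => heat (f w) (g w)).
Proof.
move=> mf mg; apply: (measurableT_comp measurable_Phi).
apply: measurable_funM => //; apply: measurable_funV.
apply: (measurableT_comp _ mf).
by apply: nondecreasing_measurable => //; exact: ler_wsqrtr.
Qed.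

End heat.

(** * Gaussian limit of the scalar product of a uniform point with a fixed vector *)

Section sphere_heat.
Context {R : realType}.

Section flip.
Context {n : nat}.
Implicit Types (i j : 'I_n) (x y : n.-tuple R).

Definition flip_mx i : 'M[R]_n := diag_mx (\row_j if j == i then -1 else 1).

Lemma flip_mx_orthogonal i : orthogonal_mx (flip_mx i).
Proof.
rewrite /orthogonal_mx /flip_mx tr_diag_mx mulmx_diag -[1%:M]diag_const_mx.
congr diag_mx; apply/rowP => j; rewrite !mxE; case: eqP => _; ring.
Qed.

Lemma tnth_flip i x j : tnth (mxact (flip_mx i) x) j = if j == i then - tnth x j else tnth x j.
Proof.
rewrite tnth_mktuple (bigD1 j)//= big1 => [|k kj].
  by rewrite !mxE eqxx mulr1n addr0; case: eqP => _; ring.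
by rewrite !mxE [j == k]eq_sym (negbTE kj) mulr0n mul0r.
Qed.

End flip.

(** The integral of F is that of its average over x and O x. For a sign flip this average cancels
    the odd terms pointwise, so that no signed integral appears. *)
Lemma rotation_average n (nu : probability (n.-tuple R) R) (r2 : R) (O : 'M[R]_n)
    (F G e : n.-tuple R -> R) : sphere_law nu r2 -> orthogonal_mx O ->
  (forall x, 0 <= F x) -> (forall x, 0 <= G x) -> (forall x, 0 <= e x) ->
  measurable_fun setT F -> measurable_fun setT G -> measurable_fun setT e ->
  (forall x, F x + F (mxact O x) <= 2 * (G x + e x)) ->
  (\int[nu]_x (F x)%:E <= \int[nu]_x (G x)%:E + \int[nu]_x (e x)%:E)%E.
Proof.
move=> snu oO F0 G0 e0 mF mG me FG.
have mFO : measurable_fun setT (fun x => F (mxact O x)).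
  by apply: (measurableT_comp mF); exact: measurable_mxact.
have mGe := measurable_funD mG me.
have Ge0 x : 0 <= G x + e x by rewrite addr_ge0.
have E2 : (\int[nu]_x (F x + F (mxact O x))%:E = 2%:E * \int[nu]_x (F x)%:E)%E.
  by rewrite EX_D// (sphere_rotation snu oO)// -[LHS]mule2n mule_natl.
rewrite -EX_D// -(@lee_pmul2l _ 2%:E) ?lte_fin//.
rewrite -E2 -EX_Zl//; apply: le_EX => //.
- by move=> x; rewrite addr_ge0.
- exact: measurable_funD.
- exact: measurable_funM.
Qed.

Let half_sum (A B D E dd c : R) : A - D - dd <= c -> B - D + dd <= c -> c <= E ->
  B + A <= 2 * (D + E).
Proof. lra. Qed.

(** This is 2 q g^3 <= g^2 + q^2 g^4: an odd moment is replaced by even ones, with q = sqrt n in the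
    application. *)
Let cube_le (q g : R) : 0 < q -> 0 <= g ->
  g ^+ 3 + (g ^+ 2) ^+ 2 <= g ^+ 2 / (2 * q) + (q / 2 + 1) * (g ^+ 2) ^+ 2.
Proof.
move=> q0 g0.
have : 0 <= g ^+ 2 * ((1 - q * g) ^+ 2 / (2 * q)).
  by rewrite mulr_ge0 ?sqr_ge0// divr_ge0 ?sqr_ge0// mulr_ge0// ltW.
have -> : g ^+ 2 * ((1 - q * g) ^+ 2 / (2 * q)) =
    g ^+ 2 / (2 * q) - g ^+ 3 + q / 2 * (g ^+ 2) ^+ 2.
  by field; rewrite gt_eqF.
lra.
Qed.

(** In [F k] the coordinates from k on have been converted into time, and the first k are still
    displacement. A flip fixes all squares, hence [tau], and reverses one increment, so it acts as
    an independent random sign although the coordinates are dependent. Equal coordinates of [flat]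
    make the total time t + a^2 |x|^2, which is constant on the sphere. *)
Lemma sphere_heat (t0 : R) : 0 < t0 -> exists2 C : R, 0 <= C &
  forall (n : nat) (nu : probability (n.-tuple R) R) (S : R), (0 < n)%N -> 0 < S ->
  sphere_law nu (n%:R * S) -> forall (t x0 : R) (y : n.-tuple R), t0 <= t ->
  (\int[nu]_x (heat t (x0 + dotp x y))%:E <=
    (heat (t + sqnorm (tnth y) * S) x0
     + C * (sqnorm (tnth y) * S + (sqnorm (tnth y) * S) ^+ 2) / Num.sqrt n%:R)%:E)%E.
Proof.
move=> t00; have [C C0 hC] := heat_step t00.
exists (5 * C); first by rewrite mulr_ge0.
move=> n nu S n0 S0 snu t x0 y tt0.
have nR : (0 : R) < n%:R by rewrite ltr0n.
have r20 : 0 <= n%:R * S by rewrite mulr_ge0// ltW.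
set q := Num.sqrt n%:R : R.
have q0 : 0 < q by rewrite sqrtr_gt0.
have q1 : 1 <= q by rewrite -sqrtr1 ler_wsqrtr// ler1n.
have qq : q ^+ 2 = n%:R by rewrite sqr_sqrtr// ltW.
pose a := Num.sqrt (sqnorm (tnth y)) / q.
have a2 : a ^+ 2 = sqnorm (tnth y) / n%:R.
  by rewrite /a expr_div_n sqr_sqrtr ?sqnorm_ge0// qq.
clearbody a.
pose flat : n.-tuple R := [tuple a | i < n].
have sflat : sqnorm (tnth y) = sqnorm (tnth flat).
  rewrite [RHS](eq_bigr (fun=> a ^+ 2)); last by move=> i _; rewrite tnth_mktuple.
  by rewrite sumr_const card_ord -mulr_natr a2 divfK// gt_eqF.
pose tau k (x : n.-tuple R) := t + a ^+ 2 * \sum_(i < n | (k <= i)%N) tnth x i ^+ 2.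
pose pos k (x : n.-tuple R) := x0 + a * \sum_(i < n | (i < k)%N) tnth x i.
pose F k x := heat (tau k x) (pos k x).
have tau_ge k x : t0 <= tau k x.
  apply: le_trans tt0 _; rewrite lerDl mulr_ge0 ?sqr_ge0//.
  by apply: sumr_ge0 => i _; exact: sqr_ge0.
have F0 k x : 0 <= F k x by exact: heat_ge0.
have mtn i : measurable_fun setT (fun x : n.-tuple R => tnth x i) by exact: measurable_tnth.
have msum (P : pred 'I_n) (f : R -> R) : measurable_fun setT f ->
    measurable_fun setT (fun x : n.-tuple R => \sum_(i < n | P i) f (tnth x i)).
  move=> mf.
  have -> : (fun x : n.-tuple R => \sum_(i < n | P i) f (tnth x i)) =
            (fun x => \sum_(i < n) (if P i then f (tnth x i) else 0)).
    by apply/funext => x; rewrite big_mkcond.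
  apply: measurable_sum => i; case: (P i) => //.
  exact: (measurableT_comp mf).
have mF k : measurable_fun setT (F k).
  apply: measurable_heat.
    apply: measurable_funD => //; apply: measurable_funM => //.
    by apply: (msum _ (fun z => z ^+ 2)); exact: measurable_funX.
  apply: measurable_funD => //; apply: measurable_funM => //.
  exact: (msum _ id).
(* Error of one step: second and fourth moments of a x_i, weighted as in [cube_le]. As a^2 S is of
   order 1/n and q = sqrt n, the n steps cost O (1 / sqrt n). *)
pose e : R := C * (a ^+ 2 * S / (2 * q) + (q / 2 + 1) * (a ^+ 4 * (3 * S ^+ 2))).
have step k : (k < n)%N ->
    (\int[nu]_x (F k.+1 x)%:E <= \int[nu]_x (F k x)%:E + e%:E)%E.
  move=> kn; pose i := Ordinal kn; pose O := flip_mx i.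
  have m1 : sphere_moment nu i 1 = S.
    have := sphere_moment1 snu r20 i; rewrite mulrC => /mulfI; apply.
    by rewrite gt_eqF.
  have m2 : sphere_moment nu i 2 <= 3 * S ^+ 2.
    have := sphere_moment2 snu r20 i.
    rewrite exprMn mulrC mulrCA ler_pM2l//; exact: exprn_gt0.
  have mFO : measurable_fun setT (fun x => F k.+1 (mxact O x)).
    by apply: (measurableT_comp (mF _)); exact: measurable_mxact.
  pose er (x : n.-tuple R) := C * (a ^+ 2 / (2 * q) * tnth x i ^+ 2
       + (q / 2 + 1) * a ^+ 4 * (tnth x i ^+ 2) ^+ 2).
  have cc1 : 0 <= a ^+ 2 / (2 * q) by rewrite divr_ge0 ?sqr_ge0// mulr_ge0// ltW.
  have a40 : 0 <= a ^+ 4 by rewrite (exprM a 2 2) sqr_ge0.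
  have cc2 : 0 <= (q / 2 + 1) * a ^+ 4 by rewrite mulr_ge0// addr_ge0// divr_ge0// ltW.
  have er0 x : 0 <= er x.
    by rewrite mulr_ge0// addr_ge0// mulr_ge0// ?sqr_ge0.
  have mer : measurable_fun setT er.
    apply: measurable_funM => //; apply: measurable_funD; apply: measurable_funM => //.
      exact: measurable_funX.
    by do 2 apply: measurable_funX.
  have pw x : F k.+1 x + F k.+1 (mxact O x) <= 2 * (F k x + er x).
    have tauO : tau k.+1 (mxact O x) = tau k.+1 x.
      congr (_ + _ * _); apply: eq_bigr => j kj; rewrite tnth_flip.
      by case: eqP => // _; rewrite sqrrN.
    have posO : pos k.+1 (mxact O x) = pos k x + - (a * tnth x i).
      rewrite /pos -addrA -mulrN -mulrDr; congr (_ + _ * _).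
      rewrite (bigD1 i)/= ?ltnS// tnth_flip eqxx addrC; congr (_ + _).
      apply: eq_big => [j|j /andP[_ ji]]; last by rewrite tnth_flip (negbTE ji).
      rewrite ltnS leq_eqVlt andbC -(inj_eq val_inj) /=.
      by case: (ltngtP j k).
    have posS : pos k.+1 x = pos k x + a * tnth x i.
      rewrite /pos -addrA -mulrDr; congr (_ + _ * _).
      rewrite (bigD1 i)/= ?ltnS// addrC; congr (_ + _).
      apply: eq_bigl => j; rewrite ltnS leq_eqVlt andbC -(inj_eq val_inj) /=.
      by case: (ltngtP j k).
    (* The time exchanged is exactly the square of the increment, so the d2 term of [heat_step] is
       zero, and the d1 terms of the two signs cancel. *)
    have tauS : tau k x = tau k.+1 x + (a * tnth x i) ^+ 2.
      rewrite /tau -addrA exprMn -mulrDr; congr (_ + _ * _).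
      rewrite (bigD1 i)//= addrC; congr (_ + _).
      apply: eq_bigl => j; rewrite andbC -(inj_eq val_inj) /=.
      by case: (ltngtP j k).
    have [d1 [d2 [_ _ H]]] := hC (tau k.+1 x) (pos k x) (tau_ge _ _).
    have h20 : 0 <= (a * tnth x i) ^+ 2 by exact: sqr_ge0.
    have := H (a * tnth x i) _ h20; have := H (- (a * tnth x i)) _ h20.
    rewrite sqrrN subrr mulr0 !subr0 -posS -tauS normrN.
    rewrite -posO -tauO -/(F k.+1 (mxact O x)) tauO.
    rewrite -/(F k.+1 x) -/(heat (tau k x) (pos k x)) -/(F k x).
    set h := a * tnth x i.
    have er_ge : C * (`|h| ^+ 3 + (h ^+ 2) ^+ 2) <= er x.
      rewrite /er ler_wpM2l//.
      have -> : a ^+ 2 / (2 * q) * tnth x i ^+ 2 = h ^+ 2 / (2 * q).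
        by rewrite /h; field; rewrite gt_eqF.
      have -> : (q / 2 + 1) * a ^+ 4 * (tnth x i ^+ 2) ^+ 2 = (q / 2 + 1) * (h ^+ 2) ^+ 2.
        by rewrite /h; ring.
      by rewrite -(real_normK (num_real h)); exact: cube_le.
    rewrite !ler_norml => /andP[_ H1] /andP[_ H2].
    by apply: (half_sum H1 _ er_ge); rewrite mulrN.
  have Eer : (\int[nu]_x (er x)%:E <= e%:E)%E.
    rewrite /er EX_Zl//; last 2 first.
    - by move=> x; rewrite addr_ge0// mulr_ge0// ?sqr_ge0.
    - apply: measurable_funD; apply: measurable_funM => //.
        exact: measurable_funX.
      by do 2 apply: measurable_funX.
    rewrite /e EFinM lee_wpmul2l ?lee_fin// EX_D; last 4 first.
    - by move=> x; rewrite mulr_ge0 ?sqr_ge0.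
    - by move=> x; rewrite mulr_ge0 ?sqr_ge0.
    - by apply: measurable_funM => //; exact: measurable_funX.
    - by apply: measurable_funM => //; do 2 apply: measurable_funX.
    rewrite !EX_Zl//; last 4 first.
    - by move=> x; exact: sqr_ge0.
    - by do 2 apply: measurable_funX.
    - by move=> x; exact: sqr_ge0.
    - exact: measurable_funX.
    rewrite (sphere_momentE snu r20 i 2).
    have -> : (\int[nu]_x (tnth x i ^+ 2)%:E = S%:E)%E.
      by rewrite -m1 -(sphere_momentE snu r20 i 1); apply: eq_integral => x _; rewrite expr1.
    rewrite -!EFinM -EFinD lee_fin.
    have := ler_wpM2l cc2 m2; lra.
  apply: le_trans (rotation_average snu (flip_mx_orthogonal i) (F0 _) (F0 k) er0
    (mF _) (mF k) mer pw) _.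
  by rewrite leeD2l.
rewrite (@sphere_dotp _ _ _ _ snu (fun z => heat t (x0 + z)) y flat)//; last 2 first.
- by move=> z; exact: heat_ge0.
- by apply: measurable_heat => //; exact: measurable_funD.
have -> : (\int[nu]_x (heat t (x0 + dotp x flat))%:E = \int[nu]_x (F n x)%:E)%E.
  apply: eq_integral => x _; congr (_%:E); rewrite /F /tau /pos.
  rewrite [X in _ * X]big1 ?mulr0 ?addr0; last by move=> j; rewrite leqNgt ltn_ord.
  congr (heat _ (_ + _)); rewrite /dotp mulr_sumr.
  apply: eq_big => [j|j _]; first by rewrite ltn_ord.
  by rewrite tnth_mktuple mulrC.
have ind k : (k <= n)%N -> (\int[nu]_x (F k x)%:E <= \int[nu]_x (F 0 x)%:E + (k%:R * e)%:E)%E.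
  elim: k => [_|k IH kn]; first by rewrite mul0r adde0.
  apply: le_trans (step k kn) _.
  apply: le_trans (leeD2r _ (IH (ltnW kn))) _.
  by rewrite -addeA -EFinD -natr1 mulrDl mul1r.
apply: le_trans (ind n (leqnn n)) _.
have -> : (\int[nu]_x (F 0 x)%:E = (heat (t + sqnorm (tnth y) * S) x0)%:E)%E.
  have F0E x : sqnorm (tnth x) = n%:R * S -> F 0 x = heat (t + sqnorm (tnth y) * S) x0.
    move=> xr.
    have tE : tau 0%N x = t + sqnorm (tnth y) * S.
      have -> : tau 0%N x = t + a ^+ 2 * sqnorm (tnth x) by [].
      by rewrite xr a2; field; rewrite gt_eqF.
    have pE : pos 0%N x = x0 by rewrite /pos big1 ?mulr0 ?addr0.
    by rewrite /F tE pE.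
  rewrite -(EX_cst nu).
  have h0 (x : n.-tuple R) : 0 <= heat (t + sqnorm (tnth y) * S) x0 by exact: heat_ge0.
  exact: (sphere_EX_eq snu (F0 _) h0 (mF _) (measurable_cst _) F0E).
rewrite -EFinD lee_fin lerD2l.
set v := sqnorm (tnth y) * S.
have v0 : 0 <= v by rewrite mulr_ge0 ?sqnorm_ge0// ltW.
have av : a ^+ 2 * S = v / n%:R by rewrite a2 /v; ring.
have -> : n%:R * e = C * (v / (2 * q) + (q / 2 + 1) * 3 * v ^+ 2 / q ^+ 2).
  rewrite /e av (_ : a ^+ 4 * (3 * S ^+ 2) = 3 * (a ^+ 2 * S) ^+ 2); last by ring.
  by rewrite av -qq; field; rewrite gt_eqF.
have -> : 5 * C * (v + v ^+ 2) / q = C * (5 * (v + v ^+ 2) / q) by ring.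
rewrite ler_wpM2l//.
have -> : v / (2 * q) + (q / 2 + 1) * 3 * v ^+ 2 / q ^+ 2
   = (v / 2 + (q / 2 + 1) * 3 * v ^+ 2 / q) / q by field; rewrite gt_eqF.
rewrite ler_wpM2r ?invr_ge0 ?(ltW q0)//.
(* As q >= 1, 3 (q / 2 + 1) / q <= 9 / 2. *)
have : (q / 2 + 1) * 3 * v ^+ 2 / q <= 5 * v ^+ 2.
  rewrite ler_pdivrMr//; have : 0 <= v ^+ 2 by exact: sqr_ge0.
  nra.
by lra.
Qed.

End sphere_heat.

Section law.
Context {R : realType} d (T : measurableType d) (Pr : probability T R).

Lemma EX_law d' (D : measurableType d') (X : T -> D) (mu : probability D R) (f : D -> R) :
  measurable_fun setT X -> (forall A, measurable A -> Pr (X @^-1` A) = mu A) ->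
  (forall x, 0 <= f x) -> measurable_fun setT f ->
  (\int[Pr]_w (f (X w))%:E = \int[mu]_x (f x)%:E)%E.
Proof.
move=> mX law f0 mf.
have mEf : measurable_fun setT (EFin \o f) by exact/measurable_EFinP.
have := @ge0_integral_pushforward _ _ _ _ R _ mX Pr setT (EFin \o f) measurableT mEf
  (fun y _ => f0 y).
rewrite preimage_setT => <-.
by apply: eq_measure_integral => A mA _; exact: law.
Qed.

End law.

(** * Sums of centred squares of the noise *)

Section iid.
Context {R : realType} (mu : probability R R) (s2 z4 m6 : R).
Hypothesis mu2 : (\int[mu]_x (x ^+ 2)%:E = s2%:E)%E.
Hypothesis mu4 : (\int[mu]_x (x ^+ 4)%:E = z4%:E)%E.
Hypothesis mu6 : (\int[mu]_x (x ^+ 6)%:E = m6%:E)%E.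

Lemma even_moment_integrable k m : (\int[mu]_x (x ^+ k.*2)%:E = m%:E)%E ->
  mu.-integrable setT (EFin \o (fun x : R => x ^+ k.*2)).
Proof.
move=> e; apply/integrableP; split; first exact/measurable_EFinP.
under eq_integral.
  move=> x _; rewrite /= ger0_norm; last by rewrite exprn_even_ge0// odd_double.
  over.
by rewrite e ltry.
Qed.

(** The coefficients are signed in the applications, so linearity rests here on integrability rather
    than on nonnegativity. *)
Lemma poly_moment (a0 a2 a4 a6 : R) :
  (\int[mu]_x (a0 + a2 * x ^+ 2 + a4 * x ^+ 4 + a6 * x ^+ 6)%:E
    = (a0 + a2 * s2 + a4 * z4 + a6 * m6)%:E)%E.
Proof.
have i2 := @even_moment_integrable 1 _ mu2.
have i4 := @even_moment_integrable 2 _ mu4.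
have i6 := @even_moment_integrable 3 _ mu6.
have iZ k (a : R) : mu.-integrable setT (EFin \o (fun x : R => x ^+ k)) ->
  mu.-integrable setT (EFin \o (fun x : R => a * x ^+ k)).
  by move=> ik; exact: (integrableZl measurableT a ik).
have eZ k (a : R) : mu.-integrable setT (EFin \o (fun x : R => x ^+ k)) ->
  (\int[mu]_x (a * x ^+ k)%:E = a%:E * \int[mu]_x (x ^+ k)%:E)%E.
  by move=> ik; rewrite -(integralZl measurableT ik); apply: eq_integral.
have i0 : mu.-integrable setT (EFin \o (fun x : R => a0)).
  exact: finite_measure_integrable_cst.
have i02 : mu.-integrable setT (EFin \o (fun x : R => a0 + a2 * x ^+ 2)).
  exact: (integrableD measurableT i0 (iZ _ _ i2)).
have i04 : mu.-integrable setT (EFin \o (fun x : R => a0 + a2 * x ^+ 2 + a4 * x ^+ 4)).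
  exact: (integrableD measurableT i02 (iZ _ _ i4)).
have := integralD_EFin measurableT i04 (iZ _ a6 i6).
have := integralD_EFin measurableT i02 (iZ _ a4 i4).
have := integralD_EFin measurableT i0 (iZ _ a2 i2).
rewrite /= => e1 e2 e3.
rewrite [LHS]e3 [X in (X + _)%E]e2 [X in ((X + _) + _)%E]e1.
by rewrite !eZ// mu2 mu4 mu6 EX_cst -!EFinM -!EFinD.
Qed.

Lemma s2_ge0 : 0 <= s2.
Proof. by rewrite -lee_fin -mu2; apply: integral_ge0 => x _; rewrite lee_fin sqr_ge0. Qed.

Lemma m6_ge0 : 0 <= m6.
Proof.
by rewrite -lee_fin -mu6; apply: integral_ge0 => x _; rewrite lee_fin exprn_even_ge0.
Qed.

Lemma square_variance :
  (\int[mu]_x ((x ^+ 2 - s2) ^+ 2)%:E = (z4 - s2 ^+ 2)%:E)%E.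
Proof.
have := poly_moment (s2 ^+ 2) (- 2 * s2) 1 0.
under eq_integral => x _.
  rewrite (_ : _ + _ = (x ^+ 2 - s2) ^+ 2); last by ring.
  over.
by move=> ->; congr (_%:E); ring.
Qed.

Lemma square_variance_ge0 : 0 <= z4 - s2 ^+ 2.
Proof.
by rewrite -lee_fin -square_variance; apply: integral_ge0 => x _; rewrite lee_fin sqr_ge0.
Qed.

Section chain.
Context d (T : measurableType d) (Pr : probability T R) (n : nat) (Z : 'I_n -> T -> R).
Variable g : R -> R.
Hypothesis mg : measurable_fun setT g.
Hypothesis mZ : forall k, measurable_fun setT (Z k).
Hypothesis lawZ : forall k A, measurable A -> Pr (Z k @^-1` A) = mu A.

Definition partial_sum k w := \sum_(i < n | (i < k)%N) g (Z i w).

Hypothesis indZ : forall k : 'I_n, indep_maps Pr (Z k) (partial_sum k).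

Lemma measurable_partial_sum k : measurable_fun setT (partial_sum k).
Proof.
have -> : partial_sum k = fun w => \sum_(i < n) (if (i < k)%N then g (Z i w) else 0).
  by apply/funext => w; rewrite /partial_sum big_mkcond.
by apply: measurable_sum => i; case: (i < k)%N => //; exact: (measurableT_comp mg (mZ i)).
Qed.

(** If averaging over one more term turns f_(k+1) into at most f_k + e, the errors add up. A
    quadratic f_k yields the variance bound, a heat evolution the Lindeberg replacement. *)
Lemma iid_chain (f : nat -> R -> R) (e : R) :
  (forall k x, 0 <= f k x) -> (forall k, measurable_fun setT (f k)) -> 0 <= e ->
  (forall k x, (k < n)%N -> \int[mu]_z (f k.+1 (x + g z))%:E <= (f k x + e)%:E)%E ->
  (\int[Pr]_w (f n (\sum_(i < n) g (Z i w)))%:E <= (f 0 0 + n%:R * e)%:E)%E.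
Proof.
move=> f0 mf e0 H.
have ind k : (k <= n)%N ->
    (\int[Pr]_w (f k (partial_sum k w))%:E <= (f 0 0 + k%:R * e)%:E)%E.
  elim: k => [_|k IH kn].
    rewrite mul0r addr0 (_ : (fun w => _) = cst (f 0 0)%:E) ?EX_cst//.
    by apply/funext => w; rewrite /partial_sum big1.
  pose i := Ordinal kn.
  pose F (z : R * R) := f k.+1 (z.2 + g z.1).
  have mF : measurable_fun setT F.
    apply: (measurableT_comp (mf _)); apply: measurable_funD => //.
    exact: (measurableT_comp mg).
  have -> : (\int[Pr]_w (f k.+1 (partial_sum k.+1 w))%:E =
             \int[Pr]_w (F (Z i w, partial_sum k w))%:E)%E.
    apply: eq_integral => w _; congr (_%:E); rewrite /F /=; congr (f _ _).
    rewrite /partial_sum (bigD1 i)/= ?ltnS// addrC; congr (_ + _).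
    apply: eq_bigl => j; rewrite ltnS leq_eqVlt andbC -(inj_eq val_inj) /=.
    by case: (ltngtP j k).
  apply: (@le_trans _ _ (\int[Pr]_w (f k (partial_sum k w) + e)%:E)%E).
    apply: (indep_le (mZ i) (measurable_partial_sum k) (indZ i)
       (g := fun y => f k y + e)) => //.
    - by move=> z; exact: f0.
    - exact: measurable_funD.
    - move=> y; rewrite /F /= (EX_law (mZ i) (@lawZ i) (f := fun z => f k.+1 (y + g z)))//.
        exact: H.
      by apply: (measurableT_comp (mf _)); exact: measurable_funD.
  rewrite EX_D//; last exact: (measurableT_comp (mf k) (measurable_partial_sum k)).
  rewrite EX_cst; apply: le_trans (leeD2r _ (IH (ltnW kn))) _.
  by rewrite -EFinD -natr1 mulrDl mul1r addrA.
apply: le_trans (ind n (leqnn n)); rewrite le_eqVlt; apply/orP; left; apply/eqP.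
apply: eq_integral => w _; congr (f n _)%:E; rewrite /partial_sum.
by apply: eq_bigl => i; rewrite ltn_ord.
Qed.

End chain.

Section applications.

Lemma iid_second_moment d (T : measurableType d) (Pr : probability T R) (n : nat)
    (Z : 'I_n -> T -> R) :
  (forall k, measurable_fun setT (Z k)) ->
  (forall k A, measurable A -> Pr (Z k @^-1` A) = mu A) ->
  (forall k : 'I_n, indep_maps Pr (Z k) (partial_sum Z (fun z => z ^+ 2 - s2) k)) ->
  (\int[Pr]_w ((\sum_(i < n) (Z i w ^+ 2 - s2)) ^+ 2)%:E
     <= (n%:R * (z4 - s2 ^+ 2))%:E)%E.
Proof.
move=> mZ lawZ indZ.
have mg : measurable_fun setT (fun z : R => z ^+ 2 - s2).
  by apply: measurable_funB => //; exact: measurable_funX.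
(* The variance of the n - k terms still to come is included, which makes each step exact, with e =
   0. *)
pose f k (x : R) := x ^+ 2 + (n - k)%:R * (z4 - s2 ^+ 2).
have v0 := square_variance_ge0.
have := @iid_chain _ _ _ n Z _ mg mZ lawZ indZ f 0.
rewrite /f subnn mul0r expr0n /= subn0 add0r mulr0 addr0.
under [X in _ -> _ -> _ -> _ -> (X <= _)%E]eq_integral do rewrite addr0.
apply => //.
- by move=> k x; rewrite addr_ge0 ?sqr_ge0// mulr_ge0.
- by move=> k; apply: measurable_funD => //; exact: measurable_funX.
- move=> k x kn.
  pose K := (n - k.+1)%:R * (z4 - s2 ^+ 2).
  have := poly_moment (x ^+ 2 - 2 * x * s2 + s2 ^+ 2 + K) (2 * x - 2 * s2) 1 0.
  have E z : x ^+ 2 - 2 * x * s2 + s2 ^+ 2 + K + (2 * x - 2 * s2) * z ^+ 2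
      + 1 * z ^+ 4 + 0 * z ^+ 6 = (x + (z ^+ 2 - s2)) ^+ 2 + K by ring.
  under eq_integral do rewrite E.
  move=> ->; rewrite lee_fin addr0 /K.
  have -> : ((n - k)%:R : R) = (n - k.+1)%:R + 1 by rewrite natr1 subnSK.
  by lra.
Qed.

(** The terms not yet added are represented by the time (n - k) s, where s is the variance of one
    term. The sixth moment of the noise enters through the third absolute moment of Z^2 - s2. *)
Lemma iid_heat (t0 c : R) : 0 < t0 -> exists2 K : R, 0 <= K &
  forall d (T : measurableType d) (Pr : probability T R) (n : nat) (Z : 'I_n -> T -> R),
  (0 < n)%N ->
  (forall k, measurable_fun setT (Z k)) ->
  (forall k A, measurable A -> Pr (Z k @^-1` A) = mu A) ->
  (forall k : 'I_n, indep_maps Pr (Z k) (partial_sum Z (fun z => z ^+ 2 - s2) k)) ->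
  forall t x0 : R, t0 <= t ->
  (\int[Pr]_w (heat t (x0 + c / Num.sqrt n%:R * \sum_(i < n) (Z i w ^+ 2 - s2)))%:E
     <= (heat (t + c ^+ 2 * (z4 - s2 ^+ 2)) x0 + K / Num.sqrt n%:R)%:E)%E.
Proof.
move=> t00; have [C C0 hC] := heat_step t00.
have v0 := square_variance_ge0; set v := z4 - s2 ^+ 2 in v0 *.
have s20 := s2_ge0; have m60 := m6_ge0.
exists (C * (`|c| ^+ 3 * (m6 + s2 ^+ 3) + (c ^+ 2 * v) ^+ 2)).
  rewrite mulr_ge0// addr_ge0 ?sqr_ge0// mulr_ge0// addr_ge0// exprn_ge0//.
move=> d T Pr n Z n0 mZ lawZ indZ t x0 tt0.
have nR : (0 : R) < n%:R by rewrite ltr0n.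
set q := Num.sqrt n%:R : R.
have q0 : 0 < q by rewrite sqrtr_gt0.
have q1 : 1 <= q by rewrite -sqrtr1 ler_wsqrtr// ler1n.
have qq : q ^+ 2 = n%:R by rewrite sqr_sqrtr// ltW.
have mg : measurable_fun setT (fun z : R => z ^+ 2 - s2).
  by apply: measurable_funB => //; exact: measurable_funX.
pose b := c / q.
have b2 : b ^+ 2 = c ^+ 2 / n%:R by rewrite /b expr_div_n qq.
pose s := b ^+ 2 * v.
have s0 : 0 <= s by rewrite mulr_ge0// sqr_ge0.
pose e := C * (`|b| ^+ 3 * (m6 + s2 ^+ 3) + s ^+ 2).
have e0 : 0 <= e.
  by rewrite mulr_ge0// addr_ge0 ?sqr_ge0// mulr_ge0// addr_ge0// exprn_ge0.
pose f k (x : R) := heat (t + (n - k)%:R * s) (x0 + b * x).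
have := @iid_chain _ _ _ n Z _ mg mZ lawZ indZ f e.
rewrite /f subnn mul0r subn0 addr0 mulr0 addr0.
have -> : n%:R * s = c ^+ 2 * v.
  by rewrite /s b2; field; rewrite gt_eqF.
move=> h; apply: le_trans (h _ _ _ _) _ => //.
- by move=> k x; exact: heat_ge0.
- move=> k; by apply: measurable_heat => //; apply: measurable_funD.
- move=> k x kn.
  set tau := t + (n - k.+1)%:R * s.
  have tau0 : t0 <= tau by apply: le_trans tt0 _; rewrite lerDl mulr_ge0.
  have -> : t + (n - k)%:R * s = tau + s.
    by rewrite /tau -addrA; congr (_ + _); rewrite -(subnSK kn) -natr1; ring.
  have [d1 [d2 [_ _ H]]] := hC tau (x0 + b * x) tau0.
  (* The upper bound from [heat_step], written as an even polynomial of degree 6 in z. In its mean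
     the d1 and d2 terms disappear, since Z^2 - s2 is centred with variance v. *)
  have := poly_moment (heat (tau + s) (x0 + b * x) + C * s ^+ 2 - d1 * b * s2
     + d2 * (b ^+ 2 * s2 ^+ 2 - s) + C * `|b| ^+ 3 * s2 ^+ 3)
     (d1 * b - d2 * b ^+ 2 * 2 * s2) (d2 * b ^+ 2) (C * `|b| ^+ 3).
  have -> : heat (tau + s) (x0 + b * x) + C * s ^+ 2 - d1 * b * s2
      + d2 * (b ^+ 2 * s2 ^+ 2 - s) + C * `|b| ^+ 3 * s2 ^+ 3
      + (d1 * b - d2 * b ^+ 2 * 2 * s2) * s2 + d2 * b ^+ 2 * z4
      + C * `|b| ^+ 3 * m6 = heat (tau + s) (x0 + b * x) + e.
    by rewrite /e /s /v; ring.
  move=> <-; apply: ge0_le_integral => //.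
  + by move=> z _; rewrite lee_fin heat_ge0.
  + apply/measurable_EFinP; apply: measurable_heat => //.
    apply: measurable_funD => //; apply: measurable_funM => //.
    exact: measurable_funD.
  + apply/measurable_EFinP; do ?apply: measurable_funD => //;
    apply: measurable_funM => //; exact: measurable_funX.
  + move=> z _; rewrite lee_fin.
    have := H (b * (z ^+ 2 - s2)) s s0.
    rewrite ler_norml => /andP[_].
    have -> : x0 + b * x + b * (z ^+ 2 - s2) = x0 + b * (x + (z ^+ 2 - s2)) by ring.
    (* The difference of two nonnegative numbers is at most the larger one, so its cube is at most
       the sum of their cubes. *)
    have h3 : `|b * (z ^+ 2 - s2)| ^+ 3 <= `|b| ^+ 3 * (z ^+ 6 + s2 ^+ 3).
      rewrite normrM exprMn ler_wpM2l ?exprn_ge0//.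
      rewrite (_ : z ^+ 6 = (z ^+ 2) ^+ 3); last by rewrite -exprM.
      have : 0 <= z ^+ 2 by exact: sqr_ge0.
      move: (z ^+ 2) => u u0.
      have [us|us] := leP s2 u.
        rewrite ger0_norm ?subr_ge0//.
        apply: (@le_trans _ _ (u ^+ 3)); last by rewrite lerDl exprn_ge0.
        by rewrite lerXn2r ?nnegrE ?subr_ge0// gerBl.
      rewrite ltr0_norm ?subr_lt0// opprB.
      apply: (@le_trans _ _ (s2 ^+ 3)); last by rewrite lerDr exprn_ge0.
      by rewrite lerXn2r ?nnegrE ?subr_ge0// ?gerBl// ltW.
    have := ler_wpM2l C0 h3; lra.
- rewrite lee_fin lerD2l /e.
  have bc : `|b| = `|c| / q by rewrite /b normrM normfV (gtr0_norm q0).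
  rewrite bc /s b2 -qq.
  have -> : q ^+ 2 * (C * ((`|c| / q) ^+ 3 * (m6 + s2 ^+ 3) + (c ^+ 2 / q ^+ 2 * v) ^+ 2))
    = C * (`|c| ^+ 3 * (m6 + s2 ^+ 3) + (c ^+ 2 * v) ^+ 2 / q) / q.
    by field; rewrite gt_eqF.
  rewrite ler_wpM2r ?invr_ge0 ?(ltW q0)// ler_wpM2l// lerD2l.
  by rewrite ler_pdivrMr// ler_peMr ?sqr_ge0.
Qed.

End applications.
End iid.

(** * Energy of the noise *)

Section tuples.
Context {R : realType} {n : nat}.
Implicit Types x y : n.-tuple R.

Definition addt x y : n.-tuple R := [tuple tnth x i + tnth y i | i < n].
Definition subt x y : n.-tuple R := [tuple tnth x i - tnth y i | i < n].
Definition scalet (c : R) x : n.-tuple R := [tuple c * tnth x i | i < n].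

Lemma sqnorm_addt x y :
  sqnorm (tnth (addt x y)) = sqnorm (tnth x) + 2 * dotp x y + sqnorm (tnth y).
Proof.
rewrite /sqnorm /dotp mulr_sumr -!big_split /=.
by apply: eq_bigr => i _; rewrite tnth_mktuple; ring.
Qed.

Lemma dotp_scalet c x y : dotp x (scalet c y) = c * dotp x y.
Proof.
by rewrite /dotp mulr_sumr; apply: eq_bigr => i _; rewrite tnth_mktuple; ring.
Qed.

Lemma sqnorm_scalet c x : sqnorm (tnth (scalet c x)) = c ^+ 2 * sqnorm (tnth x).
Proof.
by rewrite /sqnorm mulr_sumr; apply: eq_bigr => i _; rewrite tnth_mktuple exprMn.
Qed.

Lemma sqdist_subt x y : sqdist (tnth x) (tnth y) = sqnorm (tnth (subt x y)).
Proof. by apply: eq_bigr => i _; rewrite tnth_mktuple. Qed.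

Lemma measurable_addt d (T : measurableType d) (X Y : T -> n.-tuple R) :
  measurable_fun setT X -> measurable_fun setT Y ->
  measurable_fun setT (fun w => addt (X w) (Y w)).
Proof.
move=> mX mY; apply/measurable_fun_tnthP => i.
rewrite (_ : _ \o _ = fun w => tnth (X w) i + tnth (Y w) i); last first.
  by apply/funext => w /=; rewrite tnth_mktuple.
by apply: measurable_funD; exact: (measurableT_comp (measurable_tnth i)).
Qed.

Lemma measurable_subt d (T : measurableType d) (X Y : T -> n.-tuple R) :
  measurable_fun setT X -> measurable_fun setT Y ->
  measurable_fun setT (fun w => subt (X w) (Y w)).
Proof.
move=> mX mY; apply/measurable_fun_tnthP => i.
rewrite (_ : _ \o _ = fun w => tnth (X w) i - tnth (Y w) i); last first.
  by apply/funext => w /=; rewrite tnth_mktuple.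
by apply: measurable_funB; exact: (measurableT_comp (measurable_tnth i)).
Qed.

End tuples.

Lemma measurable_set_le {R : realType} d (T : measurableType d) (f g : T -> R) :
  measurable_fun setT f -> measurable_fun setT g -> measurable [set w | f w <= g w].
Proof.
move=> mf mg; have := measurable_fun_ler mf mg measurableT.
by move=> /(_ [set true] I); rewrite setTI.
Qed.

(** * Random codewords: cap probabilities, energy concentration, tails *)

Section sphere_rv.
Context {R : realType} d (T : measurableType d) (Pr : probability T R) {n : nat}.
Implicit Types X Y N : T -> n.-tuple R.

Definition sphere_rv X (r2 : R) := measurable_fun setT X /\
  exists2 nu : probability (n.-tuple R) R, sphere_law nu r2 &
    forall A, measurable A -> Pr (X @^-1` A) = nu A.

Lemma uniform_sphere_rv X r2 : measurable_fun setT X -> uniform_sphere Pr X r2 ->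
  sphere_rv X r2.
Proof.
move=> mX [X1 X2]; split => //.
pose mfX := HB.pack_for {mfun T >-> n.-tuple R} X (@isMeasurableFun.Build _ _ T _ X mX).
exists (distribution Pr mfX : probability _ _) => //.
Qed.

Lemma sphere_rv_as X r2 : sphere_rv X r2 ->
  measurable [set w | sqnorm (tnth (X w)) = r2] /\
  Pr (~` [set w | sqnorm (tnth (X w)) = r2]) = 0%E.
Proof.
move=> [mX [nu snu law]].
have mA : measurable [set w | sqnorm (tnth (X w)) = r2].
  by have := mX measurableT _ (measurable_sphere r2); rewrite setTI.
split => //; rewrite probability_setC// (_ : Pr _ = 1%E) ?subee//.
by case: snu => <- _; rewrite -law//; exact: measurable_sphere.
Qed.

Lemma sphere_rv_le d' (D : measurableType d') X (Y : T -> D) r2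
    (F : n.-tuple R * D -> R) (g : D -> R) :
  sphere_rv X r2 -> measurable_fun setT Y -> indep_maps Pr X Y ->
  (forall z, 0 <= F z) -> measurable_fun setT F -> measurable_fun setT g ->
  (forall nu : probability (n.-tuple R) R, sphere_law nu r2 -> forall y,
     \int[nu]_x (F (x, y))%:E <= (g y)%:E)%E ->
  (\int[Pr]_w (F (X w, Y w))%:E <= \int[Pr]_w (g (Y w))%:E)%E.
Proof.
move=> [mX [nu snu law]] mY iXY F0 mF mg H.
apply: indep_le => // y.
rewrite (EX_law mX law (f := fun x => F (x, y)))//; first exact: H.
by apply: (measurableT_comp mF); exact: measurable_fun_pair.
Qed.

Section caps.
Variables (r2 s q : R) (m : nat).
Hypotheses (r20 : 0 < r2) (s01 : 0 <= s < 1) (q0 : 0 < q).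
Hypotheses (m0 : (0 < m)%N) (mn : (m.*2 <= n)%N).

Let weight (x y : n.-tuple R) : R := (1 - s * corr2 x y)^-1 ^+ m.

Let weight_ge0 x y : 0 <= weight x y.
Proof. by rewrite exprn_ge0// invr_ge0 ltW// corr_factor_gt0. Qed.

Let measurable_weight d' (T' : measurableType d') (X Y : T' -> n.-tuple R) :
  measurable_fun setT X -> measurable_fun setT Y ->
  measurable_fun setT (fun w => weight (X w) (Y w)).
Proof.
move=> mX mY; apply: measurable_funX; apply: measurable_funV.
apply: measurable_funB => //; apply: measurable_funM => //.
exact: measurable_corr2.
Qed.

Lemma corr_mgf_rv X Y : sphere_rv X r2 -> measurable_fun setT Y -> indep_maps Pr X Y ->
  (\int[Pr]_w (weight (X w) (Y w))%:E <= ((1 - s)^-1)%:E)%E.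
Proof.
move=> sX mY iXY; rewrite -(EX_cst Pr).
apply: (sphere_rv_le (F := fun z => weight z.1 z.2) (g := fun=> (1 - s)^-1) sX mY iXY) => //.
- exact: measurable_weight.
- by move=> nu snu y; exact: (sphere_corr_mgf _ snu).
Qed.

Lemma sphere_cap X Y : sphere_rv X r2 -> measurable_fun setT Y -> indep_maps Pr X Y ->
  (Pr [set w | (1 - s * corr2 (X w) (Y w) <= q)%R] <= (q ^+ m / (1 - s))%:E)%E.
Proof.
move=> sX mY iXY; have mX := sX.1.
have qm : 0 < q ^+ m by exact: exprn_gt0.
apply: le_trans (_ : _ <= (((q ^+ m)^-1)^-1)%:E * \int[Pr]_w (weight (X w) (Y w))%:E)%E _.
  apply: markov_EX => //.
  - by rewrite invr_gt0.
  - exact: measurable_weight.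
  - apply: measurable_set_le => //; apply: measurable_funB => //.
    by apply: measurable_funM => //; exact: measurable_corr2.
  - move=> w /= h; rewrite /weight -exprVn lerXn2r ?nnegrE ?invr_ge0 ?(ltW q0)//.
      by rewrite ltW// corr_factor_gt0.
    by rewrite lef_pV2// posrE corr_factor_gt0.
rewrite invrK EFinM lee_pmul2l ?lte_fin//.
exact: corr_mgf_rv.
Qed.

(** The codewords are integrated in turn: with (Y, V) frozen, U contributes a factor 1 / (1 - s)
    whatever the vector Y - V is, and then V contributes another. *)
Lemma sphere_cap2 r2' V U Y : 0 < r2' -> sphere_rv V r2 -> sphere_rv U r2' ->
  measurable_fun setT Y -> indep_maps Pr V Y -> indep_maps Pr U (fun w => (Y w, V w)) ->
  (Pr [set w | ((1 - s * corr2 (V w) (Y w)) * (1 - s * corr2 (U w) (subt (Y w) (V w))) <= q)%R]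
    <= (q ^+ m / (1 - s) ^+ 2)%:E)%E.
Proof.
move=> r20' sV sU mY iVY iU; have mV := sV.1; have mU := sU.1.
have /andP[s0 s1] := s01.
have qm : 0 < q ^+ m by exact: exprn_gt0.
have mS : measurable_fun setT (fun w => subt (Y w) (V w)) by exact: measurable_subt.
pose f w := weight (V w) (Y w) * weight (U w) (subt (Y w) (V w)).
apply: le_trans (_ : _ <= (((q ^+ m)^-1)^-1)%:E * \int[Pr]_w (f w)%:E)%E _.
  apply: markov_EX => //.
  - by rewrite invr_gt0.
  - by move=> w; rewrite mulr_ge0.
  - by apply: measurable_funM; exact: measurable_weight.
  - by apply: measurable_set_le => //; apply: measurable_funM;
      apply: measurable_funB => //; apply: measurable_funM => //; exact: measurable_corr2.
  - move=> w /= h; rewrite /f /weight -exprMn -invfM -exprVn lerXn2r ?nnegrE ?invr_ge0 ?(ltW q0)//.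
      by rewrite mulr_ge0// ltW// corr_factor_gt0.
    by rewrite lef_pV2// posrE mulr_gt0// corr_factor_gt0.
rewrite invrK EFinM lee_pmul2l ?lte_fin//.
pose F (z : n.-tuple R * (n.-tuple R * n.-tuple R)) :=
  weight z.2.2 z.2.1 * weight z.1 (subt z.2.1 z.2.2).
have m1 : measurable_fun setT (fun z : n.-tuple R * (n.-tuple R * n.-tuple R) => z.2.1).
  exact: (measurableT_comp measurable_fst).
have m2 : measurable_fun setT (fun z : n.-tuple R * (n.-tuple R * n.-tuple R) => z.2.2).
  exact: (measurableT_comp measurable_snd).
apply: (@le_trans _ _ (\int[Pr]_w ((1 - s)^-1 * weight (V w) (Y w))%:E)%E).
  apply: (sphere_rv_le (F := F) (Y := fun w => (Y w, V w))
    (g := fun yv => (1 - s)^-1 * weight yv.2 yv.1) sU) => //.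
  - exact: measurable_fun_pair.
  - by move=> z; rewrite mulr_ge0.
  - by apply: measurable_funM; apply: measurable_weight => //; exact: measurable_subt.
  - by apply: measurable_funM => //; exact: measurable_weight.
  - move=> nu snu [y v]; rewrite /F /=.
    rewrite EX_Zl//; last by apply: measurable_weight => //; exact: measurable_id.
    rewrite mulrC EFinM lee_wpmul2l ?lee_fin//.
    exact: (sphere_corr_mgf _ snu).
rewrite EX_Zl//; last 2 first.
- by rewrite invr_ge0 subr_ge0 ltW.
- exact: measurable_weight.
rewrite expr2 invfM EFinM lee_wpmul2l ?lee_fin ?invr_ge0 ?subr_ge0 ?(ltW s1)//.
exact: corr_mgf_rv.
Qed.

End caps.

Lemma dotp_second_moment X Y S : (0 < n)%N -> 0 < S -> sphere_rv X (n%:R * S) ->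
  measurable_fun setT Y -> indep_maps Pr X Y ->
  (\int[Pr]_w (dotp (X w) (Y w) ^+ 2)%:E
    <= \int[Pr]_w (S * sqnorm (tnth (Y w)))%:E)%E.
Proof.
move=> n0 S0 sX mY iXY.
have nR : (0 : R) < n%:R by rewrite ltr0n.
apply: (sphere_rv_le (F := fun z => dotp z.1 z.2 ^+ 2)
   (g := fun y => S * sqnorm (tnth y)) sX mY iXY).
- by move=> z; exact: sqr_ge0.
- by apply: measurable_funX; exact: measurable_dotp.
- by apply: measurable_funM => //; exact: measurable_sqnorm.
- move=> nu snu y; have r20 : 0 <= n%:R * S by rewrite mulr_ge0// ltW.
  have := dotp_moment snu r20 (Ordinal n0) y 1; rewrite expr1.
  under eq_integral do rewrite expr1.
  move=> ->; rewrite lee_fin.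
  have := sphere_moment1 snu r20 (Ordinal n0); rewrite mulrC => /mulfI ->//.
  by rewrite gt_eqF.
Qed.

(** Mean square concentration of the normalized energy. This property survives the addition of a
    codeword, so interference can be treated as noise. *)
Definition noise_ok N (s2 K : R) := measurable_fun setT N /\
  (\int[Pr]_w ((sqnorm (tnth (N w)) / n%:R - s2) ^+ 2)%:E <= (K / n%:R)%:E)%E.

Lemma measurable_noise_dev d' (T' : measurableType d') (N : T' -> n.-tuple R) (s2 : R) :
  measurable_fun setT N ->
  measurable_fun setT (fun w => (sqnorm (tnth (N w)) / n%:R - s2) ^+ 2).
Proof.
move=> mN; apply: measurable_funX; apply: measurable_funB => //.
by apply: measurable_funM => //; exact: measurable_sqnorm.
Qed.

(** In |X + N|^2 the part |X|^2 = n S is constant, and the cross term has conditional mean square of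
    order S |N|^2, hence O (1/n) after normalization. The constants come from (a + b)^2 <= 2 a^2 + 2
    b^2 and a <= s2 + 1 + (a - s2)^2. *)
Lemma noise_add X N (S s2 K : R) : (0 < n)%N -> 0 < S -> 0 <= s2 -> 0 <= K ->
  sphere_rv X (n%:R * S) -> noise_ok N s2 K -> indep_maps Pr X N ->
  noise_ok (fun w => addt (X w) (N w)) (S + s2) (2 * K + 8 * S * (s2 + 1 + K)).
Proof.
move=> n0 S0 s20 K0 sX [mN nN] iXN; have mX := sX.1.
have n1 : (1 : R) <= n%:R by rewrite ler1n.
have nR : (0 : R) < n%:R by rewrite ltr0n.
have mXN := measurable_addt mX mN.
split => //.
have [mD PD] := sphere_rv_as sX.
have mdot : measurable_fun setT (fun w => dotp (X w) (N w) ^+ 2).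
  by apply: measurable_funX; exact: measurable_dotp.
have mdev := measurable_noise_dev s2 mN.
pose c := 8 / n%:R ^+ 2 : R.
have c0 : 0 <= c by rewrite divr_ge0// exprn_ge0// ltW.
apply: (@le_trans _ _ (\int[Pr]_w (2 * (sqnorm (tnth (N w)) / n%:R - s2) ^+ 2
     + c * dotp (X w) (N w) ^+ 2)%:E)%E).
  apply: (le_EX_ae mD PD).
  - by move=> w; exact: sqr_ge0.
  - by move=> w; rewrite addr_ge0// mulr_ge0// sqr_ge0.
  - exact: measurable_noise_dev.
  - by apply: measurable_funD; exact: measurable_funM.
  - move=> w /= Xw; rewrite sqnorm_addt Xw.
    rewrite (_ : _ - _ = (sqnorm (tnth (N w)) / n%:R - s2) + 2 * dotp (X w) (N w) / n%:R); last first.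
      by field; rewrite gt_eqF.
    have -> : c * dotp (X w) (N w) ^+ 2 = 2 * (2 * dotp (X w) (N w) / n%:R) ^+ 2.
      by rewrite /c; field; rewrite gt_eqF.
    move: (_ - s2) (2 * _ / _) => a b.
    have : 0 <= (a - b) ^+ 2 by exact: sqr_ge0.
    nra.
rewrite EX_D//; last 4 first.
- by move=> w; rewrite mulr_ge0// sqr_ge0.
- by move=> w; rewrite mulr_ge0// sqr_ge0.
- exact: measurable_funM.
- exact: measurable_funM.
rewrite !EX_Zl//; try by move=> w; exact: sqr_ge0.
have msq : measurable_fun setT (fun w => sqnorm (tnth (N w))) by exact: measurable_sqnorm.
have H2 : (\int[Pr]_w (S * sqnorm (tnth (N w)))%:E <= (n%:R * S * (s2 + 1 + K))%:E)%E.
  apply: (@le_trans _ _ (\int[Pr]_w (n%:R * S * (s2 + 1)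
     + n%:R * S * (sqnorm (tnth (N w)) / n%:R - s2) ^+ 2)%:E)%E).
    apply: le_EX => //.
    - by move=> w; rewrite mulr_ge0 ?sqnorm_ge0// ltW.
    - exact: measurable_funM.
    - by apply: measurable_funD => //; exact: measurable_funM.
    - move=> w; rewrite -mulrDr.
      have -> : S * sqnorm (tnth (N w)) = n%:R * S * (sqnorm (tnth (N w)) / n%:R).
        by field; rewrite gt_eqF.
      rewrite ler_wpM2l ?mulr_ge0 ?(ltW S0)//.
      move: (_ / n%:R) => a; have : 0 <= (a - s2 - 1 / 2) ^+ 2 by exact: sqr_ge0.
      nra.
  rewrite EX_D//; last 3 first.
  - by move=> w; rewrite !mulr_ge0 ?addr_ge0// ltW.
  - by move=> w; rewrite mulr_ge0 ?sqr_ge0// mulr_ge0// ltW.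
  - exact: measurable_funM.
  rewrite EX_cst EX_Zl//; last 2 first.
  - by rewrite mulr_ge0// ltW.
  - by move=> w; exact: sqr_ge0.
  have nS0 : 0 <= n%:R * S by rewrite mulr_ge0// ltW.
  apply: le_trans (leeD2l _ (lee_wpmul2l _ nN)) _; rewrite ?lee_fin//.
  rewrite [leRHS]mulrDr lerD2l ler_wpM2l//.
  by rewrite ler_pdivrMr// ler_peMr.
have H3 := le_trans (dotp_second_moment n0 S0 sX mN iXN) H2.
apply: le_trans (leeD (lee_wpmul2l _ nN) (lee_wpmul2l _ H3)) _; rewrite ?lee_fin//.
rewrite /c.
rewrite le_eqVlt; apply/orP; left; apply/eqP; field.
by rewrite gt_eqF.
Qed.

Lemma noise_dev N (s2 K del : R) : (0 < n)%N -> 0 < del -> noise_ok N s2 K ->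
  (Pr [set w | (del <= `|sqnorm (tnth (N w)) / n%:R - s2|)%R]
     <= (K / (n%:R * del ^+ 2))%:E)%E.
Proof.
move=> n0 d0 [mN nN].
have d2 : 0 < del ^+ 2 by exact: exprn_gt0.
apply: le_trans (_ : _ <= ((del ^+ 2)^-1)%:E *
   \int[Pr]_w ((sqnorm (tnth (N w)) / n%:R - s2) ^+ 2)%:E)%E _.
  apply: markov_EX => //.
  - by move=> w; exact: sqr_ge0.
  - exact: measurable_noise_dev.
  - apply: measurable_set_le => //; apply: measurableT_comp => //.
    apply: measurable_funB => //.
    by apply: measurable_funM => //; exact: measurable_sqnorm.
  - move=> w /= h; rewrite -[leRHS]real_normK ?num_real// lerXn2r ?nnegrE// ltW//.
apply: le_trans (lee_wpmul2l _ nN) _; first by rewrite lee_fin invr_ge0 ltW.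
rewrite -EFinM lee_fin le_eqVlt; apply/orP; left; apply/eqP; field.
by rewrite (gt_eqF d0)/= pnatr_eq0 -lt0n.
Qed.

(** On this event a wrong codeword as close to Y as the true one has squared cosine at least 1 - x
    with Y; the positivity of |Y|^2 permits the division. *)
Definition ratio_good (N Y : T -> n.-tuple R) (x : R) : set T :=
  [set w | sqnorm (tnth (N w)) <= x * sqnorm (tnth (Y w)) /\ 0 < sqnorm (tnth (Y w))].

Lemma measurable_ratio_good N Y x : measurable_fun setT N -> measurable_fun setT Y ->
  measurable (ratio_good N Y x).
Proof.
move=> mN mY; apply: measurableI.
  apply: measurable_set_le; first exact: measurable_sqnorm.
  by apply: measurable_funM => //; exact: measurable_sqnorm.
rewrite [X in measurable X](_ : _ = ~` [set w | sqnorm (tnth (Y w)) <= 0]); last first.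
  apply/seteqP; split => w /=; first by rewrite ltNge => /negP.
  by move/negP; rewrite -ltNge.
apply: measurableC; apply: measurable_set_le => //; exact: measurable_sqnorm.
Qed.

Lemma ratio_ok N Y (a b x K K' : R) : (0 < n)%N -> 0 <= a -> 0 < x <= 1 -> a < x * b ->
  noise_ok N a K -> noise_ok Y b K' ->
  (Pr (~` ratio_good N Y x)
    <= ((K + K') * 16 / (x * b - a) ^+ 2 / n%:R)%:E)%E.
Proof.
move=> n0 a0 /andP[x0 x1] axb nN nY.
have nR : (0 : R) < n%:R by rewrite ltr0n.
(* If both normalized energies deviate by less than [del], then a + del <= x (b - del) separates
   them, because x <= 1 and 2 del is below the gap x b - a. *)
pose del := (x * b - a) / 4.
have d0 : 0 < del by rewrite /del; lra.
pose E (N : T -> n.-tuple R) s := [set w | del <= `|sqnorm (tnth (N w)) / n%:R - s|].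
have mE N' s : measurable_fun setT N' -> measurable (E N' s).
  move=> mN'; apply: measurable_set_le => //; apply: measurableT_comp => //.
  apply: measurable_funB => //.
  by apply: measurable_funM => //; exact: measurable_sqnorm.
apply: (@le_trans _ _ (Pr (E N a `|` E Y b))).
  apply: le_measure; rewrite ?inE.
  - by apply: measurableC; apply: measurable_ratio_good; [exact: nN.1|exact: nY.1].
  - by apply: measurableU; apply: mE; [exact: nN.1|exact: nY.1].
  - move=> w; apply: contra_notP => /not_orP[] /negP; rewrite -ltNge ltr_norml => /andP[_ h1].
    move=> /negP; rewrite -ltNge ltr_norml => /andP[h2 _].
    have h3 : sqnorm (tnth (N w)) < (a + del) * n%:R by rewrite -ltr_pdivrMr//; lra.
    have h4 : (b - del) * n%:R < sqnorm (tnth (Y w)) by rewrite -ltr_pdivlMr//; lra.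
    have b0 : 0 < b by nra.
    have h5 : 0 < b - del by rewrite /del; nra.
    split; last by apply: lt_trans h4; exact: mulr_gt0.
    apply: le_trans (ltW h3) _; apply: (@le_trans _ _ (x * ((b - del) * n%:R))).
      by rewrite mulrA ler_wpM2r ?(ltW nR)// /del; nra.
    by rewrite ler_wpM2l ?(ltW x0)// ltW.
apply: le_trans (measureU2 _ _ _) _.
- by apply: mE; exact: nN.1.
- by apply: mE; exact: nY.1.
apply: le_trans (leeD (noise_dev n0 d0 nN) (noise_dev n0 d0 nY)) _.
rewrite -EFinD lee_fin /del le_eqVlt; apply/orP; left; apply/eqP; field.
by rewrite !gt_eqF//= subr_gt0.
Qed.

(** A one-sided form of W being nearly Gaussian of variance w: averaging over W amounts to the time
    w. All t >= t0 and all x0 are kept, so that further terms can be added by conditioning. *)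
Definition clt_ok (t0 : R) (W : T -> R) (w K : R) := measurable_fun setT W /\
  forall t x0, t0 <= t ->
  (\int[Pr]_o (heat t (x0 + W o))%:E <= (heat (t + w) x0 + K / Num.sqrt n%:R)%:E)%E.

(** On the event l <= W the argument of Phi is at least k, so the heat function divided by Phi k
    dominates the indicator of the event. *)
Lemma clt_ok_tail (t0 k w K l : R) (W : T -> R) : 0 < t0 -> 0 < Phi k ->
  clt_ok t0 W w K ->
  (Pr [set o | (l <= W o)%R] <=
     ((heat (t0 + w) (k * Num.sqrt t0 - l) + K / Num.sqrt n%:R) / Phi k)%:E)%E.
Proof.
move=> t00 Pk [mW hW].
have st0 : 0 < Num.sqrt t0 by rewrite sqrtr_gt0.
apply: le_trans (_ : _ <= ((Phi k)^-1)%:E *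
   \int[Pr]_o (heat t0 (k * Num.sqrt t0 - l + W o))%:E)%E _.
  apply: markov_EX => //.
  - by move=> o; exact: heat_ge0.
  - by apply: measurable_heat => //; exact: measurable_funD.
  - exact: measurable_set_le.
  - move=> o /= lW; apply: Phi_nondecreasing.
    by rewrite ler_pdivlMr//; lra.
rewrite [in leRHS]mulrC EFinM lee_wpmul2l ?lee_fin ?invr_ge0 ?(ltW Pk)//.
exact: hW.
Qed.

End sphere_rv.

(** * Adding the scalar product of a codeword with noise to a Gaussian limit *)

Section clt_step.
Context {R : realType}.

Let young (q u : R) : 0 < q -> 0 <= u -> u <= (q^-1 + q * u ^+ 2) / 2.
Proof.
move=> q0 u0; have : 0 <= (1 - q * u) ^+ 2 / (2 * q).
  by rewrite divr_ge0 ?sqr_ge0// mulr_ge0// ltW.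
rewrite (_ : (1 - q * u) ^+ 2 / (2 * q) = (q^-1 + q * u ^+ 2) / 2 - u); last first.
  by field; rewrite gt_eqF.
by rewrite subr_ge0.
Qed.

(* a is the normalized energy of the noise, e * a the conditional variance. *)
Let step_error (C e s2 q a C1 : R) : 0 <= C -> 0 <= e -> 0 <= s2 -> 1 <= q -> 0 <= C1 ->
  C1 * (e * `|a - s2|) + C * (e * a + (e * a) ^+ 2) / q <=
  (C1 * e + C * (e * (s2 + 1) + 2 * e ^+ 2 * s2 ^+ 2 + e + 2 * e ^+ 2))
     * (q^-1 + q * (a - s2) ^+ 2).
Proof.
move=> C0 e0 s20 q1 C10; have q0 : 0 < q by lra.
set D := (a - s2) ^+ 2; have D0 : 0 <= D by exact: sqr_ge0.
have qV : 0 <= q^-1 by rewrite invr_ge0 ltW.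
have h1 : `|a - s2| <= q^-1 + q * D.
  have := young q0 (normr_ge0 (a - s2)); rewrite real_normK ?num_real// -/D.
  have : 0 <= q * D by rewrite mulr_ge0// ltW.
  lra.
have h2 : q^-1 * D <= q * D.
  rewrite ler_wpM2r//; apply: (@le_trans _ _ 1) => //; by rewrite invf_le1.
have ha : a <= s2 + 1 + D.
  have : 0 <= (a - s2 - 1 / 2) ^+ 2 by exact: sqr_ge0.
  by rewrite /D; nra.
have ha2 : a ^+ 2 <= 2 * s2 ^+ 2 + 2 * D.
  have : 0 <= (a - 2 * s2) ^+ 2 by exact: sqr_ge0.
  by rewrite /D; nra.
set B := e * (s2 + 1) + 2 * e ^+ 2 * s2 ^+ 2 + e + 2 * e ^+ 2.
have e20 : 0 <= e ^+ 2 by exact: sqr_ge0.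
have h3 : e * a + (e * a) ^+ 2 <= B * (1 + D).
  have k1 := ler_wpM2l e0 ha; have k2 := ler_wpM2l e20 ha2.
  have k3 : 0 <= e * (s2 + 1) * D by do 2 apply: mulr_ge0 => //; lra.
  have k4 : 0 <= e ^+ 2 * s2 ^+ 2 * D := mulr_ge0 (mulr_ge0 e20 (sqr_ge0 s2)) D0.
  rewrite /B exprMn; nra.
have B0 : 0 <= B by rewrite /B !addr_ge0// !mulr_ge0// ?addr_ge0// sqr_ge0.
rewrite mulrDl; apply: lerD.
  rewrite mulrA -[leRHS]mulrA -[leLHS]mulrA; do 2 rewrite ler_wpM2l//.
rewrite -!mulrA ler_wpM2l//.
apply: (@le_trans _ _ (B * (1 + D) / q)); first by rewrite ler_wpM2r.
by rewrite -mulrA ler_wpM2l// mulrDl mul1r lerD2l mulrC.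
Qed.

(** Given W and N, [sphere_heat] replaces the scalar product by the time c^2 S |N|^2 / n. By
    [heat_time] this random time may be replaced by c^2 S s2 at a cost proportional to the deviation
    of |N|^2 / n, which is O (1 / sqrt n) in mean. The assumption on W then applies at the shifted
    time. X must be independent of the pair, since W may depend on N. *)
Lemma clt_step (t0 c S s2 K KN w : R) : 0 < t0 -> 0 < S -> 0 <= s2 -> 0 <= w ->
  0 <= K -> 0 <= KN ->
  exists2 K' : R, 0 <= K' &
  forall d (T : measurableType d) (Pr : probability T R) (n : nat)
    (X N : T -> n.-tuple R) (W : T -> R), (0 < n)%N ->
  sphere_rv Pr X (n%:R * S) -> noise_ok Pr N s2 KN ->
  clt_ok Pr (n := n) t0 W w K -> indep_maps Pr X (fun o => (W o, N o)) ->
  clt_ok Pr (n := n) t0 (fun o => W o + c / Num.sqrt n%:R * dotp (X o) (N o))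
    (w + c ^+ 2 * S * s2) K'.
Proof.
move=> t00 S0 s20 w0 K0 KN0.
have [C C0 hC] := sphere_heat t00; have [C1 C10 hC1] := heat_time t00.
pose e := c ^+ 2 * S.
have e0 : 0 <= e by rewrite mulr_ge0 ?sqr_ge0// ltW.
pose K0' := C1 * e + C * (e * (s2 + 1) + 2 * e ^+ 2 * s2 ^+ 2 + e + 2 * e ^+ 2).
have K0'0 : 0 <= K0'.
  have h1 : 0 <= e * (s2 + 1) by apply: mulr_ge0 => //; lra.
  have h2 : 0 <= 2 * e ^+ 2 * s2 ^+ 2 by apply: mulr_ge0; [apply: mulr_ge0 => //|]; exact: sqr_ge0.
  have h3 : 0 <= e ^+ 2 by exact: sqr_ge0.
  by rewrite /K0' addr_ge0// mulr_ge0//; lra.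
exists (K + K0' * (1 + KN)); first by rewrite addr_ge0// mulr_ge0// addr_ge0.
move=> d T Pr n X N W n0 sX [mN nN] [mW hW] iX; have mX := sX.1.
have nR : (0 : R) < n%:R by rewrite ltr0n.
set q := Num.sqrt n%:R : R.
have q0 : 0 < q by rewrite sqrtr_gt0.
have q1 : 1 <= q by rewrite -sqrtr1 ler_wsqrtr// ler1n.
have qq : q ^+ 2 = n%:R by rewrite sqr_sqrtr// ltW.
split.
  by apply: measurable_funD => //; apply: measurable_funM => //; exact: measurable_dotp.
move=> t x0 tt0.
pose dev (y : n.-tuple R) := (sqnorm (tnth y) / n%:R - s2) ^+ 2.
have mdev : measurable_fun setT dev by exact: measurable_noise_dev.
pose F (z : n.-tuple R * (R * n.-tuple R)) :=
  heat t (x0 + z.2.1 + c / q * dotp z.1 z.2.2).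
pose g (z : R * n.-tuple R) := heat (t + e * s2) (x0 + z.1) + K0' * (q^-1 + q * dev z.2).
have m1 : measurable_fun setT (fun z : n.-tuple R * (R * n.-tuple R) => z.2.1).
  exact: (measurableT_comp measurable_fst).
have m2 : measurable_fun setT (fun z : n.-tuple R * (R * n.-tuple R) => z.2.2).
  exact: (measurableT_comp measurable_snd).
have mdev2 : measurable_fun setT (fun z : R * n.-tuple R => dev z.2).
  exact: (measurableT_comp mdev).
have mdevN : measurable_fun setT (fun o => dev (N o)) by exact: (measurableT_comp mdev).
apply: (@le_trans _ _ (\int[Pr]_o (g (W o, N o))%:E)%E).
  under eq_integral do rewrite addrA.
  apply: (sphere_rv_le (F := F) (Y := fun o => (W o, N o)) (g := g) sX) => //.
  - exact: measurable_fun_pair.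
  - by move=> z; exact: heat_ge0.
  - apply: measurable_heat => //; apply: measurable_funD; first exact: measurable_funD.
    by apply: measurable_funM => //; exact: measurable_dotp.
  - apply: measurable_funD; first by apply: measurable_heat => //; exact: measurable_funD.
    by apply: measurable_funM => //; apply: measurable_funD => //; exact: measurable_funM.
  - move=> nu snu [x y]; rewrite /F /g /=.
    pose y' := scalet (c / q) y.
    under eq_integral do rewrite -dotp_scalet.
    apply: le_trans (hC n nu S n0 S0 snu t (x0 + x) y' tt0) _; rewrite lee_fin.
    set a := sqnorm (tnth y) / n%:R.
    have -> : sqnorm (tnth y') * S = e * a.
      by rewrite sqnorm_scalet expr_div_n qq /e /a; ring.
    have a0 : 0 <= a by rewrite divr_ge0 ?sqnorm_ge0// ltW.
    have ea : t0 <= t + e * a by apply: le_trans tt0 _; rewrite lerDl mulr_ge0.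
    have es : t0 <= t + e * s2 by apply: le_trans tt0 _; rewrite lerDl mulr_ge0.
    have := hC1 _ _ (x0 + x) ea es.
    have -> : t + e * a - (t + e * s2) = e * (a - s2) by ring.
    rewrite normrM (ger0_norm e0) => h1.
    have := @step_error C e s2 q a C1 C0 e0 s20 q1 C10.
    rewrite -/K0' -/q /dev -/a; move: h1 => /=.
    move: (heat _ _) (heat _ _) => A B h1 h2.
    by apply: le_trans (lerD h1 (lexx _)) _; rewrite -addrA lerD2l.
rewrite /g /= EX_D; last 4 first.
- by move=> o; exact: heat_ge0.
- by move=> o; rewrite mulr_ge0// addr_ge0 ?invr_ge0 ?(ltW q0)// mulr_ge0 ?(ltW q0)// sqr_ge0.
- by apply: measurable_heat => //; exact: measurable_funD.
- by apply: measurable_funM => //; apply: measurable_funD => //; exact: measurable_funM.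
have es : t0 <= t + e * s2 by apply: le_trans tt0 _; rewrite lerDl mulr_ge0.
have hW' := hW _ x0 es.
apply: le_trans (leeD2r _ hW') _.
rewrite EX_Zl//; last 2 first.
- by move=> o; rewrite addr_ge0 ?invr_ge0 ?(ltW q0)// mulr_ge0 ?(ltW q0)// sqr_ge0.
- by apply: measurable_funD => //; exact: measurable_funM.
rewrite EX_D; last 4 first.
- by move=> o; rewrite invr_ge0 ltW.
- by move=> o; rewrite mulr_ge0 ?(ltW q0)// sqr_ge0.
- by [].
- exact: measurable_funM.
rewrite EX_cst EX_Zl ?(ltW q0)//; last by move=> o; exact: sqr_ge0.
have H : (q^-1%:E + q%:E * \int[Pr]_x (dev (N x))%:E <= ((1 + KN) / q)%:E)%E.
  apply: le_trans (leeD2l _ (lee_wpmul2l _ nN)) _; first by rewrite lee_fin ltW.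
  rewrite -EFinM -EFinD lee_fin -qq le_eqVlt; apply/orP; left; apply/eqP; field.
  by rewrite gt_eqF.
apply: le_trans (leeD2l _ (lee_wpmul2l _ H)) _; first by rewrite lee_fin.
rewrite -EFinM -EFinD lee_fin.
have -> : t + e * s2 + w = t + (w + c ^+ 2 * S * s2) by rewrite /e; ring.
rewrite -addrA lerD2l le_eqVlt; apply/orP; left; apply/eqP.
by rewrite [RHS]mulrDl mulrA.
Qed.

End clt_step.

(** * Asymptotics of the confusion bounds *)

Section asymptotics.
Context {R : realType}.

Lemma sqrt_large (a : R) : exists N : nat, forall n, (N <= n)%N -> a <= Num.sqrt n%:R.
Proof.
exists (Num.truncn (a ^+ 2)).+1 => n Nn.
apply: le_trans (ler_norm a) _; rewrite -sqrtr_sqr ler_wsqrtr//.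
apply: (@le_trans _ _ (Num.truncn (a ^+ 2)).+1%:R); last by rewrite ler_nat.
by rewrite ltW// truncnS_gt.
Qed.

Lemma limn_esup_le (u : nat -> \bar R) (l : R) :
  (forall e, 0 < e -> exists N, forall n, (N <= n)%N -> (u n <= (l + e)%:E)%E) ->
  (limn_esup u <= l%:E)%E.
Proof.
move=> h; apply/lee_addgt0Pr => e e0; have [N hN] := h e e0.
rewrite limn_esup_lim -EFinD.
apply: lime_le; first exact: is_cvg_esups.
exists N => // n /= Nn; apply: ge_ereal_sup => _ [k /= nk <-].
by apply: hN; exact: leq_trans nk.
Qed.

(** With y = sqrt n the factor n^2 is y^4, while exp (d y) is at least (d y)^6 / 6!. *)
Lemma exp_sqrt_vanish (c d e : R) : 0 < d -> 0 < e -> exists N : nat,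
  forall n, (N <= n)%N -> n%:R ^+ 2 * expR (c - d * Num.sqrt n%:R) <= e.
Proof.
move=> d0 e0.
have [f f0 fE] : exists2 f : R, 0 < f & f = 6`!%:R by exists 6`!%:R; rewrite ?ltr0n ?fact_gt0.
pose K : R := f * expR c / d ^+ 6.
have K0 : 0 < K by rewrite divr_gt0 ?mulr_gt0 ?expR_gt0// exprn_gt0.
have [N hN] := sqrt_large (1 + K / e).
exists N => n /hN; have : (n%:R : R) = Num.sqrt n%:R ^+ 2 by rewrite sqr_sqrtr.
move: (Num.sqrt _) => y ->; move=> yK.
have Ke : 0 < K / e by rewrite divr_gt0.
have y1 : 1 <= y by lra.
have y0 : 0 < y by lra.
have dy : 0 <= d * y by rewrite mulr_ge0// ltW.
have := expR_ge1Dxn 5 dy; rewrite -fE => h.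
have h2 : (d * y) ^+ 6 / f <= expR (d * y) by lra.
have h3 : 0 < (d * y) ^+ 6 / f by rewrite divr_gt0// exprn_gt0// mulr_gt0.
rewrite expRB.
apply: (@le_trans _ _ ((y ^+ 2) ^+ 2 * (expR c / ((d * y) ^+ 6 / f)))).
  rewrite ler_wpM2l ?sqr_ge0// ler_wpM2l ?expR_ge0// lef_pV2// posrE//.
  exact: expR_gt0.
have -> : (y ^+ 2) ^+ 2 * (expR c / ((d * y) ^+ 6 / f)) = K / y ^+ 2.
  by rewrite /K; field; rewrite !gt_eqF.
rewrite ler_pdivrMr ?exprn_gt0//.
have : K = K / e * e by rewrite divfK// gt_eqF.
move: (K / e) Ke yK => k k0 yK ->.
rewrite mulrC ler_wpM2l ?(ltW e0)//; nra.
Qed.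

(** With x = exp (-2 C) the power n/2 of x cancels exp (n C), and that of 1 + 2 l / sqrt n is about
    exp (l sqrt n). What remains is n^2 exp (-(L - l) sqrt n) times a constant; [c0] bounds the
    bounded terms of the exponent. *)
Lemma cap_bound_vanish (x L l kap : R) : 0 < x < 1 -> l < L -> 0 <= kap ->
  forall e, 0 < e -> exists N : nat, forall n, (N <= n)%N ->
  0 < x * (1 + 2 * l / Num.sqrt n%:R) + kap / n%:R /\
  expR (n%:R * (- ln x / 2) - L * Num.sqrt n%:R) * n%:R ^+ 2
    * (x * (1 + 2 * l / Num.sqrt n%:R) + kap / n%:R) ^+ n./2 <= e.
Proof.
move=> /andP[x0 x1] lL kap0 e e0.
have lx : ln x < 0 by apply: ln_lt0; rewrite x0.
pose c0 := - ln x / 2 + `|l| + kap / x.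
have [N1 hN1] := @exp_sqrt_vanish c0 (L - l) e ltac:(lra) e0.
(* Beyond this size sqrt n is at least 1, the base q is positive, and the upper bound g of ln q is
   nonpositive. *)
pose big := 1 + 2 * `|l| + 1 + (2 * `|l| + kap / x) / (- ln x).
have [N2 hN2] := sqrt_large big.
exists (maxn N1 (maxn N2 1)) => n; rewrite !geq_max => /andP[n1 /andP[n2 n3]].
have := hN2 n n2; have := hN1 n n1.
have nR : (0 : R) < n%:R by rewrite ltr0n.
have n1R : (1 : R) <= n%:R by rewrite ler1n.
set y := Num.sqrt n%:R.
have yy : y ^+ 2 = n%:R by rewrite sqr_sqrtr// ltW.
have al : 0 <= `|l| by [].
have kx : 0 <= kap / x by rewrite divr_ge0// ltW.
have lx' : 0 < - ln x by lra.
have bx : 0 <= (2 * `|l| + kap / x) / (- ln x) by rewrite divr_ge0//; lra.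
move=> H1 H2.
have y1 : 1 <= y by rewrite /big in H2; lra.
have y0 : 0 < y by lra.
have lb : - `|l| <= l by rewrite lerNnormlW.
have lu : l <= `|l| by rewrite ler_norm.
have p1 : 0 < 1 + 2 * l / y.
  have : - 1 < 2 * l / y by rewrite ltr_pdivlMr//; rewrite /big in H2; lra.
  lra.
have kn : 0 <= kap / n%:R by rewrite divr_ge0// ltW.
set q := x * (1 + 2 * l / y) + kap / n%:R.
have q0 : 0 < q by rewrite /q ltr_pwDl// mulr_gt0.
split => //.
pose g := ln x + 2 * l / y + kap / (x * n%:R).
have lq : ln q <= g.
  have -> : q = x * (1 + (q / x - 1)) by field; rewrite gt_eqF.
  have qx : 0 < q / x by rewrite divr_gt0.
  rewrite lnM ?posrE//; last lra.
  rewrite /g -addrA lerD2l; apply: le_trans (le_ln1Dx _) _; first lra.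
  rewrite le_eqVlt; apply/orP; left; apply/eqP; rewrite /q; field.
  by rewrite !gt_eqF.
have g0 : g <= 0.
  have h1 : 2 * l / y <= 2 * `|l| / y by rewrite ler_wpM2r ?invr_ge0 ?(ltW y0)//; lra.
  have h2 : kap / (x * n%:R) <= kap / x / y.
    rewrite invfM mulrA ler_wpM2l// lef_pV2 ?posrE// -yy expr2; nra.
  have h3 : (2 * `|l| + kap / x) / y <= - ln x.
    rewrite ler_pdivrMr// -ler_pdivrMl// [_^-1 * _]mulrC.
    by rewrite /big in H2; lra.
  have h4 : (2 * `|l| + kap / x) / y = 2 * `|l| / y + kap / x / y by rewrite mulrDl.
  rewrite /g; lra.
(* Rounding n / 2 down loses at most 1/2; since g <= 0, the exponent may be lowered to (n - 1) /
   2. *)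
have m1 : (n%:R - 1) / 2 <= n./2%:R :> R.
  have := odd_double_half n => /(congr1 (fun k => k%:R : R)).
  rewrite natrD -mul2n natrM; case: (odd n) => /=; lra.
have qm : q ^+ n./2 <= expR ((n%:R - 1) / 2 * g).
  have -> : q ^+ n./2 = expR (n./2%:R * ln q) by rewrite expRM_natl lnK.
  rewrite ler_expR; apply: (@le_trans _ _ (n./2%:R * g)); first by rewrite ler_wpM2l.
  by rewrite ler_wnM2r.
apply: le_trans H1; rewrite [leLHS]mulrAC [leRHS]mulrC.
apply: ler_wpM2r; first exact: sqr_ge0.
apply: (@le_trans _ _ (expR (n%:R * (- ln x / 2) - L * y) * expR ((n%:R - 1) / 2 * g))).
  by rewrite ler_wpM2l ?expR_ge0.
rewrite -expRD ler_expR.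
have -> : (n%:R - 1) / 2 * g = n%:R * (ln x / 2) - ln x / 2 + l * y - l / y
    + kap / (2 * x) - kap / (2 * x * n%:R).
  by rewrite /g -yy; field; rewrite !gt_eqF.
have h1 : - (l / y) <= `|l|.
  rewrite -mulNr ler_pdivrMr//; apply: (@le_trans _ _ `|l|); first lra.
  by rewrite ler_peMr.
have h2 : 0 <= kap / (2 * x * n%:R) by rewrite divr_ge0// !mulr_ge0// ltW.
have h3 : kap / (2 * x) <= kap / x.
  by rewrite ler_wpM2l// lef_pV2 ?posrE ?mulr_gt0//; lra.
rewrite /c0; lra.
Qed.

(** The maximum with 1 keeps the codebook nonempty when the exponential is below 1. *)
Definition codebook_size (C L : R) (n : nat) : nat :=
  maxn 1 (Num.truncn (expR (n%:R * C - L * Num.sqrt n%:R))).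

Lemma codebook_size_gt0 C L n : (0 < codebook_size C L n)%N.
Proof. by rewrite /codebook_size leq_max. Qed.

Lemma rate_large (C L : R) : 0 < C -> exists N : nat, forall n, (N <= n)%N ->
  1 <= expR (n%:R * C - L * Num.sqrt n%:R).
Proof.
move=> C0; have [N hN] := sqrt_large (L / C).
exists N => n /hN; rewrite ler_pdivrMr// => h; rewrite -[leLHS]expR0 ler_expR.
have {1}-> : (n%:R : R) = Num.sqrt n%:R ^+ 2 by rewrite sqr_sqrtr.
have : 0 <= Num.sqrt (n%:R : R) by exact: sqrtr_ge0.
by move: (Num.sqrt _) h => y h y0; nra.
Qed.

Lemma codebook_size_le (C L : R) : 0 < C -> exists N : nat, forall n, (N <= n)%N ->
  (codebook_size C L n)%:R <= expR (n%:R * C - L * Num.sqrt n%:R).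
Proof.
move=> /(rate_large L)[N hN]; exists N => n /hN h.
rewrite /codebook_size; case: leqP => // _.
by rewrite truncn_le// expR_ge0.
Qed.

(** Rounding down a number that is at least 1 at most halves it, which costs ln 2 / sqrt n in the
    normalized rate. *)
Lemma codebook_rate (C L : R) : 0 < C ->
  (limn_esup (fun n : nat =>
     ((n%:R * C - ln (codebook_size C L n)%:R) / Num.sqrt n%:R)%:E) <= L%:E)%E.
Proof.
move=> C0; apply: limn_esup_le => e e0.
have [N1 hN1] := rate_large L C0; have [N2 hN2] := sqrt_large (1 + ln 2 / e).
exists (maxn N1 N2) => n; rewrite geq_max => /andP[/hN1 h1 /hN2].
set y := Num.sqrt n%:R => h2.
have l2 : 0 <= ln 2 / e :> R by rewrite divr_ge0 ?(ltW e0)// ln_ge0// ler1n.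
have y0 : 0 < y by lra.
rewrite lee_fin ler_pdivrMr//.
have M : expR (n%:R * C - L * y) / 2 <= (codebook_size C L n)%:R.
  rewrite /codebook_size.
  have := truncnS_gt (expR (n%:R * C - L * y)).
  move: h1; rewrite -/y; move: (expR _) => z z1; rewrite -natr1 => zt.
  case: leqP => [|]; last by rewrite ltnS leqn0 => /eqP t0; rewrite t0 in zt; lra.
  by rewrite -(ler_nat R) => ?; lra.
have M0 : 0 < expR (n%:R * C - L * y) / 2 by rewrite divr_gt0// expR_gt0.
have := M; rewrite -ler_ln ?posrE//; last exact: lt_le_trans M.
rewrite ln_div ?posrE ?expR_gt0// expRK => h3.
have : ln 2 <= e * y by rewrite mulrC -ler_pdivrMr//; lra.
lra.
Qed.

(** As eta and t0 = eta^2 tend to 0, the argument of Phi tends to -L / sqrt w, where Phi is at most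
    eps by the choice of L. The number k is fixed first, so that dividing by Phi k costs little. *)
Lemma normal_tail (w eps L e : R) : 0 < w -> 0 < eps < 1 -> 0 < e ->
  Num.sqrt w * Qinv eps <= L ->
  exists eta t0 k : R, [/\ 0 < eta, 0 < t0, 0 < Phi k &
    heat (t0 + w) (k * Num.sqrt t0 - (L - eta)) / Phi k <= eps + e].
Proof.
move=> w0 eps01 e0 QL; have /andP[eps0 eps1] := eps01.
have sw : 0 < Num.sqrt w by rewrite sqrtr_gt0.
pose z := - L / Num.sqrt w.
have Pz : Phi z <= eps.
  rewrite -[leRHS](Qinv_correct eps01) -[X in Qfun X]opprK -/(Phi _).
  by apply: Phi_nondecreasing; rewrite /z mulNr lerN2 ler_pdivlMr// mulrC.
have [r r0 hr] : exists2 r, 0 < r & Phi (z + r) <= eps + e / 4.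
  have /cvgrPdist_le/(_ (e / 4))[] := @continuous_Phi R z; first by rewrite divr_gt0.
  move=> r /= r0 h; exists (r / 2); first by rewrite divr_gt0.
  have := h (z + r / 2); rewrite /= => /(_ _)/wrap[|].
    by rewrite opprD addNKr normrN ger0_norm ?divr_ge0 ?(ltW r0)//; lra.
  by rewrite ler_norml => /andP[h1 _]; lra.
(* Chosen so that (eps + e) e1 <= e / 4, whence eps + e / 4 <= (eps + e) (1 - e1). *)
pose e1 := e / (4 * (1 + e)).
have e10 : 0 < e1 by rewrite divr_gt0// mulr_gt0//; lra.
have e11 : e1 * (1 + e) = e / 4 by rewrite /e1; field; lra.
have [k k0 hk] := @Phi_near1 R e1 e10.
have Pk : 0 < Phi k by nra.
(* A bound for the growth in eta of the argument of Phi: (1 + k) / sqrt w from the shift, |L| / w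
   from the change of variance. *)
pose B := (1 + k) / Num.sqrt w + `|L| / w.
have B0 : 0 < B by rewrite ltr_pwDl ?divr_ge0 ?(ltW w0)// divr_gt0//; lra.
pose eta := r / B.
have eta0 : 0 < eta by rewrite divr_gt0.
exists eta, (eta ^+ 2), k; split => //; first exact: exprn_gt0.
rewrite sqrtr_sqr ger0_norm ?(ltW eta0)//.
set s := Num.sqrt (eta ^+ 2 + w).
have e2w : 0 <= eta ^+ 2 + w by rewrite addr_ge0 ?sqr_ge0// ltW.
have s1 : Num.sqrt w <= s by rewrite ler_wsqrtr// lerDr sqr_ge0.
have s0 : 0 < s by lra.
have s2 : s <= Num.sqrt w + eta.
  rewrite -(@ler_pXn2r _ 2)// ?nnegrE ?(ltW s0) ?addr_ge0 ?(ltW sw) ?(ltW eta0)//.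
  rewrite sqr_sqrtr// sqrrD sqr_sqrtr ?(ltW w0)//.
  have : 0 <= Num.sqrt w * eta by rewrite mulr_ge0 ?ltW.
  lra.
have key : (k * eta - (L - eta)) / s <= z + r.
  have -> : r = B * eta by rewrite /eta mulrC divfK// gt_eqF.
  have -> : (k * eta - (L - eta)) / s = (1 + k) * eta / s - L / s by ring.
  have h1 : (1 + k) * eta / s <= (1 + k) * eta / Num.sqrt w.
    by rewrite ler_wpM2l ?lef_pV2 ?posrE// mulr_ge0 ?(ltW eta0)//; lra.
  have h2 : - (L / s) <= - L / Num.sqrt w + `|L| / w * eta.
    rewrite -lerBlDl.
    have -> : - (L / s) - - L / Num.sqrt w = L * ((s - Num.sqrt w) / (s * Num.sqrt w)).
      by field; rewrite !gt_eqF.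
    have h3 : 0 <= (s - Num.sqrt w) / (s * Num.sqrt w).
      by rewrite divr_ge0 ?subr_ge0// mulr_ge0// ltW.
    apply: (@le_trans _ _ (`|L| * ((s - Num.sqrt w) / (s * Num.sqrt w)))).
      by rewrite ler_wpM2r// ler_norm.
    rewrite -mulrA ler_wpM2l// mulrC ler_pM ?subr_ge0//; last by lra.
      by rewrite invr_ge0 mulr_ge0// ltW.
    have ww : Num.sqrt w * Num.sqrt w = w by rewrite -expr2 sqr_sqrtr// ltW.
    by rewrite lef_pV2 ?posrE ?mulr_gt0// -[leLHS]ww ler_wpM2r// ltW.
  rewrite /B /z; have : (1 + k) * eta / Num.sqrt w = (1 + k) / Num.sqrt w * eta by ring.
  by rewrite mulrDl; lra.
have hA : heat (eta ^+ 2 + w) (k * eta - (L - eta)) <= eps + e / 4.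
  by apply: le_trans hr; exact: Phi_nondecreasing.
rewrite ler_pdivrMr//; apply: le_trans hA _.
have : (eps + e) * (1 - e1) <= (eps + e) * Phi k by rewrite ler_wpM2l//; lra.
have : (eps + e) * e1 <= (1 + e) * e1 by rewrite ler_wpM2r ?(ltW e10)//; lra.
nra.
Qed.

End asymptotics.

(** * The broadcast channel *)

Section model.
Context {R : realType} d (T : measurableType d) (Pr : probability T R).
Context (n M1 M2 : nat) (alpha P : R) (mu : probability R R).
Variables (Z : 'I_n -> T -> R) (V : 'I_M1 -> T -> n.-tuple R) (U : 'I_M2 -> T -> n.-tuple R).
Hypothesis bc : bc_model Pr alpha P mu Z V U.

Let F (i : ('I_n + ('I_M1 + 'I_M2))%type) : set (set T) :=
  match i with
  | inl k => preim_events (Z k)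
  | inr (inl m) => preim_events (V m)
  | inr (inr m) => preim_events (U m)
  end.

Lemma model_mZ k : measurable_fun setT (Z k). Proof. by case: bc => + _; apply. Qed.
Lemma model_lawZ k A : measurable A -> Pr (Z k @^-1` A) = mu A.
Proof. by case: bc => _ [+ _]; apply. Qed.
Lemma model_mV m : measurable_fun setT (V m). Proof. by case: bc => _ [_ [+ _]]; apply. Qed.
Lemma model_mU m : measurable_fun setT (U m).
Proof. by case: bc => _ [_ [_ [+ _]]]; apply. Qed.

Lemma model_sphereV m : sphere_rv Pr (V m) (n%:R * (alpha * P)).
Proof.
rewrite mulrA; apply: uniform_sphere_rv; first exact: model_mV.
by case: bc => _ [_ [_ [_ [+ _]]]]; apply.
Qed.

Lemma model_sphereU m : sphere_rv Pr (U m) (n%:R * ((1 - alpha) * P)).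
Proof.
rewrite mulrA; apply: uniform_sphere_rv; first exact: model_mU.
by case: bc => _ [_ [_ [_ [_ [+ _]]]]]; apply.
Qed.

Let mi : mutually_independent Pr F.
Proof. by case: bc => _ [_ [_ [_ [_ [_ ]]]]]. Qed.

Let Fm i : F i `<=` measurable.
Proof.
case: i => [k|[m|m]] _ [A mA <-]; rewrite -[X in measurable X]setTI.
- exact: model_mZ.
- exact: model_mV.
- exact: model_mU.
Qed.

Let FT i : F i setT.
Proof. by case: i => [k|[m|m]]; exists setT => //; rewrite preimage_setT. Qed.

Let FI i : setI_closed (F i).
Proof.
by case: i => [k|[m|m]] _ _ [A mA <-] [B mB <-]; exists (A `&` B);
  rewrite ?preimage_setI//; exact: measurableI.
Qed.

Let sel (p1 : pred 'I_n) (p2 : pred 'I_M1) (p3 : pred 'I_M2) :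
    {set ('I_n + ('I_M1 + 'I_M2))%type} :=
  [set j | match j with inl i => p1 i | inr (inl m) => p2 m | inr (inr m) => p3 m end].

(** The same space with the sigma-algebra generated by the selected variables. Measurability on
    [Tsel] says that a map depends on these variables only, so [sel_indep] reduces independence to
    measurability. *)
Let Tsel p1 p2 p3 := g_sigma_algebraType (sigma_of F (sel p1 p2 p3)).

Let selZ (p1 : pred 'I_n) (p2 : pred 'I_M1) (p3 : pred 'I_M2) k : p1 k -> @measurable_fun _ _ (Tsel p1 p2 p3) _ setT (Z k).
Proof.
move=> pk _ B mB; rewrite setTI; apply: sub_sigma_algebra.
by exists (inl k); [rewrite /= inE|exists B].
Qed.

Let selV (p1 : pred 'I_n) (p2 : pred 'I_M1) (p3 : pred 'I_M2) k : p2 k -> @measurable_fun _ _ (Tsel p1 p2 p3) _ setT (V k).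
Proof.
move=> pk _ B mB; rewrite setTI; apply: sub_sigma_algebra.
by exists (inr (inl k)); [rewrite /= inE|exists B].
Qed.

Let selU (p1 : pred 'I_n) (p2 : pred 'I_M1) (p3 : pred 'I_M2) k : p3 k -> @measurable_fun _ _ (Tsel p1 p2 p3) _ setT (U k).
Proof.
move=> pk _ B mB; rewrite setTI; apply: sub_sigma_algebra.
by exists (inr (inr k)); [rewrite /= inE|exists B].
Qed.

Let sel_indep (p1 : pred 'I_n) (p2 : pred 'I_M1) (p3 : pred 'I_M2) k d1 (D1 : measurableType d1) d2 (D2 : measurableType d2)
    (X : T -> D1) (Y : T -> D2) :
  k \notin sel p1 p2 p3 -> preim_events X `<=` F k ->
  @measurable_fun _ _ (Tsel p1 p2 p3) _ setT Y -> indep_maps Pr X Y.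
Proof.
move=> kJ XF mY; apply: (indep_maps_sigma Fm FT FI mi kJ XF) => B mB.
by have := mY measurableT B mB; rewrite setTI.
Qed.

Lemma model_indep_partial (g : R -> R) (k : 'I_n) : measurable_fun setT g ->
  indep_maps Pr (Z k) (partial_sum Z g k).
Proof.
move=> mg; apply: (@sel_indep (fun i => (i < k)%N) pred0 pred0 (inl k)) => //.
  by rewrite inE ltnn.
have -> : partial_sum Z g k = fun w => \sum_(i < n) (if (i < k)%N then g (Z i w) else 0).
  by apply/funext => w; rewrite /partial_sum big_mkcond.
apply: measurable_sum => i; have [ik|//] := boolP (i < k)%N.
by apply: (measurableT_comp mg); exact: selZ.
Qed.

Definition noise_tuple w : n.-tuple R := [tuple Z i w | i < n].

Let sel_noise (p2 : pred 'I_M1) (p3 : pred 'I_M2) :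
  @measurable_fun _ _ (Tsel predT p2 p3) _ setT noise_tuple.
Proof.
apply/measurable_fun_tnthP => i.
rewrite (_ : _ \o _ = Z i); first exact: selZ.
by apply/funext => w /=; rewrite tnth_mktuple.
Qed.

Lemma measurable_noise_tuple : measurable_fun setT noise_tuple.
Proof.
apply/measurable_fun_tnthP => i.
rewrite (_ : _ \o _ = Z i); first exact: model_mZ.
by apply/funext => w /=; rewrite tnth_mktuple.
Qed.

Lemma model_indep_V w1 : indep_maps Pr (V w1) noise_tuple.
Proof.
by apply: (@sel_indep predT pred0 pred0 (inr (inl w1))) => //; rewrite inE.
Qed.

Lemma model_indep_U w1 w2 : indep_maps Pr (U w2) (fun w => (V w1 w, noise_tuple w)).
Proof.
apply: (@sel_indep predT (pred1 w1) pred0 (inr (inr w2))) => //; first by rewrite inE.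
by apply: measurable_fun_pair => //; apply: selV => /=.
Qed.

Lemma model_indep_U' w1 w2 w2' : w2' != w2 ->
  indep_maps Pr (U w2') (fun w => (V w1 w, U w2 w, noise_tuple w)).
Proof.
move=> neq; apply: (@sel_indep predT (pred1 w1) (pred1 w2) (inr (inr w2'))) => //.
  by rewrite inE.
apply: measurable_fun_pair => //; apply: measurable_fun_pair.
  by apply: selV => /=.
by apply: selU => /=.
Qed.

Lemma model_indep_V' w1 w2 w1' : w1' != w1 ->
  indep_maps Pr (V w1') (fun w => (V w1 w, U w2 w, noise_tuple w)).
Proof.
move=> neq; apply: (@sel_indep predT (pred1 w1) (pred1 w2) (inr (inl w1'))) => //.
  by rewrite inE.
apply: measurable_fun_pair => //; apply: measurable_fun_pair.
  by apply: selV => /=.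
by apply: selU => /=.
Qed.

Lemma model_indep_UV' w1 w2 w1' w2' : w2' != w2 ->
  indep_maps Pr (U w2') (fun w => (V w1 w, U w2 w, noise_tuple w, V w1' w)).
Proof.
move=> neq; apply: (@sel_indep predT (pred2 w1 w1') (pred1 w2) (inr (inr w2'))) => //.
  by rewrite inE.
apply: measurable_fun_pair; last by apply: selV => /=; rewrite eqxx orbT.
apply: measurable_fun_pair => //; apply: measurable_fun_pair.
  by apply: selV => /=; rewrite eqxx.
by apply: selU => /=.
Qed.

End model.

Lemma indep_comp {R : realType} d (T : measurableType d) (Pr : probability T R)
    d1 (D1 : measurableType d1) d2 (D2 : measurableType d2) d3 (D3 : measurableType d3)
    (X : T -> D1) (Y : T -> D2) (h : D2 -> D3) :
  measurable_fun setT h -> indep_maps Pr X Y -> indep_maps Pr X (fun w => h (Y w)).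
Proof.
move=> mh iXY A B mA mB; apply: (iXY A (h @^-1` B)) => //.
by rewrite -[X in measurable X]setTI; exact: mh.
Qed.

Section union_bounds.
Context {R : realType} d (T : measurableType d) (Pr : probability T R).

Lemma measure_bigsetU_le (I : Type) (s : seq I) (A : I -> set T) :
  (forall i, measurable (A i)) ->
  (Pr (\big[setU/set0]_(i <- s) A i) <= \sum_(i <- s) Pr (A i))%E.
Proof.
move=> mA; elim: s => [|i s IH]; first by rewrite !big_nil measure0.
rewrite !big_cons; apply: le_trans (measureU2 _ _ _) _ => //.
  by apply: bigsetU_measurable => j _.
exact: leeD2l.
Qed.

Lemma union_bound (I : finType) (G E : set T) (B : I -> set T) (c : R) :
  measurable G -> measurable E -> (forall i, measurable (B i)) ->
  (forall i, (Pr (B i) <= c%:E)%E) ->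
  E `<=` ~` G `|` \bigcup_i B i ->
  (Pr E <= Pr (~` G) + (#|I|%:R * c)%:E)%E.
Proof.
move=> mG mE mB Bc sub.
have mU : measurable (\big[setU/set0]_(i <- enum I) B i).
  by apply: bigsetU_measurable => j _.
apply: (@le_trans _ _ (Pr (~` G `|` \big[setU/set0]_(i <- enum I) B i))).
  apply: le_measure; rewrite ?inE//.
    by apply: measurableU => //; exact: measurableC.
  move=> w /sub[|[i _ Bi]]; [by left|right].
  by rewrite -bigcup_seq; exists i => //=; rewrite mem_enum.
apply: le_trans (measureU2 _ _ _) _ => //; first exact: measurableC.
apply: leeD2l; apply: le_trans (measure_bigsetU_le _ mB) _.
apply: (@le_trans _ _ (\sum_(i <- enum I) c%:E)%E); first exact: lee_sum.
by rewrite sumEFin big_const_seq count_predT -cardE iter_addr_0 mulr_natl.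
Qed.

End union_bounds.

(** * Confusion with wrong codewords *)

Section confusion.
Context {R : realType} d (T : measurableType d) (Pr : probability T R) (n : nat).
Hypothesis n2 : (1 < n)%N.
Implicit Types (N Y : T -> n.-tuple R).

(** The common form of the decoding errors: N is what remains of Y when the true codeword is
    removed, so |N|^2 is the squared distance to beat. *)
Definition confusion (I : eqType) N Y (X : I -> T -> n.-tuple R) (i0 : I) : set T :=
  [set w | exists i, i != i0 /\
     sqdist (tnth (Y w)) (tnth (X i w)) <= sqnorm (tnth (N w))].

Definition confusion2 (I J : eqType) N Y (V : I -> T -> n.-tuple R)
    (U : J -> T -> n.-tuple R) (i0 : I) (j0 : J) : set T :=
  [set w | exists i j, [/\ i != i0, j != j0 &
     sqdist (tnth (subt (Y w) (V i w))) (tnth (U j w)) <= sqnorm (tnth (N w))]].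

Lemma measurable_confusion (I : finType) N Y (X : I -> T -> n.-tuple R) i0 :
  measurable_fun setT N -> measurable_fun setT Y -> (forall i, measurable_fun setT (X i)) ->
  measurable (confusion N Y X i0).
Proof.
move=> mN mY mX.
rewrite (_ : confusion _ _ _ _ = \bigcup_(i in [set i | i != i0])
  [set w | sqdist (tnth (Y w)) (tnth (X i w)) <= sqnorm (tnth (N w))]); last first.
  apply/seteqP; split => w /= [i]; first by case=> h1 h2; exists i.
  by move=> h1 h2; exists i.
apply: fin_bigcup_measurable => [|i _]; first exact: finite_finset; apply: measurable_set_le.
  under eq_fun do rewrite sqdist_subt.
  by apply: measurable_sqnorm; exact: measurable_subt.
exact: measurable_sqnorm.
Qed.

Lemma measurable_confusion2 (I J : finType) N Y (V : I -> T -> n.-tuple R)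
    (U : J -> T -> n.-tuple R) i0 j0 :
  measurable_fun setT N -> measurable_fun setT Y ->
  (forall i, measurable_fun setT (V i)) -> (forall j, measurable_fun setT (U j)) ->
  measurable (confusion2 N Y V U i0 j0).
Proof.
move=> mN mY mV mU.
rewrite (_ : confusion2 _ _ _ _ _ _ = \bigcup_(i in [set i | i != i0])
  confusion N (fun w => subt (Y w) (V i w)) U j0); last first.
  apply/seteqP; split => w /= [i]; first by case=> j [h1 h2 h3]; exists i => //; exists j.
  by move=> h1 [j [h2 h3]]; exists i, j.
apply: fin_bigcup_measurable => [|i _]; first exact: finite_finset; apply: measurable_confusion => //.
exact: measurable_subt.
Qed.

Let s : R := 1 - n%:R^-1.
Let s01 : 0 <= s < 1.
Proof.
have n1 : 1 <= n%:R :> R by rewrite ler1n; lia.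
have n0 : 0 < n%:R :> R by rewrite ltr0n; lia.
by rewrite /s subr_ge0 invf_le1// n1/= ltrBlDl ltrDr invr_gt0.
Qed.

Let m0 : (0 < n./2)%N. Proof. lia. Qed.
Let mn : (n./2.*2 <= n)%N. Proof. lia. Qed.
Let onems : 1 - s = n%:R^-1. Proof. by rewrite /s; ring. Qed.

(** For one wrong codeword the method gives n and 1/n; n^2 and 3/n are the values of
    [confusion2_bound], so that one asymptotic estimate serves both. *)
Lemma confusion_bound (I : finType) N Y (X : I -> T -> n.-tuple R) i0 (x r2 : R) :
  0 < r2 -> 0 < x + 3 / n%:R -> measurable_fun setT N -> measurable_fun setT Y ->
  (forall i, sphere_rv Pr (X i) r2) -> (forall i, i != i0 -> indep_maps Pr (X i) Y) ->
  (Pr (confusion N Y X i0) <= Pr (~` ratio_good N Y x) +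
     (#|I|%:R * (n%:R ^+ 2 * (x + 3 / n%:R) ^+ n./2))%:E)%E.
Proof.
move=> r20 q0 mN mY sX iX; set q := x + 3 / n%:R.
have n1 : 1 <= n%:R :> R by rewrite ler1n; lia.
have n0 : 0 < n%:R :> R by rewrite ltr0n; lia.
have qm : 0 < q ^+ n./2 by rewrite exprn_gt0.
have mX i := (sX i).1.
have mB i : measurable [set w | 1 - s * corr2 (X i w) (Y w) <= q].
  apply: measurable_set_le => //; apply: measurable_funB => //.
  by apply: measurable_funM => //; exact: measurable_corr2.
apply: (@union_bound _ _ _ Pr I _ _
  (fun i => if i == i0 then set0 else [set w | 1 - s * corr2 (X i w) (Y w) <= q])).
- exact: measurable_ratio_good.
- exact: measurable_confusion.
- by move=> i; case: eqP.
- move=> i; case: eqP => [_|/eqP ii0].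
    by rewrite measure0 lee_fin mulr_ge0 ?exprn_ge0 ?(ltW n0)// ltW.
  apply: le_trans (sphere_cap r20 s01 q0 m0 mn (sX i) mY (iX i ii0)) _.
  rewrite lee_fin onems invrK -/q mulrC ler_wpM2r ?(ltW qm)//.
  by rewrite expr2 ler_peMl// ltW.
- move=> w [i [ii0 hi]]; have [[g1 g2]|ng] := pselect (ratio_good N Y x w); [right|by left].
  exists i => //; rewrite (negbTE ii0) /=.
  have := le_trans (corr2_sqdist (X i w) (Y w)) hi.
  have := corr2_le1 (X i w) (Y w); have := corr2_ge0 (X i w) (Y w).
  move: (corr2 _ _) => c c0 c1 h.
  have h1 : (1 - c) * sqnorm (tnth (Y w)) <= x * sqnorm (tnth (Y w)) by exact: le_trans g1.
  move: h1; rewrite ler_pM2r// /q /s => h1.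
  have : 0 < n%:R^-1 :> R by rewrite invr_gt0.
  by move: (n%:R^-1) => v v0; nra.
Qed.

Lemma confusion2_bound (I J : finType) N Y (V : I -> T -> n.-tuple R)
    (U : J -> T -> n.-tuple R) i0 j0 (x r2 r2' : R) :
  0 < r2 -> 0 < r2' -> 0 < x + 3 / n%:R ->
  measurable_fun setT N -> measurable_fun setT Y ->
  (forall i, sphere_rv Pr (V i) r2) -> (forall j, sphere_rv Pr (U j) r2') ->
  (forall i, i != i0 -> indep_maps Pr (V i) Y) ->
  (forall i j, i != i0 -> j != j0 -> indep_maps Pr (U j) (fun w => (Y w, V i w))) ->
  (Pr (confusion2 N Y V U i0 j0) <= Pr (~` ratio_good N Y x) +
     ((#|I| * #|J|)%:R * (n%:R ^+ 2 * (x + 3 / n%:R) ^+ n./2))%:E)%E.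
Proof.
move=> r20 r20' q0 mN mY sV sU iV iU; set q := x + 3 / n%:R.
have n1 : 1 <= n%:R :> R by rewrite ler1n; lia.
have n0 : 0 < n%:R :> R by rewrite ltr0n; lia.
have qm : 0 < q ^+ n./2 by rewrite exprn_gt0.
have mV i := (sV i).1; have mU j := (sU j).1.
pose B i j := [set w | (1 - s * corr2 (V i w) (Y w)) *
  (1 - s * corr2 (U j w) (subt (Y w) (V i w))) <= q].
have mB i j : measurable (B i j).
  apply: measurable_set_le => //; apply: measurable_funM; apply: measurable_funB => //;
    apply: measurable_funM => //; apply: measurable_corr2 => //.
  exact: measurable_subt.
rewrite -card_prod; apply: (@union_bound _ _ _ Pr (I * J)%type _ _
  (fun ij => if (ij.1 == i0) || (ij.2 == j0) then set0 else B ij.1 ij.2)).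
- exact: measurable_ratio_good.
- exact: measurable_confusion2.
- by move=> i; case: ifP.
- move=> [i j] /=; case: ifP => [_|/negbT].
    by rewrite measure0 lee_fin mulr_ge0 ?exprn_ge0 ?(ltW n0)// ltW.
  rewrite negb_or => /andP[ii0 jj0].
  apply: le_trans (sphere_cap2 r20 s01 q0 m0 mn r20' (sV i) (sU j) mY
    (iV i ii0) (iU i j ii0 jj0)) _.
  by rewrite lee_fin onems exprVn invrK mulrC.
- move=> w [i [j [ii0 jj0 hi]]].
  have [[g1 g2]|ng] := pselect (ratio_good N Y x w); [right|by left].
  exists (i, j) => //=; rewrite (negbTE ii0) (negbTE jj0) /= /B /=.
  have := le_trans (corr2_sqdist (U j w) (subt (Y w) (V i w))) hi.
  have := corr2_sqdist (V i w) (Y w); rewrite sqdist_subt.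
  have := corr2_le1 (V i w) (Y w); have := corr2_ge0 (V i w) (Y w).
  have := corr2_le1 (U j w) (subt (Y w) (V i w)).
  have := corr2_ge0 (U j w) (subt (Y w) (V i w)).
  move: (corr2 (U j w) _) (corr2 (V i w) _) => c c' c0 c1 c0' c1' h' h.
  (* Subtracting V leaves at least the fraction 1 - c' of |Y|^2, and subtracting U at least the
     fraction 1 - c of the rest. *)
  have h1 : (1 - c) * (1 - c') * sqnorm (tnth (Y w)) <= x * sqnorm (tnth (Y w)).
    apply: le_trans g1; apply: le_trans h; rewrite -mulrA.
    by apply: ler_wpM2l => //; rewrite subr_ge0.
  move: h1; rewrite ler_pM2r// /q /s => h1.
  have : 0 < n%:R^-1 :> R by rewrite invr_gt0.
  have : n%:R^-1 <= 1 :> R by rewrite invf_le1.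
  move: (n%:R^-1) => v v1 v0.
  (* Each of the three terms multiplied by v = 1/n is at most 1, whence 3/n. *)
  have -> : (1 - (1 - v) * c') * (1 - (1 - v) * c) =
    (1 - c) * (1 - c') + v * (c' * (1 - c) + c * (1 - c') + v * c * c') by ring.
  rewrite [3 * v]mulrC; apply: lerD => //; rewrite ler_pM2l//.
  have a1 : c' * (1 - c) <= 1 by nra.
  have a2 : c * (1 - c') <= 1 by nra.
  have a3 : v * c * c' <= 1.
    have vc0 : 0 <= v * c by rewrite mulr_ge0// ltW.
    have vc1 : v * c <= 1 by nra.
    by nra.
  lra.
Qed.

End confusion.

(** * The error events of both users as confusions *)

Section channel.
Context {R : realType} d (T : measurableType d) (Pr : probability T R).
Context (n M1 M2 : nat) (alpha P : R) (mu : probability R R).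
Variables (Z : 'I_n -> T -> R) (V : 'I_M1 -> T -> n.-tuple R) (U : 'I_M2 -> T -> n.-tuple R).
Variables (w1 : 'I_M1) (w2 : 'I_M2).

(** It is the noise when U is decoded first, and the output when V is decoded after the removal of
    U. *)
Definition interference w := addt (V w1 w) (noise_tuple Z w).
(** What remains of the output once V is removed; it governs a JNN error in U alone. *)
Definition strong_output w := addt (U w2 w) (noise_tuple Z w).
Definition output w := addt (U w2 w) (interference w).

Let out_sub w : sqdist (received Z V U w1 w2 w) (tnth (U w2 w)) = sqnorm (tnth (interference w)).
Proof.
by apply: eq_bigr => i _; rewrite /received !tnth_mktuple; ring.
Qed.

Let receivedE w : received Z V U w1 w2 w = tnth (output w).
Proof. by apply/funext => i; rewrite /received !tnth_mktuple; ring. Qed.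

Lemma err_weakE : err_weak Z V U w1 w2 = confusion interference output U w2.
Proof.
by apply/seteqP; split => w /= [i [ii h]]; exists i; split => //; move: h;
  rewrite out_sub receivedE.
Qed.

(** The second stage may be judged with the true U removed, since a wrong first decision is already
    counted. *)
Lemma err_SIC_E : err_strong_SIC Z V U w1 w2 =
  err_weak Z V U w1 w2 `|` confusion (noise_tuple Z) interference V w1.
Proof.
congr (_ `|` _); apply/seteqP; split => w /= [i [ii h]]; exists i; split => //; move: h;
  rewrite (_ : (fun i => _) = tnth (interference w));
  try by apply/funext => j; rewrite /received !tnth_mktuple; ring.
  rewrite (_ : sqdist _ (tnth (V w1 w)) = sqnorm (tnth (noise_tuple Z w)))//.
  by apply: eq_bigr => j _; rewrite !tnth_mktuple; ring.
rewrite (_ : sqdist _ (tnth (V w1 w)) = sqnorm (tnth (noise_tuple Z w)))//.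
by apply: eq_bigr => j _; rewrite !tnth_mktuple; ring.
Qed.

Let joint_dist i j w :
  sqdist (received Z V U w1 w2 w) (fun k => tnth (U j w) k + tnth (V i w) k) =
  sqdist (tnth (subt (output w) (V i w))) (tnth (U j w)).
Proof. by apply: eq_bigr => k _; rewrite /received !tnth_mktuple; ring. Qed.

Let joint_dist_U j w :
  sqdist (tnth (subt (output w) (V w1 w))) (tnth (U j w)) =
  sqdist (tnth (strong_output w)) (tnth (U j w)).
Proof. by apply: eq_bigr => k _; rewrite !tnth_mktuple; ring. Qed.

Let joint_dist_V i w :
  sqdist (tnth (subt (output w) (V i w))) (tnth (U w2 w)) =
  sqdist (tnth (interference w)) (tnth (V i w)).
Proof. by apply: eq_bigr => k _; rewrite !tnth_mktuple; ring. Qed.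

Let joint_dist_0 w :
  sqdist (tnth (strong_output w)) (tnth (U w2 w)) = sqnorm (tnth (noise_tuple Z w)).
Proof. by apply: eq_bigr => k _; rewrite !tnth_mktuple; ring. Qed.

(** The error is split by which indices are wrong: a correct codeword cancels from the distance and
    leaves a problem for the other one alone. *)
Lemma err_JNN_E : err_strong_JNN Z V U w1 w2 =
  confusion (noise_tuple Z) strong_output U w2 `|`
  confusion2 (noise_tuple Z) output V U w1 w2 `|`
  confusion (noise_tuple Z) interference V w1.
Proof.
apply/seteqP; split => w /=.
  move=> [i [j [ij]]]; rewrite !joint_dist joint_dist_U joint_dist_0 => h.
  have [ii0|ii0] := eqVneq i w1.
    left; left; exists j; split; first by case: ij => //; rewrite ii0 eqxx.
    by move: h; rewrite ii0 joint_dist_U.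
  have [jj0|jj0] := eqVneq j w2.
    by right; exists i; split => //; move: h; rewrite jj0 joint_dist_V.
  by left; right; exists i, j.
move=> [[[j [jj0 h]]|[i [j [ii0 jj0 h]]]]|[i [ii0 h]]].
- exists w1, j; split; first by right.
  by rewrite !joint_dist !joint_dist_U joint_dist_0.
- exists i, j; split; first by left.
  by rewrite !joint_dist !joint_dist_U joint_dist_0.
- exists i, w2; split; first by left.
  by rewrite !joint_dist !joint_dist_U joint_dist_V joint_dist_0.
Qed.

Hypotheses (n2 : (1 < n)%N) (P0 : 0 < P) (a01 : 0 < alpha < 1).
Hypothesis bc : bc_model Pr alpha P mu Z V U.

Let mV m : measurable_fun setT (V m). Proof. exact: (model_mV bc). Qed.
Let mU m : measurable_fun setT (U m). Proof. exact: (model_mU bc). Qed.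
Let mZ : measurable_fun setT (noise_tuple Z). Proof. exact: (measurable_noise_tuple bc). Qed.

Lemma measurable_interference : measurable_fun setT interference.
Proof. exact: measurable_addt. Qed.
Lemma measurable_strong_output : measurable_fun setT strong_output.
Proof. exact: measurable_addt. Qed.
Lemma measurable_output : measurable_fun setT output.
Proof. by apply: measurable_addt => //; exact: measurable_interference. Qed.

Let mI := measurable_interference.
Let mS := measurable_strong_output.
Let mO := measurable_output.

Let sumr (x : n.-tuple R * n.-tuple R * n.-tuple R) := addt x.1.2 (addt x.1.1 x.2).

Let m11 d1 d2 d3 (A : measurableType d1) (B : measurableType d2) (C : measurableType d3) :
  measurable_fun setT (fun x : A * B * C => x.1.1).
Proof. exact: (measurableT_comp measurable_fst measurable_fst). Qed.

Let m12 d1 d2 d3 (A : measurableType d1) (B : measurableType d2) (C : measurableType d3) :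
  measurable_fun setT (fun x : A * B * C => x.1.2).
Proof. exact: (measurableT_comp measurable_snd measurable_fst). Qed.

Let measurable_sumr : measurable_fun setT sumr.
Proof.
apply: measurable_addt; first exact: m12.
by apply: measurable_addt; [exact: m11|exact: measurable_snd].
Qed.

Let nV : 0 < n%:R * (alpha * P).
Proof. by case/andP: a01 => a0 _; rewrite !mulr_gt0// ltr0n; lia. Qed.
Let nU : 0 < n%:R * ((1 - alpha) * P).
Proof. by case/andP: a01 => _ a1; rewrite !mulr_gt0// ?subr_gt0// ltr0n; lia. Qed.

Let tail x : R := n%:R ^+ 2 * (x + 3 / n%:R) ^+ n./2.

Lemma indep_interference_V : indep_maps Pr (V w1) (noise_tuple Z).
Proof. exact: (model_indep_V bc). Qed.

Lemma indep_U_interference : indep_maps Pr (U w2) interference.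
Proof.
apply: (indep_comp (h := fun x => addt x.1 x.2) _ (model_indep_U bc w1 w2)).
by apply: measurable_addt; [exact: measurable_fst|exact: measurable_snd].
Qed.

Lemma indep_U_noise : indep_maps Pr (U w2) (noise_tuple Z).
Proof.
apply: (indep_comp (h := snd) _ (model_indep_U bc w1 w2)); exact: measurable_snd.
Qed.

Lemma err_weak_bound x : 0 < x + 3 / n%:R ->
  measurable (err_weak Z V U w1 w2) /\
  (Pr (err_weak Z V U w1 w2) <= Pr (~` ratio_good interference output x) +
    (M2%:R * tail x)%:E)%E.
Proof.
move=> q0; rewrite err_weakE; split; first exact: measurable_confusion.
rewrite -[X in X%:R * _]card_ord; apply: (confusion_bound n2 nU q0 mI mO).
  by move=> m; exact: (model_sphereU bc).
move=> m mw; exact: (indep_comp measurable_sumr (model_indep_U' bc w1 mw)).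
Qed.

Lemma confusion_V_bound x : 0 < x + 3 / n%:R ->
  measurable (confusion (noise_tuple Z) interference V w1) /\
  (Pr (confusion (noise_tuple Z) interference V w1) <=
    Pr (~` ratio_good (noise_tuple Z) interference x) + (M1%:R * tail x)%:E)%E.
Proof.
move=> q0; split; first exact: measurable_confusion.
rewrite -[X in X%:R * _]card_ord; apply: (confusion_bound n2 nV q0 mZ mI).
  by move=> m; exact: (model_sphereV bc).
move=> m mw.
apply: (indep_comp (h := fun x => addt x.1.1 x.2) _ (model_indep_V' bc w2 mw)).
by apply: measurable_addt; [exact: m11|exact: measurable_snd].
Qed.

Lemma confusion_U_bound x : 0 < x + 3 / n%:R ->
  measurable (confusion (noise_tuple Z) strong_output U w2) /\
  (Pr (confusion (noise_tuple Z) strong_output U w2) <=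
    Pr (~` ratio_good (noise_tuple Z) strong_output x) + (M2%:R * tail x)%:E)%E.
Proof.
move=> q0; split; first exact: measurable_confusion.
rewrite -[X in X%:R * _]card_ord; apply: (confusion_bound n2 nU q0 mZ mS).
  by move=> m; exact: (model_sphereU bc).
move=> m mw.
apply: (indep_comp (h := fun x => addt x.1.2 x.2) _ (model_indep_U' bc w1 mw)).
by apply: measurable_addt; [exact: m12|exact: measurable_snd].
Qed.

Lemma confusion2_joint_bound x : 0 < x + 3 / n%:R ->
  measurable (confusion2 (noise_tuple Z) output V U w1 w2) /\
  (Pr (confusion2 (noise_tuple Z) output V U w1 w2) <=
    Pr (~` ratio_good (noise_tuple Z) output x) + ((M1 * M2)%:R * tail x)%:E)%E.
Proof.
move=> q0; split; first exact: measurable_confusion2.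
rewrite -[X in (X * _)%:R]card_ord -[X in (_ * X)%:R]card_ord.
apply: (confusion2_bound n2 nV nU q0 mZ mO).
- by move=> m; exact: (model_sphereV bc).
- by move=> m; exact: (model_sphereU bc).
- move=> m mw; exact: (indep_comp measurable_sumr (model_indep_V' bc w2 mw)).
- move=> i j ii0 jj0.
  apply: (indep_comp (h := fun x => (sumr x.1, x.2)) _ (model_indep_UV' bc w1 i jj0)).
  apply: measurable_fun_pair; last exact: measurable_snd.
  exact: (measurableT_comp measurable_sumr measurable_fst).
Qed.

End channel.

(** * Energy and Gaussian limits of noise, interference and output *)

Section noise_norms.
Context {R : realType} (mu : probability R R) (s2 z4 m6 : R).
Hypothesis mu2 : (\int[mu]_x (x ^+ 2)%:E = s2%:E)%E.
Hypothesis mu4 : (\int[mu]_x (x ^+ 4)%:E = z4%:E)%E.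
Hypothesis mu6 : (\int[mu]_x (x ^+ 6)%:E = m6%:E)%E.
Variables (alpha P : R).
Hypotheses (a01 : 0 < alpha < 1) (P0 : 0 < P).

Let v := z4 - s2 ^+ 2.
Let v0 : 0 <= v. Proof. exact: (square_variance_ge0 mu2 mu4 mu6). Qed.
Let s20 : 0 <= s2. Proof. exact: (s2_ge0 mu2). Qed.
Let S1 := alpha * P.
Let S2 := (1 - alpha) * P.
Let S10 : 0 < S1. Proof. by case/andP: a01 => a0 _; rewrite mulr_gt0. Qed.
Let S20 : 0 < S2. Proof. by case/andP: a01 => _ a1; rewrite mulr_gt0// subr_gt0. Qed.

Definition noise_bound (S s K : R) : R := 2 * K + 8 * S * (s + 1 + K).

Let noise_bound_ge0 S s K : 0 < S -> 0 <= s -> 0 <= K -> 0 <= noise_bound S s K.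
Proof. by move=> ? ? ?; rewrite /noise_bound; nra. Qed.

Lemma squares_noise_tuple d (T : measurableType d) n (Z : 'I_n -> T -> R) w :
  sqnorm (tnth (noise_tuple Z w)) - n%:R * s2 = \sum_(i < n) (Z i w ^+ 2 - s2).
Proof.
rewrite big_split /= sumr_const card_ord mulrC; congr (_ + _).
  by apply: eq_bigr => i _; rewrite tnth_mktuple.
by rewrite mulNrn mulr_natr.
Qed.

Section model_noise.
Context d (T : measurableType d) (Pr : probability T R) (n M1 M2 : nat).
Variables (Z : 'I_n -> T -> R) (V : 'I_M1 -> T -> n.-tuple R) (U : 'I_M2 -> T -> n.-tuple R).
Variables (w1 : 'I_M1) (w2 : 'I_M2).
Hypotheses (n0 : (0 < n)%N) (bc : bc_model Pr alpha P mu Z V U).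

Let mg : measurable_fun setT (fun z : R => z ^+ 2 - s2).
Proof. by apply: measurable_funB => //; exact: measurable_funX. Qed.

Lemma noise_ok_noise : noise_ok Pr (noise_tuple Z) s2 v.
Proof.
have nR : (0 : R) < n%:R by rewrite ltr0n.
split; first exact: (measurable_noise_tuple bc).
have h := iid_second_moment mu2 mu4 mu6 (model_mZ bc) (model_lawZ bc)
  (fun k => model_indep_partial bc k mg).
under eq_integral => w _.
  rewrite (_ : _ ^+ 2 = (n%:R ^- 2) * (\sum_(i < n) (Z i w ^+ 2 - s2)) ^+ 2); last first.
    rewrite -squares_noise_tuple -exprVn -exprMn; congr (_ ^+ 2).
    by field; rewrite gt_eqF.
  over.
rewrite EX_Zl ?invr_ge0 ?exprn_ge0 ?(ltW nR)//; first last.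
- apply: measurable_funX; apply: measurable_sum => i.
  exact: (measurableT_comp mg (model_mZ bc i)).
- by move=> w; exact: sqr_ge0.
apply: le_trans (lee_wpmul2l _ h) _; first by rewrite lee_fin invr_ge0 exprn_ge0// ltW.
rewrite -EFinM lee_fin le_eqVlt; apply/orP; left; apply/eqP; rewrite /v.
by field; rewrite gt_eqF.
Qed.

Lemma noise_ok_interference :
  noise_ok Pr (interference Z V w1) (S1 + s2) (noise_bound S1 s2 v).
Proof.
exact: noise_add n0 S10 s20 v0 (model_sphereV bc w1) noise_ok_noise
  (indep_interference_V w1 bc).
Qed.

Lemma noise_ok_strong_output :
  noise_ok Pr (strong_output Z U w2) (S2 + s2) (noise_bound S2 s2 v).
Proof.
exact: noise_add n0 S20 s20 v0 (model_sphereU bc w2) noise_ok_noise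
  (indep_U_noise w1 w2 bc).
Qed.

Lemma noise_ok_output :
  noise_ok Pr (output Z V U w1 w2) (S2 + (S1 + s2))
    (noise_bound S2 (S1 + s2) (noise_bound S1 s2 v)).
Proof.
apply: noise_add n0 S20 _ _ (model_sphereU bc w2) noise_ok_interference
  (indep_U_interference w1 w2 bc).
- by rewrite addr_ge0// ltW.
- exact: noise_bound_ge0.
Qed.

End model_noise.

(** The weights are left free and fixed later to reproduce [noise_excess] for X = V. The two terms
    are dependent, but the second is nearly Gaussian given the noise, with a variance close to
    constant. *)
Definition strong_stat d (T : measurableType d) n M1 (Z : 'I_n -> T -> R)
    (V : 'I_M1 -> T -> n.-tuple R) w1 (c1 c2 : R) (o : T) : R :=
  c1 / Num.sqrt n%:R * (sqnorm (tnth (noise_tuple Z o)) - n%:R * s2)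
  + c2 / Num.sqrt n%:R * dotp (V w1 o) (noise_tuple Z o).

Lemma clt_strong_stat (t0 c1 c2 : R) : 0 < t0 -> exists2 K, 0 <= K &
  forall d (T : measurableType d) (Pr : probability T R) (n M1 M2 : nat)
    (Z : 'I_n -> T -> R) (V : 'I_M1 -> T -> n.-tuple R) (U : 'I_M2 -> T -> n.-tuple R) w1,
  (0 < n)%N -> bc_model Pr alpha P mu Z V U ->
  clt_ok Pr (n := n) t0 (strong_stat Z V w1 c1 c2) (c1 ^+ 2 * v + c2 ^+ 2 * S1 * s2) K.
Proof.
move=> t00; have [K K0 hK] := iid_heat mu2 mu4 mu6 c1 t00.
have w0 : 0 <= c1 ^+ 2 * v by rewrite mulr_ge0// sqr_ge0.
have [K' K'0 hK'] := clt_step c2 t00 S10 s20 w0 K0 v0.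
exists K' => // d T Pr n M1 M2 Z V U w1 n0 bc.
have mg : measurable_fun setT (fun z : R => z ^+ 2 - s2).
  by apply: measurable_funB => //; exact: measurable_funX.
have mF : measurable_fun setT
    (fun x : n.-tuple R => c1 / Num.sqrt n%:R * (sqnorm (tnth x) - n%:R * s2)).
  by apply: measurable_funM => //; apply: measurable_funB => //; exact: measurable_sqnorm.
apply: (hK' _ _ Pr n (V w1) (noise_tuple Z)) => //.
- exact: (model_sphereV bc).
- exact: (noise_ok_noise n0 bc).
- split; first exact: (measurableT_comp mF (measurable_noise_tuple bc)).
  move=> t x0 tt; under eq_integral do rewrite squares_noise_tuple.
  apply: hK => //; [exact: (model_mZ bc)|exact: (model_lawZ bc)|].
  by move=> k; exact: (model_indep_partial bc k mg).
- apply: (indep_comp (h := fun x => (c1 / Num.sqrt n%:R * (sqnorm (tnth x) - n%:R * s2), x))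
    _ (model_indep_V bc w1)).
  exact: measurable_fun_pair.
Qed.

Definition weak_stat d (T : measurableType d) n M1 M2 (Z : 'I_n -> T -> R)
    (V : 'I_M1 -> T -> n.-tuple R) (U : 'I_M2 -> T -> n.-tuple R) w1 w2
    (c1 c2 c3 : R) (o : T) : R :=
  strong_stat Z V w1 c1 c2 o
  + c3 / Num.sqrt n%:R * dotp (U w2 o) (interference Z V w1 o).

(** One more application of [clt_step], with the interference as noise: U adds the variance c3^2 S2
    (S1 + s2). *)
Lemma clt_weak_stat (t0 c1 c2 c3 : R) : 0 < t0 -> exists2 K, 0 <= K &
  forall d (T : measurableType d) (Pr : probability T R) (n M1 M2 : nat)
    (Z : 'I_n -> T -> R) (V : 'I_M1 -> T -> n.-tuple R) (U : 'I_M2 -> T -> n.-tuple R) w1 w2,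
  (0 < n)%N -> bc_model Pr alpha P mu Z V U ->
  clt_ok Pr (n := n) t0 (weak_stat Z V U w1 w2 c1 c2 c3)
    (c1 ^+ 2 * v + c2 ^+ 2 * S1 * s2 + c3 ^+ 2 * S2 * (S1 + s2)) K.
Proof.
move=> t00; have [K K0 hK] := clt_strong_stat c1 c2 t00.
have w0 : 0 <= c1 ^+ 2 * v + c2 ^+ 2 * S1 * s2.
  by apply: addr_ge0; [exact: mulr_ge0 (sqr_ge0 c1) v0|
    exact: mulr_ge0 (mulr_ge0 (sqr_ge0 c2) (ltW S10)) s20].
have Is0 : 0 <= S1 + s2 by rewrite addr_ge0// ltW.
have [K' K'0 hK'] := clt_step c3 t00 S20 Is0 w0 K0 (noise_bound_ge0 S10 s20 v0).
exists K' => // d T Pr n M1 M2 Z V U w1 w2 n0 bc.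
apply: (hK' _ _ Pr n (U w2) (interference Z V w1)) => //.
- exact: (model_sphereU bc).
- exact: (noise_ok_interference w1 n0 bc).
- exact: (hK _ _ _ _ _ _ _ _ _ _ n0 bc).
- apply: (indep_comp (h := fun x => (c1 / Num.sqrt n%:R * (sqnorm (tnth x.2) - n%:R * s2)
    + c2 / Num.sqrt n%:R * dotp x.1 x.2, addt x.1 x.2)) _ (model_indep_U bc w1 w2)).
  apply: measurable_fun_pair; last first.
    by apply: measurable_addt; [exact: measurable_fst|exact: measurable_snd].
  apply: measurable_funD; apply: measurable_funM => //.
    by apply: measurable_funB => //; apply: measurable_sqnorm; exact: measurable_snd.
  by apply: measurable_dotp; [exact: measurable_fst|exact: measurable_snd].
Qed.

End noise_norms.

(** * Thresholds below capacity and at capacity *)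

Section asymptotics.
Context {R : realType}.

Lemma ratio_good_mono d (T : measurableType d) n (N Y : T -> n.-tuple R) x y : x <= y ->
  ratio_good N Y x `<=` ratio_good N Y y.
Proof.
move=> xy w [h1 h2]; split => //; apply: le_trans h1 _.
by rewrite ler_pM2r.
Qed.

Lemma div_sqrt_small (c e : R) : 0 < e ->
  exists N : nat, forall n, (N <= n)%N -> c / Num.sqrt n%:R <= e.
Proof.
move=> e0; have [N hN] := sqrt_large (1 + `|c| / e).
exists N => n /hN h.
have q0 : 0 < Num.sqrt n%:R :> R.
  by apply: lt_le_trans h; rewrite ltr_pwDl// divr_ge0// ltW.
rewrite ler_pdivrMr//.
have : `|c| / e <= Num.sqrt n%:R by lra.
by rewrite ler_pdivrMr// mulrC; apply: le_trans; exact: ler_norm.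
Qed.

Lemma div_nat_small (c e : R) : 0 < e ->
  exists N : nat, forall n, (N <= n)%N -> c / n%:R <= e.
Proof.
move=> e0; have [N hN] := div_sqrt_small `|c| e0.
exists (maxn N 1) => n; rewrite geq_max => /andP[/hN h n0].
have n1 : 1 <= n%:R :> R by rewrite ler1n.
apply: le_trans h; apply: (@le_trans _ _ (`|c| / n%:R)).
  by rewrite ler_wpM2r ?ler_norm// invr_ge0.
rewrite ler_wpM2l// lef_pV2 ?posrE ?sqrtr_gt0; try lra.
have -> : n%:R = Num.sqrt n%:R ^+ 2 :> R by rewrite sqr_sqrtr.
have : 1 <= Num.sqrt n%:R :> R by rewrite -[leLHS]sqrtr1 ler_wsqrtr.
rewrite sqrtr_sqr ger0_norm ?sqrtr_ge0//.
by move: (Num.sqrt _) => y y1; nra.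
Qed.

(** The union bound of [confusion_bound] for exp (n C - L sqrt n) codewords. *)
Definition cap_tail (C L x : R) n :=
  expR (n%:R * C - L * Num.sqrt n%:R) * (n%:R ^+ 2 * (x + 3 / n%:R) ^+ n./2).

(** The limit ratio a / b lies below exp (-2 C), so a constant x1 fits in between. The threshold has
    the form of [cap_bound_vanish] with l = L - 1, and it exceeds x1 for large n; L is therefore
    arbitrary. *)
Lemma first_order (a b C L K K' e : R) : 0 <= a -> a < expR (- 2 * C) * b -> 0 < C -> 0 < e ->
  exists N, forall n, (N <= n)%N -> exists x, [/\ 0 < x + 3 / n%:R,
    cap_tail C L x n <= e &
    forall d (T : measurableType d) (Pr : probability T R) (N Y : T -> n.-tuple R),
      noise_ok Pr N a K -> noise_ok Pr Y b K' -> (Pr (~` ratio_good N Y x) <= e%:E)%E].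
Proof.
move=> a0 ab C0 e0; set x0 := expR (- 2 * C) in ab *.
have x00 : 0 < x0 by exact: expR_gt0.
have x01 : x0 < 1 by rewrite /x0 -[ltRHS]expR0 ltr_expR; lra.
have b0 : 0 < b by rewrite -(pmulr_rgt0 _ x00); exact: le_lt_trans ab.
pose x1 := (a / b + x0) / 2.
have ab1 : a / b < x0 by rewrite ltr_pdivrMr.
have ab0 : 0 <= a / b by rewrite divr_ge0// ltW.
have x1b : a < x1 * b.
  by rewrite -ltr_pdivrMr// /x1; lra.
have lx : - ln x0 / 2 = C by rewrite /x0 expRK; lra.
have [N0 h0] := cap_bound_vanish (L := L) (l := L - 1) (kap := 3)
  (introT andP (conj x00 x01)) ltac:(lra) ltac:(lra) e0.
have d0 : 0 < (x0 - x1) / x0 by rewrite divr_gt0// /x1; lra.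
have [N1 h1] := div_sqrt_small (- (2 * (L - 1))) d0.
have [N2 h2] := div_nat_small ((K + K') * 16 / (x1 * b - a) ^+ 2) e0.
exists (maxn 1 (maxn N0 (maxn N1 N2))) => n; rewrite !geq_max.
move=> /andP[n0 /andP[/h0 [g0 g0'] /andP[/h1 g1 /h2 g2]]].
exists (x0 * (1 + 2 * (L - 1) / Num.sqrt n%:R)); split => //.
  by move: g0'; rewrite lx /cap_tail -mulrA.
move=> d T Pr N Y nN nY.
have x1x : x1 <= x0 * (1 + 2 * (L - 1) / Num.sqrt n%:R).
  move: g1; rewrite ler_pdivlMr// => g1; rewrite -subr_ge0.
  have -> : x0 * (1 + 2 * (L - 1) / Num.sqrt n%:R) - x1 =
    x0 - x1 - - (2 * (L - 1)) / Num.sqrt n%:R * x0 by ring.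
  by rewrite subr_ge0.
have mN := nN.1; have mY := nY.1.
apply: (@le_trans _ _ (Pr (~` ratio_good N Y x1))).
  apply: le_measure; rewrite ?inE; try by apply: measurableC; exact: measurable_ratio_good.
  by apply: subsetC; exact: ratio_good_mono.
apply: le_trans (ratio_ok n0 a0 _ x1b nN nY) _; last by rewrite lee_fin.
by rewrite /x1; apply/andP; split; lra.
Qed.

(** For nonzero Y = X + N, the ratio |N|^2 / |Y|^2 exceeds s2/(S + s2) (1 + 2 l / sqrt n) exactly
    when this quantity exceeds l |Y|^2 / (n (S + s2)), which is close to l. On this scale the limit
    variance is the dispersion. *)
Definition noise_excess n (S s2 : R) (X N : n.-tuple R) : R :=
  Num.sqrt n%:R * ((S + s2) * (sqnorm (tnth N) / n%:R)
    - s2 * (sqnorm (tnth (addt X N)) / n%:R)) / (2 * s2 * (S + s2)).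

(** Half of the slack eta compensates the deviation of |Y|^2 / n from S + s2; the other half keeps l
    = L - eta / 2 below L. *)
Lemma ratio_good_excess n (S s2 L eta : R) (X N : n.-tuple R) :
  (0 < n)%N -> 0 < S -> 0 < s2 -> noise_excess S s2 X N < L - eta ->
  `|L - eta / 2| * `|sqnorm (tnth (addt X N)) / n%:R - (S + s2)| <= eta / 2 * (S + s2) ->
  sqnorm (tnth N) <= s2 / (S + s2) * (1 + 2 * (L - eta / 2) / Num.sqrt n%:R)
    * sqnorm (tnth (addt X N)).
Proof.
move=> n0 S0 s20; rewrite /noise_excess.
have nR : (0 : R) < n%:R by rewrite ltr0n.
set A := sqnorm (tnth N) / n%:R; set Y := sqnorm (tnth (addt X N)) / n%:R.
have -> : sqnorm (tnth N) = n%:R * A by rewrite /A; field; rewrite gt_eqF.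
have -> : sqnorm (tnth (addt X N)) = n%:R * Y by rewrite /Y; field; rewrite gt_eqF.
have q0 : 0 < Num.sqrt n%:R :> R by rewrite sqrtr_gt0.
move: A Y => A Y; set q := Num.sqrt _ in q0 *; set l := L - eta / 2.
have D0 : 0 < S + s2 by lra.
rewrite ltr_pdivrMr ?mulr_gt0// => hT hY.
have lY : (S + s2) * (L - eta) <= l * Y.
  have : - (`|l| * `|Y - (S + s2)|) <= l * (Y - (S + s2)).
    by rewrite -normrM lerNl -normrN; exact: ler_norm.
  have -> : l * (Y - (S + s2)) = l * Y - l * (S + s2) by ring.
  have : l * (S + s2) = (S + s2) * (L - eta) + eta / 2 * (S + s2) by rewrite /l; field.
  lra.
rewrite mulrCA ler_pM2l//.
have -> : s2 / (S + s2) * (1 + 2 * l / q) * Y = (s2 * Y * q + 2 * s2 * (l * Y)) / (q * (S + s2)).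
  by field; rewrite !gt_eqF.
rewrite ler_pdivlMr ?mulr_gt0//.
have h2 : 2 * s2 * ((S + s2) * (L - eta)) <= 2 * s2 * (l * Y).
  by apply: ler_wpM2l => //; lra.
have := ltW hT; lra.
Qed.

(* [C Pr X N W] links a channel with input X and noise N to a statistic W that agrees
   almost surely with the noise excess and has a Gaussian limit. *)
Lemma second_order (S s2 w eps L K e : R)
  (C : forall d (T : measurableType d), probability T R -> forall n,
    (T -> n.-tuple R) -> (T -> n.-tuple R) -> (T -> R) -> Prop) :
  0 < S -> 0 < s2 -> 0 < w -> 0 < eps < 1 -> 0 < e -> Num.sqrt w * Qinv eps <= L ->
  (forall t0, 0 < t0 -> exists2 K', 0 <= K' & forall d (T : measurableType d) Pr n X N W,
    (0 < n)%N -> C d T Pr n X N W -> clt_ok Pr (n := n) t0 W w K') ->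
  (forall d (T : measurableType d) Pr n X N W, (0 < n)%N -> C d T Pr n X N W ->
    [/\ measurable_fun setT N, noise_ok Pr (fun o => addt (X o) (N o)) (S + s2) K &
      exists D, [/\ measurable D, Pr (~` D) = 0%E &
        forall o, D o -> W o = noise_excess S s2 (X o) (N o)]]) ->
  exists N0, forall n, (N0 <= n)%N -> exists x, [/\ 0 < x + 3 / n%:R,
    cap_tail (- ln (s2 / (S + s2)) / 2) L x n <= e &
    forall d (T : measurableType d) Pr X N W, C d T Pr n X N W ->
      (Pr (~` ratio_good N (fun o => addt (X o) (N o)) x) <= (eps + e)%:E)%E].
Proof.
move=> S0 s20 w0 eps01 e0 QL hclt hC.
have e40 : 0 < e / 4 by lra.
have D0 : 0 < S + s2 by lra.
have [eta [t0 [k [eta0 t00 Pk tl]]]] := normal_tail w0 eps01 e40 QL.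
have [K' K'0 hK'] := hclt t0 t00.
set x0 := s2 / (S + s2); set l := L - eta / 2.
have x00 : 0 < x0 by rewrite divr_gt0.
have x01 : x0 < 1 by rewrite ltr_pdivrMr// mul1r; lra.
have lL : l < L by rewrite /l; lra.
have k3 : 0 <= 3 :> R by lra.
have [N0 h0] := cap_bound_vanish (introT andP (conj x00 x01)) lL k3 e0.
(* The first bound on the deviation of the output energy feeds [ratio_good_excess], the second keeps
   the output nonzero. *)
pose del := Num.min (eta / 2 * (S + s2) / (1 + `|l|)) ((S + s2) / 2).
have l1 : 0 < 1 + `|l| by rewrite ltr_pwDl.
have del0 : 0 < del by rewrite lt_min !divr_gt0// mulr_gt0// divr_gt0.
have [N1 h1] := div_sqrt_small (K' / Phi k) e40.
have [N2 h2] := div_nat_small (K / del ^+ 2) e40.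
exists (maxn 1 (maxn N0 (maxn N1 N2))) => n; rewrite !geq_max.
move=> /andP[n0 /andP[/h0 [g0 g0'] /andP[/h1 g1 /h2 g2]]].
have nR : (0 : R) < n%:R by rewrite ltr0n.
exists (x0 * (1 + 2 * l / Num.sqrt n%:R)); split => //.
  by move: g0'; rewrite /cap_tail -mulrA.
move=> d T Pr X N W CW.
have [mN nY [D [mD PD WD]]] := hC _ _ _ _ _ _ _ n0 CW.
have cW := hK' _ _ _ _ _ _ _ n0 CW; have mW := cW.1; have mY := nY.1.
set Y := fun o => _ in nY mY *.
pose A := [set o | L - eta <= W o].
pose B := [set o | del <= `|sqnorm (tnth (Y o)) / n%:R - (S + s2)|].
have mA : measurable A by exact: measurable_set_le.
have mB : measurable B.
  apply: measurable_set_le => //; apply: measurableT_comp => //.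
  apply: measurable_funB => //; apply: measurable_funM => //; exact: measurable_sqnorm.
have sub : ~` ratio_good N Y (x0 * (1 + 2 * l / Num.sqrt n%:R)) `<=` ~` D `|` (A `|` B).
  move=> o; apply: contra_notP => /not_orP[/contrapT Do /not_orP[nA nB]].
  have {}nA : W o < L - eta by rewrite ltNge; exact/negP.
  have {}nB : `|sqnorm (tnth (Y o)) / n%:R - (S + s2)| < del by rewrite ltNge; exact/negP.
  rewrite WD// in nA.
  move: nB; rewrite lt_min => /andP[nB1 nB2]; split.
    apply: ratio_good_excess n0 S0 s20 nA _.
    move: nB1; rewrite ltr_pdivlMr// => nB1; apply: ltW.
    apply: le_lt_trans nB1; rewrite mulrC ler_wpM2l// -/l.
    by rewrite lerDr.
  have : 0 < sqnorm (tnth (Y o)) / n%:R.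
    by move: nB2; rewrite ltr_norml => /andP[]; lra.
  by rewrite pmulr_lgt0// invr_gt0.
apply: (@le_trans _ _ (Pr (~` D `|` (A `|` B)))).
  apply: le_measure; rewrite ?inE//; first by apply: measurableC; exact: measurable_ratio_good.
  by apply: measurableU; [exact: measurableC|exact: measurableU].
apply: le_trans (measureU2 _ _ _) _; [exact: measurableC|exact: measurableU|].
rewrite [X in (X + _)%E](_ : _ = 0%E) ?add0e; last exact: PD.
apply: le_trans (measureU2 _ mA mB) _.
apply: (@le_trans _ _ ((eps + e / 4 + e / 4)%:E + (e / 4)%:E)%E).
  apply: leeD.
    apply: le_trans (clt_ok_tail _ t00 Pk cW) _; rewrite lee_fin mulrDl lerD//.
    by rewrite mulrAC.
  apply: le_trans (noise_dev n0 del0 nY) _; rewrite lee_fin.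
  by rewrite invfM mulrA mulrAC.
by rewrite -EFinD lee_fin; lra.
Qed.

End asymptotics.

(** * Asymptotic error probabilities of the two users *)

Section users.
Context {R : realType}.

Lemma avg_err_le d (T : measurableType d) (Pr : probability T R) M1 M2
    (E : 'I_M1 -> 'I_M2 -> set T) (c : R) :
  (0 < M1)%N -> (0 < M2)%N -> (forall w1 w2, (Pr (E w1 w2) <= c%:E)%E) ->
  (avg_err Pr E <= c%:E)%E.
Proof.
move=> M10 M20 Ec; rewrite /avg_err.
have M0 : 0 < (M1 * M2)%:R :> R by rewrite ltr0n muln_gt0 M10.
apply: (@le_trans _ _ (((M1 * M2)%:R^-1)%:E *
    \sum_(w1 < M1) \sum_(w2 < M2) c%:E)%E).
  apply: lee_wpmul2l; first by rewrite lee_fin invr_ge0 ltW.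
  by apply: lee_sum => w1 _; apply: lee_sum => w2 _.
under eq_bigr do rewrite sumEFin.
rewrite sumEFin -EFinM lee_fin !sumr_const !card_ord -mulrnA -[X in _ * X]mulr_natl.
by rewrite [(M2 * M1)%N]mulnC mulKf// gt_eqF.
Qed.

Lemma capC_ratio (S s : R) : 0 < S -> 0 < s -> capC (S / s) = - ln (s / (S + s)) / 2.
Proof.
move=> S0 s0; rewrite /capC -lnV ?posrE ?divr_gt0 ?addr_gt0//.
by rewrite invf_div mulrDl divff ?gt_eqF// addrC.
Qed.

Lemma capC_gt0 (S s : R) : 0 < S -> 0 < s -> 0 < capC (S / s).
Proof. by move=> S0 s0; rewrite /capC divr_gt0// ln_gt0// ltrDl divr_gt0. Qed.

Lemma expR_capC (S s : R) : 0 < S -> 0 < s -> expR (- 2 * capC (S / s)) = s / (S + s).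
Proof.
move=> S0 s0; rewrite capC_ratio//.
have -> : - 2 * (- ln (s / (S + s)) / 2) = ln (s / (S + s)) by field.
by rewrite lnK// posrE divr_gt0// addr_gt0.
Qed.

Lemma codebook_tail (M n : nat) (C L x e : R) : 0 < x + 3 / n%:R ->
  M%:R <= expR (n%:R * C - L * Num.sqrt n%:R) -> cap_tail C L x n <= e ->
  M%:R * (n%:R ^+ 2 * (x + 3 / n%:R) ^+ n./2) <= e.
Proof.
move=> x0 hM; apply: le_trans; apply: ler_wpM2r => //.
by rewrite mulr_ge0 ?exprn_ge0// ltW.
Qed.

Section noise.
Variables (mu : probability R R) (s2 z4 m6 alpha P : R).
Hypothesis mu2 : (\int[mu]_x (x ^+ 2)%:E = s2%:E)%E.
Hypothesis mu4 : (\int[mu]_x (x ^+ 4)%:E = z4%:E)%E.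
Hypothesis mu6 : (\int[mu]_x (x ^+ 6)%:E = m6%:E)%E.
Hypotheses (s20 : 0 < s2) (a01 : 0 < alpha < 1) (P0 : 0 < P).

Let S1 := alpha * P.
Let S2 := (1 - alpha) * P.
Let S10 : 0 < S1. Proof. by case/andP: a01 => a0 _; rewrite mulr_gt0. Qed.
Let S20 : 0 < S2. Proof. by case/andP: a01 => _ a1; rewrite mulr_gt0// subr_gt0. Qed.
Let v0 : 0 <= z4 - s2 ^+ 2. Proof. exact: (square_variance_ge0 mu2 mu4 mu6). Qed.

(** Decoding V from V + Z takes place at capacity; this is the one error of user 1 on which [eps] is
    spent. *)
Lemma confusion_V_vanish (eps L e : R) : 0 < eps < 1 -> 0 < e ->
  Num.sqrt (V1 s2 z4 S1) * Qinv eps <= L ->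
  exists N0, forall n, (N0 <= n)%N ->
  forall d (T : measurableType d) (Pr : probability T R) M1 M2 (Z : 'I_n -> T -> R)
    (V : 'I_M1 -> T -> n.-tuple R) (U : 'I_M2 -> T -> n.-tuple R) w1 (w2 : 'I_M2),
  M1%:R <= expR (n%:R * capC (S1 / s2) - L * Num.sqrt n%:R) ->
  bc_model Pr alpha P mu Z V U ->
  measurable (confusion (noise_tuple Z) (interference Z V w1) V w1) /\
  (Pr (confusion (noise_tuple Z) (interference Z V w1) V w1) <= (eps + e)%:E)%E.
Proof.
move=> eps01 e0 QL; have e20 : 0 < e / 2 by lra.
pose D0 := 2 * s2 * (S1 + s2).
have D00 : 0 < D0 by rewrite !mulr_gt0// addr_gt0.
(* The coefficients of [noise_excess] once |V|^2 = n S1 is inserted; with them the limit variance is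
   [V1]. *)
pose c1 := S1 / D0; pose c2 := - (2 * s2) / D0.
have V1E : V1 s2 z4 S1 = c1 ^+ 2 * (z4 - s2 ^+ 2) + c2 ^+ 2 * S1 * s2.
  by rewrite /V1 /c1 /c2 /D0; field; rewrite !gt_eqF// addr_gt0.
have V10 : 0 < V1 s2 z4 S1.
  rewrite V1E ltr_wpDl//; first by rewrite mulr_ge0// sqr_ge0.
  have c20 : 0 < c2 ^+ 2.
    by rewrite exprn_even_gt0//= mulf_neq0 ?oppr_eq0 ?invr_eq0 ?gt_eqF// mulr_gt0.
  exact: mulr_gt0 (mulr_gt0 c20 S10) s20.
pose C d (T : measurableType d) (Pr : probability T R) n (X N : T -> n.-tuple R) (W : T -> R) :=
  exists M1 M2 (Z : 'I_n -> T -> R) (V : 'I_M1 -> T -> n.-tuple R)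
    (U : 'I_M2 -> T -> n.-tuple R) w1, [/\ bc_model Pr alpha P mu Z V U,
    X = V w1, N = noise_tuple Z & W = strong_stat s2 Z V w1 c1 c2].
have [||N0 hN0] := @second_order R S1 s2 (V1 s2 z4 S1) eps L
  (noise_bound S1 s2 (z4 - s2 ^+ 2)) (e / 2) C S10 s20 V10 eps01 e20 QL.
- move=> t0 t00; have [K K0 hK] := clt_strong_stat mu2 mu4 mu6 a01 P0 c1 c2 t00.
  exists K => // d T Pr n X N W n0 [M1 [M2 [Z [V [U [w1 [bc _ _ ->]]]]]]].
  by rewrite V1E; exact: hK n0 bc.
- move=> d T Pr n X N W n0 [M1 [M2 [Z [V [U [w1 [bc -> -> ->]]]]]]].
  have nR : (0 : R) < n%:R by rewrite ltr0n.
  split.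
  + exact: (measurable_noise_tuple bc).
  + exact: (noise_ok_interference mu2 mu4 mu6 a01 P0 w1 n0 bc).
  + have [mD PD] := sphere_rv_as (model_sphereV bc w1).
    exists [set w | sqnorm (tnth (V w1 w)) = n%:R * (alpha * P)]; split => // o /= hV.
    rewrite /noise_excess /strong_stat sqnorm_addt hV -/S1.
    have q0 : 0 < Num.sqrt n%:R :> R by rewrite sqrtr_gt0.
    have nE : n%:R = Num.sqrt n%:R ^+ 2 :> R by rewrite sqr_sqrtr// ltW.
    move: (Num.sqrt _) q0 nE (sqnorm _) (dotp _ _) => q q0 -> A B.
    rewrite /c1 /c2 /D0; field.
    by rewrite !gt_eqF// addr_gt0.
exists (maxn 2 N0) => n; rewrite geq_max => /andP[n2 /hN0 [x [x0 tx hx]]].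
move=> d T Pr M1 M2 Z V U w1 w2 hM bc.
have [mE hE] := confusion_V_bound w1 w2 n2 P0 a01 bc x0.
split => //; apply: le_trans hE _.
have -> : eps + e = (eps + e / 2) + e / 2 by field.
rewrite EFinD; apply: leeD; last by rewrite lee_fin; apply: codebook_tail hM _; rewrite // capC_ratio.
by apply: (hx _ _ Pr (V w1) (noise_tuple Z) (strong_stat s2 Z V w1 c1 c2));
  exists M1, M2, Z, V, U, w1.
Qed.

(** The noise of user 2 is V + Z, whose energy fluctuates with |Z|^2 and with 2 <V, Z>; together
    with <U, V + Z> this gives three variances that add up to [V2]. *)
Lemma err_weak_second_order (eps L e : R) : 0 < eps < 1 -> 0 < e -> s2 = 1 ->
  Num.sqrt (V2 z4 S2 S1) * Qinv eps <= L ->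
  exists N0, forall n, (N0 <= n)%N ->
  forall d (T : measurableType d) (Pr : probability T R) M1 M2 (Z : 'I_n -> T -> R)
    (V : 'I_M1 -> T -> n.-tuple R) (U : 'I_M2 -> T -> n.-tuple R) w1 w2,
  M2%:R <= expR (n%:R * capC (S2 / (S1 + 1)) - L * Num.sqrt n%:R) ->
  bc_model Pr alpha P mu Z V U ->
  (Pr (err_weak Z V U w1 w2) <= (eps + e)%:E)%E.
Proof.
move=> eps01 e0 s21 QL; have e20 : 0 < e / 2 by lra.
have s0 : 0 < S1 + s2 by exact: addr_gt0.
have Ss0 : 0 < S2 + (S1 + s2) by exact: addr_gt0.
pose D0 := 2 * (S1 + s2) * (S2 + (S1 + s2)).
have D00 : 0 < D0 by rewrite !mulr_gt0.
(* In [noise_excess] the energy of V + Z has weight c1, so <V, Z> gets c2 = 2 c1; c3 belongs to <U,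
   V + Z>. *)
pose c1 := S2 / D0; pose c2 := 2 * S2 / D0; pose c3 := - (2 * (S1 + s2)) / D0.
have V2E : V2 z4 S2 S1 =
    c1 ^+ 2 * (z4 - s2 ^+ 2) + c2 ^+ 2 * S1 * s2 + c3 ^+ 2 * S2 * (S1 + s2).
  rewrite /V2 /c1 /c2 /c3 /D0 s21; field.
  by rewrite -s21 !gt_eqF.
have V20 : 0 < V2 z4 S2 S1.
  rewrite V2E ltr_wpDl//.
    apply: addr_ge0; first exact: mulr_ge0 (sqr_ge0 c1) v0.
    exact: mulr_ge0 (mulr_ge0 (sqr_ge0 c2) (ltW S10)) (ltW s20).
  have c30 : 0 < c3 ^+ 2.
    by rewrite exprn_even_gt0//= mulf_neq0 ?oppr_eq0 ?invr_eq0 ?gt_eqF// mulr_gt0.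
  exact: mulr_gt0 (mulr_gt0 c30 S20) s0.
pose C d (T : measurableType d) (Pr : probability T R) n (X N : T -> n.-tuple R) (W : T -> R) :=
  exists M1 M2 (Z : 'I_n -> T -> R) (V : 'I_M1 -> T -> n.-tuple R)
    (U : 'I_M2 -> T -> n.-tuple R) w1 w2, [/\ bc_model Pr alpha P mu Z V U,
    X = U w2, N = interference Z V w1 & W = weak_stat s2 Z V U w1 w2 c1 c2 c3].
have [||N0 hN0] := @second_order R S2 (S1 + s2) (V2 z4 S2 S1) eps L
  (noise_bound S2 (S1 + s2) (noise_bound S1 s2 (z4 - s2 ^+ 2)))
  (e / 2) C S20 s0 V20 eps01 e20 QL.
- move=> t0 t00; have [K K0 hK] := clt_weak_stat mu2 mu4 mu6 a01 P0 c1 c2 c3 t00.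
  exists K => // d T Pr n X N W n0 [M1 [M2 [Z [V [U [w1 [w2 [bc _ _ ->]]]]]]]].
  by rewrite V2E; exact: hK n0 bc.
- move=> d T Pr n X N W n0 [M1 [M2 [Z [V [U [w1 [w2 [bc -> -> ->]]]]]]]].
  have nR : (0 : R) < n%:R by rewrite ltr0n.
  split.
  + exact: (measurable_interference w1 bc).
  + exact: (noise_ok_output mu2 mu4 mu6 a01 P0 w1 w2 n0 bc).
  + have [mD PD] := sphere_rv_as (model_sphereV bc w1).
    have [mD' PD'] := sphere_rv_as (model_sphereU bc w2).
    set A := [set w | _] in mD PD; set B := [set w | _] in mD' PD'.
    exists (A `&` B); split.
    * exact: measurableI.
    * rewrite setCI; apply/eqP; rewrite eq_le measure_ge0 andbT.
      apply: le_trans (measureU2 _ _ _) _; [exact: measurableC|exact: measurableC|].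
      rewrite [X in (X + _)%E](_ : _ = 0%E) ?add0e; last exact: PD.
      by rewrite le_eqVlt; apply/orP; left; apply/eqP; exact: PD'.
    * move=> o [/= hV hU].
      rewrite /noise_excess /weak_stat /strong_stat sqnorm_addt hU -/S2.
      rewrite [sqnorm (tnth (interference _ _ _ _))]sqnorm_addt hV -/S1.
      have q0 : 0 < Num.sqrt n%:R :> R by rewrite sqrtr_gt0.
      have nE : n%:R = Num.sqrt n%:R ^+ 2 :> R by rewrite sqr_sqrtr// ltW.
      move: (Num.sqrt _) q0 nE => q q0 ->.
      move: (sqnorm _) (dotp (U w2 o) _) (dotp _ _) => a b b'.
      rewrite /c1 /c2 /c3 /D0 s21; field.
      by rewrite -s21 !gt_eqF.
exists (maxn 2 N0) => n; rewrite geq_max => /andP[n2 /hN0 [x [x0 tx hx]]].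
move=> d T Pr M1 M2 Z V U w1 w2 hM bc.
have [mE hE] := err_weak_bound w1 w2 n2 P0 a01 bc x0.
apply: le_trans hE _.
have -> : eps + e = (eps + e / 2) + e / 2 by field.
rewrite EFinD; apply: leeD.
  by apply: (hx _ _ Pr (U w2) (interference Z V w1) (weak_stat s2 Z V U w1 w2 c1 c2 c3));
    exists M1, M2, Z, V, U, w1, w2.
rewrite lee_fin; apply: codebook_tail hM _ => //.
by move: tx; rewrite -capC_ratio// s21.
Qed.

(** * Errors of user 1 in the message of user 2, below capacity *)

Section first_order_events.
Hypothesis s21 : s2 < 1.
Variables (L1 L2 e : R).
Hypothesis e0 : 0 < e.

Let C1 := capC (S1 / s2).
Let C2 := capC (S2 / (S1 + 1)).
Let S1s : 0 < S1 + 1. Proof. exact: addr_gt0. Qed.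
Let C10 : 0 < C1. Proof. exact: capC_gt0. Qed.
Let C20 : 0 < C2. Proof. exact: capC_gt0. Qed.
Let e20 : 0 < e / 2. Proof. by rewrite divr_gt0. Qed.
Let ee : e = e / 2 + e / 2. Proof. by field. Qed.
Let s2w := ltW s20.
Let s2c : 0 < 1 - s2. Proof. by rewrite subr_gt0. Qed.

Lemma err_weak_first_order :
  exists N0, forall n, (N0 <= n)%N ->
  forall d (T : measurableType d) (Pr : probability T R) M1 M2 (Z : 'I_n -> T -> R)
    (V : 'I_M1 -> T -> n.-tuple R) (U : 'I_M2 -> T -> n.-tuple R) w1 w2,
  M2%:R <= expR (n%:R * C2 - L2 * Num.sqrt n%:R) ->
  bc_model Pr alpha P mu Z V U ->
  measurable (err_weak Z V U w1 w2) /\ (Pr (err_weak Z V U w1 w2) <= e%:E)%E.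
Proof.
have a0 : 0 <= S1 + s2 by rewrite ltW// addr_gt0.
(* After clearing denominators the gap is (1 - s2) S2: the rate of U is designed for noise of
   variance 1. *)
have ab : S1 + s2 < expR (- 2 * C2) * (S2 + (S1 + s2)).
  rewrite expR_capC// mulrAC ltr_pdivlMr ?addr_gt0//.
  by have := mulr_gt0 S20 s2c; lra.
have [N0 hN0] := first_order L2 (noise_bound S1 s2 (z4 - s2 ^+ 2))
  (noise_bound S2 (S1 + s2) (noise_bound S1 s2 (z4 - s2 ^+ 2))) a0 ab C20 e20.
exists (maxn 2 N0) => n; rewrite geq_max => /andP[n2 /hN0 [x [x0 tx hx]]].
move=> d T Pr M1 M2 Z V U w1 w2 hM bc; have n0 := ltnW n2.
have [mE hE] := err_weak_bound w1 w2 n2 P0 a01 bc x0; split => //.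
apply: le_trans hE _; rewrite [in leRHS]ee EFinD; apply: leeD.
  apply: hx; first exact: (noise_ok_interference mu2 mu4 mu6 a01 P0 w1 n0 bc).
  exact: (noise_ok_output mu2 mu4 mu6 a01 P0 w1 w2 n0 bc).
by rewrite lee_fin; exact: codebook_tail hM tx.
Qed.

Lemma confusion_U_vanish :
  exists N0, forall n, (N0 <= n)%N ->
  forall d (T : measurableType d) (Pr : probability T R) M1 M2 (Z : 'I_n -> T -> R)
    (V : 'I_M1 -> T -> n.-tuple R) (U : 'I_M2 -> T -> n.-tuple R) (w1 : 'I_M1) w2,
  M2%:R <= expR (n%:R * C2 - L2 * Num.sqrt n%:R) ->
  bc_model Pr alpha P mu Z V U ->
  measurable (confusion (noise_tuple Z) (strong_output Z U w2) U w2) /\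
  (Pr (confusion (noise_tuple Z) (strong_output Z U w2) U w2) <= e%:E)%E.
Proof.
(* With V removed the gap grows to S1 S2 + (1 - s2) S2. *)
have ab : s2 < expR (- 2 * C2) * (S2 + s2).
  rewrite expR_capC// mulrAC ltr_pdivlMr ?addr_gt0//.
  have := mulr_gt0 S20 s2c.
  by have := mulr_gt0 S10 S20; lra.
have [N0 hN0] := first_order L2 (z4 - s2 ^+ 2) (noise_bound S2 s2 (z4 - s2 ^+ 2))
  s2w ab C20 e20.
exists (maxn 2 N0) => n; rewrite geq_max => /andP[n2 /hN0 [x [x0 tx hx]]].
move=> d T Pr M1 M2 Z V U w1 w2 hM bc; have n0 := ltnW n2.
have [mE hE] := confusion_U_bound w1 w2 n2 P0 a01 bc x0; split => //.
apply: le_trans hE _; rewrite [in leRHS]ee EFinD; apply: leeD.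
  apply: hx; first exact: (noise_ok_noise mu2 mu4 mu6 n0 bc).
  exact: (noise_ok_strong_output mu2 mu4 mu6 a01 P0 w1 w2 n0 bc).
by rewrite lee_fin; exact: codebook_tail hM tx.
Qed.

Lemma confusion2_vanish :
  exists N0, forall n, (N0 <= n)%N ->
  forall d (T : measurableType d) (Pr : probability T R) M1 M2 (Z : 'I_n -> T -> R)
    (V : 'I_M1 -> T -> n.-tuple R) (U : 'I_M2 -> T -> n.-tuple R) w1 w2,
  M1%:R <= expR (n%:R * C1 - L1 * Num.sqrt n%:R) ->
  M2%:R <= expR (n%:R * C2 - L2 * Num.sqrt n%:R) ->
  bc_model Pr alpha P mu Z V U ->
  measurable (confusion2 (noise_tuple Z) (output Z V U w1 w2) V U w1 w2) /\
  (Pr (confusion2 (noise_tuple Z) (output Z V U w1 w2) V U w1 w2) <= e%:E)%E.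
Proof.
(* The sum rate is below the joint capacity of user 1, with the gap (1 - s2) S2 again. *)
have ab : s2 < expR (- 2 * (C1 + C2)) * (S2 + (S1 + s2)).
  rewrite [- 2 * _]mulrDr expRD !expR_capC//.
  rewrite [X in _ < X](_ : _ = s2 * ((S1 + 1) * (S2 + (S1 + s2)) / ((S1 + s2) * (S2 + (S1 + 1))))).
    rewrite ltr_pMr// ltr_pdivlMr ?mulr_gt0 ?addr_gt0// mul1r.
    by have := mulr_gt0 S20 s2c; lra.
  by field; rewrite !gt_eqF ?addr_gt0.
have [N0 hN0] := first_order (L1 + L2) (z4 - s2 ^+ 2)
  (noise_bound S2 (S1 + s2) (noise_bound S1 s2 (z4 - s2 ^+ 2))) s2w ab (addr_gt0 C10 C20) e20.
exists (maxn 2 N0) => n; rewrite geq_max => /andP[n2 /hN0 [x [x0 tx hx]]].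
move=> d T Pr M1 M2 Z V U w1 w2 hM1 hM2 bc; have n0 := ltnW n2.
have [mE hE] := confusion2_joint_bound w1 w2 n2 P0 a01 bc x0; split => //.
apply: le_trans hE _; rewrite [in leRHS]ee EFinD; apply: leeD.
  apply: hx; first exact: (noise_ok_noise mu2 mu4 mu6 n0 bc).
  exact: (noise_ok_output mu2 mu4 mu6 a01 P0 w1 w2 n0 bc).
rewrite lee_fin; apply: codebook_tail _ tx => //.
rewrite natrM (_ : _ - _ = (n%:R * C1 - L1 * Num.sqrt n%:R) + (n%:R * C2 - L2 * Num.sqrt n%:R)).
  by rewrite expRD ler_pM.
by ring.
Qed.

End first_order_events.

(** Both decoders share the confusion of V, which accounts for [eps]. The events with a wrong U, one
    for SIC and two for JNN, vanish for any L2 because their rates are below capacity. *)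
Lemma err_strong_vanish (dec : decoder) (eps L1 L2 e : R) :
  s2 < 1 -> 0 < eps < 1 -> 0 < e -> Num.sqrt (V1 s2 z4 S1) * Qinv eps <= L1 ->
  exists N0, forall n, (N0 <= n)%N ->
  forall d (T : measurableType d) (Pr : probability T R) M1 M2 (Z : 'I_n -> T -> R)
    (V : 'I_M1 -> T -> n.-tuple R) (U : 'I_M2 -> T -> n.-tuple R) w1 w2,
  M1%:R <= expR (n%:R * capC (S1 / s2) - L1 * Num.sqrt n%:R) ->
  M2%:R <= expR (n%:R * capC (S2 / (S1 + 1)) - L2 * Num.sqrt n%:R) ->
  bc_model Pr alpha P mu Z V U ->
  (Pr (err_strong Z V U dec w1 w2) <= (eps + e)%:E)%E.
Proof.
move=> s21 eps01 e0 QL; have e30 : 0 < e / 3 by lra.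
have [Na hNa] := confusion_V_vanish eps01 e30 QL.
have [Nb hNb] := err_weak_first_order s21 L2 e30.
have [Nc hNc] := confusion_U_vanish s21 L2 e30.
have [Nd hNd] := confusion2_vanish s21 L1 L2 e30.
exists (maxn (maxn Na Nb) (maxn Nc Nd)) => n; rewrite !geq_max.
move=> /andP[/andP[/hNa {}hNa /hNb {}hNb] /andP[/hNc {}hNc /hNd {}hNd]].
move=> d T Pr M1 M2 Z V U w1 w2 hM1 hM2 bc.
have [mA hA] := hNa d T Pr M1 M2 Z V U w1 w2 hM1 bc.
have [mB hB] := hNb d T Pr M1 M2 Z V U w1 w2 hM2 bc.
have [mC hC] := hNc d T Pr M1 M2 Z V U w1 w2 hM2 bc.
have [mD hD] := hNd d T Pr M1 M2 Z V U w1 w2 hM1 hM2 bc.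
have -> : eps + e = (e / 3 + e / 3) + (eps + e / 3) by field.
case: dec => /=.
  rewrite err_SIC_E; apply: le_trans (measureU2 _ _ _) _ => //.
  rewrite EFinD; apply: leeD => //; apply: le_trans hB _.
  by rewrite lee_fin; lra.
rewrite err_JNN_E; apply: le_trans (measureU2 _ _ _) _ => //; first exact: measurableU.
rewrite EFinD; apply: leeD => //; apply: le_trans (measureU2 _ _ _) _ => //.
by rewrite EFinD; apply: leeD.
Qed.

End noise.
End users.

Theorem theorem1 (R : realType) (eps1 eps2 P alpha beta zeta1 zeta2 L1 L2 : R)
  (mu1 mu2 : probability R R) (dec : decoder) :
  0 < eps1 < 1 -> 0 < eps2 < 1 -> 0 < P -> 0 < alpha < 1 -> 0 < beta < 1 ->
  (\int[mu1]_x (x ^+ 2)%:E = beta%:E)%E ->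
  (\int[mu1]_x (x ^+ 4)%:E = zeta1%:E)%E ->
  (\int[mu1]_x (x ^+ 6)%:E < +oo)%E ->
  (\int[mu2]_x (x ^+ 2)%:E = 1%:E)%E ->
  (\int[mu2]_x (x ^+ 4)%:E = zeta2%:E)%E ->
  (\int[mu2]_x (x ^+ 6)%:E < +oo)%E ->
  Num.sqrt (V1 beta zeta1 (alpha * P)) * Qinv eps1 <= L1 ->
  Num.sqrt (V2 zeta2 ((1 - alpha) * P) (alpha * P)) * Qinv eps2 <= L2 ->
  exists M1 M2 : nat -> nat,
    (forall n, (0 < M1 n)%N) /\ (forall n, (0 < M2 n)%N) /\
    (limn_esup (fun n : nat =>
       ((n%:R * capC (alpha * P / beta) - ln (M1 n)%:R) / Num.sqrt n%:R)%:E)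
       <= L1%:E)%E /\
    (limn_esup (fun n : nat =>
       ((n%:R * capC ((1 - alpha) * P / (alpha * P + 1)) - ln (M2 n)%:R)
          / Num.sqrt n%:R)%:E)
       <= L2%:E)%E /\
    forall (d : nat -> measure_display) (T : forall n, measurableType (d n))
      (Pr : forall n, probability (T n) R)
      (Z1 Z2 : forall n, 'I_n -> T n -> R)
      (V : forall n, 'I_(M1 n) -> T n -> n.-tuple R)
      (U : forall n, 'I_(M2 n) -> T n -> n.-tuple R),
      (forall n, bc_model (Pr n) alpha P mu1 (Z1 n) (V n) (U n)) ->
      (forall n, bc_model (Pr n) alpha P mu2 (Z2 n) (V n) (U n)) ->
      (limn_esup (fun n => avg_err (Pr n) (err_strong (Z1 n) (V n) (U n) dec))
         <= eps1%:E)%E /\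
      (limn_esup (fun n => avg_err (Pr n) (err_weak (Z2 n) (V n) (U n)))
         <= eps2%:E)%E.
Proof.
move=> eps1_01 eps2_01 P0 a01 /andP[b0 b1] mu12 mu14 mu16 mu22 mu24 mu26 QL1 QL2.
have [a0 a1] := andP a01.
have S10 : 0 < alpha * P by exact: mulr_gt0.
have S20 : 0 < (1 - alpha) * P by rewrite mulr_gt0// subr_gt0.
have S1s : 0 < alpha * P + 1 by exact: addr_gt0.
have sixth (mu : probability R R) : (\int[mu]_x (x ^+ 6)%:E < +oo)%E ->
    (\int[mu]_x (x ^+ 6)%:E = (fine (\int[mu]_x (x ^+ 6)%:E))%:E)%E.
  move=> h; rewrite fineK// ge0_fin_numE//.
  by apply: integral_ge0 => x _; rewrite lee_fin exprn_even_ge0.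
have C10 := capC_gt0 S10 b0; have C20 := capC_gt0 S20 S1s.
exists (codebook_size (capC (alpha * P / beta)) L1).
exists (codebook_size (capC ((1 - alpha) * P / (alpha * P + 1))) L2).
split; [by move=> n; exact: codebook_size_gt0|].
split; [by move=> n; exact: codebook_size_gt0|].
split; [exact: codebook_rate|split; [exact: codebook_rate|]].
move=> d T Pr Z1 Z2 V U bc1 bc2.
have [N1 hN1] := codebook_size_le L1 C10; have [N2 hN2] := codebook_size_le L2 C20.
split; apply: limn_esup_le => e e0.
  have [N hN] := err_strong_vanish mu12 mu14 (sixth _ mu16) b0 a01 P0 dec L2 b1
    eps1_01 e0 QL1.
  exists (maxn N (maxn N1 N2)) => n; rewrite !geq_max => /andP[/hN h /andP[/hN1 h1 /hN2 h2]].
  apply: avg_err_le; try exact: codebook_size_gt0.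
  by move=> w1 w2; apply: h.
have [N hN] := err_weak_second_order mu22 mu24 (sixth _ mu26) ltr01 a01 P0 eps2_01 e0 erefl QL2.
exists (maxn N N2) => n; rewrite !geq_max => /andP[/hN h /hN2 h2].
apply: avg_err_le; try exact: codebook_size_gt0.
by move=> w1 w2; apply: h.
Qed.
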